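(* Let $\Omega\subset\mathbb{R}^d$ be open, let $a,q$ satisfy the regularity Assumption (A) of the context, assume in addition that $q\in L^2_{\rm loc}(\Omega)$, and let $G$ be the operator in $\mathcal H=\mathcal W(\Omega)\times L^2(\Omega)$ defined in the context. Let $\lambda\in(-\infty,0)$. Suppose that $\Omega$ contains a tubular neighborhood $$U_\omega=\{(x_1,x')\in\mathbb{R}\times\mathbb{R}^{d-1}:x_1>0,\ |x'|<\omega(x_1)^{-1}\}$$ of the ray $\Gamma=\{(x_1,0):x_1>0\}$, where $\omega:(0,\infty)\to(0,\infty)$ is continuous (for $d=1$: $U_\omega=\Gamma=(0,\infty)$ and no function $\omega$ is needed), such that: (i) there is a decomposition $$q(x)+2\lambda a(x)+\lambda^2=-A(x_1)+B(x),\qquad x\in U_\omega,$$ where $A\in C^1(\mathbb{R}_+)$ satisfies $$\lim_{u\to+\infty}A(u)=+\infty,\qquad\lim_{u\to+\infty}\frac{|A'(u)|}{A(u)}=0,$$ and $$\lim_{n\to\infty}\ \operatorname*{ess\,sup}_{x\in U_\omega,\,|x|>n}\ \frac{|B(x)|^2}{A(x_1)}=0;$$ (ii) if $d>1$, then $\omega\in C^2(\mathbb{R}_+)$ and, as $u\to\infty$, $$\frac{\omega'(u)}{\omega(u)}=o(1),\qquad\frac{\omega''(u)}{\omega(u)^3}=O(1),\qquad\frac{\omega(u)^4}{A(u)}=o(1).$$ Then $\lambda\in\sigma_{\rm e2}(G)$.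
   Context: $\mathbb{R}_+=(0,\infty)$; points of $\mathbb{R}^d$ are written $x=(x_1,x')$ with $x_1\in\mathbb{R}$, $x'\in\mathbb{R}^{d-1}$; $A$ is real-valued. $\|\cdot\|$, $\langle\cdot,\cdot\rangle$ are the norm and inner product of $L^2(\Omega)$. The domain of multiplication by a measurable function $m$ in $L^2(\Omega)$ is maximal: $\operatorname{Dom}(m)=\{\psi\in L^2(\Omega): m\psi\in L^2(\Omega)\}$. The operator $-\Delta+q$ is the Dirichlet realization defined via its form, with $$\operatorname{Dom}(-\Delta+q)=\{\phi\in W^{1,2}_0(\Omega)\cap\operatorname{Dom}(q^{1/2}): (-\Delta+q)\phi\in L^2(\Omega)\}.$$ Assumption (A). $a\in L^2_{\rm loc}(\Omega;\mathbb{R})$, $q\in L^1_{\rm loc}(\Omega;\mathbb{R})$, $a,q\ge0$, and $a=a_{\rm r}+a_{\rm s}$ with $a_{\rm r}\ge0$, $a_{\rm r}\in W^{1,\infty}_{\rm loc}(\overline\Omega;\mathbb{R})$ (i.e. $a_{\rm r}\in W^{1,\infty}(\Omega\cap B)$ for every bounded open ball $B\subset\mathbb{R}^d$), $a_{\rm s}\in L^2_{\rm loc}(\Omega;\mathbb{R})$, such that: for every $\varepsilon>0$ there is $M_\nabla=M_\nabla(\varepsilon)>0$ with $$|\nabla a_{\rm r}|\le \varepsilon a_{\rm r}^{3/2}+M_\nabla(q^{1/2}+1);$$ and for every $\varepsilon>0$ there is $M_{\rm s}=M_{\rm s}(\varepsilon)>0$ such that for all $\psi\in\operatorname{Dom}(a_{\rm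 r})\cap\operatorname{Dom}(-\Delta+q)$, $$\|a_{\rm s}\psi\|\le\varepsilon(\|(-\Delta+q)\psi\|+\|a_{\rm r}\psi\|)+M_{\rm s}\|\psi\|.$$ Definition of $G$. $\mathcal W(\Omega)$ is the completion of $C_0^\infty(\Omega)$ with respect to the inner product $\langle\nabla\cdot,\nabla\cdot\rangle+\langle q^{1/2}\cdot,q^{1/2}\cdot\rangle$; $W_0^{1,2}(\Omega)\cap\operatorname{Dom}(q^{1/2})$ is regarded as a subspace of $\mathcal W(\Omega)$. The Hilbert space $\mathcal H=\mathcal W(\Omega)\times L^2(\Omega)$ has inner product $\langle(\phi_1,\phi_2),(\psi_1,\psi_2)\rangle_{\mathcal H}=\langle\nabla\phi_1,\nabla\psi_1\rangle+\langle q^{1/2}\phi_1,q^{1/2}\psi_1\rangle+\langle\phi_2,\psi_2\rangle$. In $\mathcal H$, $G:=\overline{G_0}$ is the closure of the (closable) operator $$G_0=\begin{pmatrix}0& I\\ \Delta-q&-2a\end{pmatrix},\qquad \operatorname{Dom}(G_0)=\big(\operatorname{Dom}(-\Delta+q)\cap\operatorname{Dom}(a)\big)^2 .$$ The essential spectrum $\sigma_{\rm e2}(A)$ of an operator $A$ is the set of $\lambda\in\mathbb{C}$ for which there is a sequence $\{\psi_n\}\subset\operatorname{Dom}(A)$ with $\|\psi_n\|=1$, $\psi_n\to0$ weakly and $(A-\lambda)\psi_n\to0$. *)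

(* Defs.v *)
From HB Require Import structures.
From mathcomp Require Import all_boot all_order all_algebra.
From mathcomp Require Import generic_quotient ring_quotient complex.
From mathcomp Require Import ring.
From mathcomp Require Import all_classical all_reals all_analysis.
From mathcomp Require Import ess_sup_inf.

Set Implicit Arguments.
Unset Strict Implicit.
Unset Printing Implicit Defensive.

Import Order.TTheory GRing.Theory Num.Theory.
Import numFieldNormedType.Exports.

Local Open Scope classical_set_scope.
Local Open Scope ring_scope.
Local Open Scope complex_scope.

(** Lebesgue measure on R^d; the sigma-algebra of 'rV[T]_d is generated by the
    coordinate maps (for T = R: the Borel sets of R^d). *)

Definition rv_display : measure_display -> measure_display.
Proof. exact. Qed.

Section measurable_rv.
Context {d} {T : measurableType d} (n : nat).

Let coors : 'I_n -> 'rV[T]_n -> T := fun i x => x ord0 i.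

Let rv_set0 : g_sigma_preimage coors set0.
Proof. exact: sigma_algebra0. Qed.

Let rv_setC A : g_sigma_preimage coors A -> g_sigma_preimage coors (~` A).
Proof. exact: sigma_algebraC. Qed.

Let rv_bigcup (F : (set 'rV[T]_n)^nat) :
  (forall i, g_sigma_preimage coors (F i)) ->
  g_sigma_preimage coors (\bigcup_i (F i)).
Proof. exact: sigma_algebra_bigcup. Qed.

HB.instance Definition _ := @isMeasurable.Build (rv_display d)
  'rV[T]_n (g_sigma_preimage coors) rv_set0 rv_setC rv_bigcup.

End measurable_rv.

Lemma measurable_coor d (T : measurableType d) n (i : 'I_n) :
  measurable_fun [set: 'rV[T]_n] (fun x => x ord0 i).
Proof.
move=> _ Y mY; rewrite setTI; apply: sub_sigma_algebra => /=.
rewrite -bigcup_seq/=; exists i => /=; first by rewrite mem_index_enum.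
by exists Y => //; rewrite setTI.
Qed.

Lemma measurable_rvP d d' (S : measurableType d) (T : measurableType d') n
    (f : S -> 'rV[T]_n) :
  measurable_fun [set: S] f <->
  forall i, measurable_fun [set: S] (fun x => f x ord0 i).
Proof.
split=> [mf i|mf].
  exact: (measurableT_comp (@measurable_coor _ T n i) mf).
pose coors (i : 'I_n) (x : 'rV[T]_n) := x ord0 i.
suff H : preimage_set_system setT f (g_sigma_preimage coors) `<=` measurable.
  by move=> _ A mA; apply: H; exists A.
rewrite -(g_sigma_preimage_comp coors f).
apply: smallest_sub; first exact: sigma_algebra_measurable.
rewrite -bigcup_seq; apply: bigcup_sub => i _ _ [B mB <-].
exact: mf.
Qed.

Section lebesgue_rv.
Context {R : realType}.

Definition rv_cons n (p : 'rV[R]_n * measurableTypeR R) : 'rV[R]_n.+1 :=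
  \row_(i < n.+1) oapp (p.1 ord0) p.2 (unlift ord0 i).

Lemma measurable_rv_cons n : measurable_fun setT (@rv_cons n).
Proof.
apply/measurable_rvP => i.
case: (unliftP ord0 i) => [j ->|->].
  rewrite (_ : (fun _ => _) = (fun x : 'rV[R]_n => x ord0 j) \o fst); last first.
    by apply/funext => p; rewrite mxE liftK.
  by apply: measurableT_comp => //; exact: measurable_coor.
rewrite (_ : (fun _ => _) = snd) //.
by apply/funext => p; rewrite mxE unlift_none.
Qed.

Section step.
Context n (m : {measure set 'rV[R]_n -> \bar R}).

Definition lebesgue_rv_step : set 'rV[R]_n.+1 -> \bar R :=
  pushforward (m \x lebesgue_measure)%E (@rv_cons n).

HB.instance Definition _ := Measure.copy lebesgue_rv_step
  (measure_function_pushforward__canonical__measure_function_Measure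
    (m \x lebesgue_measure)%E (@measurable_rv_cons n)).

End step.

Fixpoint lebesgue_rv n : {measure set 'rV[R]_n -> \bar R} :=
  if n is m.+1 then lebesgue_rv_step (lebesgue_rv m) else \d_(0 : 'rV[R]_0).

Lemma lebesgue_rv_box n (B : 'I_n -> set (measurableTypeR R)) :
  (forall i, measurable (B i)) ->
  lebesgue_rv n [set x | forall i, B i (x ord0 i)] =
  (\prod_(i < n) lebesgue_measure (B i))%E.
Proof.
elim: n B => [B _|n IH B mB].
  by rewrite big_ord0 /= diracE mem_set// => -[].
rewrite big_ord_recl muleC -IH; last by move=> i; exact: mB.
have mbox : measurable [set x : 'rV[R]_n | forall i, B (lift ord0 i) (x ord0 i)].
  rewrite (_ : [set _ | _] = \bigcap_(i in [set: 'I_n])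
      (fun x : 'rV[R]_n => x ord0 i) @^-1` B (lift ord0 i)).
    apply: fin_bigcap_measurable => // i _; rewrite -[X in measurable X]setTI.
    by apply: measurable_coor => //; exact: mB.
  by apply/seteqP; split=> [x Bx i _|x Bx i]; [exact: Bx|exact: (Bx i I)].
rewrite -product_measure1E// /lebesgue_rv_step /pushforward /=.
rewrite -[LHS]/((lebesgue_rv n \x lebesgue_measure)%E _); congr product_measure1.
apply/seteqP; split => [[x y] /= h|[x y] /= [h1 h2] i].
  split=> [i|]; first by have := h (lift ord0 i); rewrite mxE liftK.
  by have := h ord0; rewrite mxE unlift_none.
by rewrite mxE; case: (unliftP ord0 i) => [j ->|->] //=.
Qed.

End lebesgue_rv.

Notation normc := (@ComplexField.Normc.normc _).

Section L2.
Context {R : realType} {n : nat}.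
Local Notation T := 'rV[R]_n.
Local Notation C := R[i].
Local Notation mu := (@lebesgue_rv R n).
Implicit Types (Om : set T) (f g : T -> C).

(* extension by zero outside Om *)
Definition ext0 Om f : T -> C := patch (fun=> 0) Om f.

Definition L2 Om f :=
  ((fun x => complex.Re (ext0 Om f x)) \in Lfun mu 2%:E) /\
  ((fun x => complex.Im (ext0 Om f x)) \in Lfun mu 2%:E).

Definition l2norm Om f : \bar R :=
  ('N[mu]_2%:E[EFin \o normc \o ext0 Om f])%E.

Definition cint Om f : C :=
  Complex (\int[mu]_(x in Om) complex.Re (f x))
          (\int[mu]_(x in Om) complex.Im (f x)).

Let Lfun2_lin (c : R) (f g : T -> R) :
  f \in Lfun mu 2%:E -> g \in Lfun mu 2%:E ->
  (fun x => c * f x + g x) \in Lfun mu 2%:E.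
Proof.
have h12 : (1 <= 2%:E :> \bar R)%E by rewrite lee1n.
exact: (Lfun_submod_closed mu h12).2.
Qed.

Lemma L2_0 Om : L2 Om (fun=> 0).
Proof.
have h12 : (1 <= 2%:E :> \bar R)%E by rewrite lee1n.
by split; rewrite (_ : (fun x => _) = 0) ?(Lfun_submod_closed mu h12).1//;
  apply/funext => x; rewrite /ext0 /patch; case: ifP.
Qed.

Lemma L2_linear Om (a : C) f g :
  L2 Om f -> L2 Om g -> L2 Om (fun x => a * f x + g x).
Proof.
move=> [fr fi] [gr gi]; case: a => a b; split.
- rewrite (_ : (fun x => _) = (fun x => a * complex.Re (ext0 Om f x) +
     (- b * complex.Im (ext0 Om f x) + complex.Re (ext0 Om g x)))).
    by do 2!apply: Lfun2_lin => //.
  apply/funext => x; rewrite /ext0 /patch; case: ifPn => _ /=; last by ring.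
  by case: (f x) (g x) => [u v] [w z] /=; ring.
- rewrite (_ : (fun x => _) = (fun x => a * complex.Im (ext0 Om f x) +
     (b * complex.Re (ext0 Om f x) + complex.Im (ext0 Om g x)))).
    by do 2!apply: Lfun2_lin => //.
  apply/funext => x; rewrite /ext0 /patch; case: ifPn => _ /=; last by ring.
  by case: (f x) (g x) => [u v] [w z] /=; ring.
Qed.

Definition L2pred Om : {pred T -> C^o} := fun f => `[< L2 Om f >].

Lemma L2_submod Om : submod_closed (L2pred Om).
Proof.
split; first by apply/asboolP; exact: L2_0.
by move=> a f g /asboolP hf /asboolP hg; apply/asboolP; exact: L2_linear.
Qed.

HB.instance Definition _ Om :=
  GRing.isSubmodClosed.Build C (T -> C^o) (L2pred Om) (L2_submod Om).

Record L2fun Om := MkL2fun { L2fun_val :> T -> C^o ; _ : L2fun_val \in L2pred Om }.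

HB.instance Definition _ Om := [isSub for @L2fun_val Om].
HB.instance Definition _ Om := [Choice of L2fun Om by <:].
HB.instance Definition _ Om := [SubChoice_isSubLmodule of L2fun Om by <:].

Definition L2null Om : {pred L2fun Om} :=
  fun u => `[< {ae mu, forall x, Om x -> u x = 0} >].

Lemma L2null_zmod Om : zmod_closed (@L2null Om).
Proof.
split; first by apply/asboolP; exact: nearW.
move=> u v /asboolP hu /asboolP hv; apply/asboolP.
apply: filterS2 hu hv => x ux vx Ox.
by rewrite [LHS](_ : _ = u x - v x)// ux// vx// subr0.
Qed.

HB.instance Definition _ Om :=
  GRing.isZmodClosed.Build (L2fun Om) (@L2null Om) (L2null_zmod Om).

(* L^2(Om; C): square-integrable functions modulo equality a.e. on Om *)
Definition L2space Om := Quotient.quot (@L2null Om).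

HB.instance Definition _ Om := GRing.Zmodule.on (L2space Om).
HB.instance Definition _ Om := EqQuotient.on (L2space Om).
HB.instance Definition _ Om := ZmodQuotient.on (L2space Om).

Definition L2scale Om (c : C) (w : L2space Om) : L2space Om :=
  (\pi_(L2space Om) (c *: repr w))%qT.

Lemma L2scale_pi Om (c : C) (u : L2fun Om) :
  L2scale c (\pi_(L2space Om) u)%qT = (\pi_(L2space Om) (c *: u))%qT.
Proof.
apply/eqP; rewrite -Quotient.idealrBE.
have : repr (\pi_(L2space Om) u)%qT - u \in @L2null Om.
  by rewrite Quotient.idealrBE reprK.
move=> /asboolP hu; apply/asboolP; apply: filterS hu => x + Ox => /(_ Ox) h.
rewrite -scalerBr [LHS](_ : _ = c * (repr (\pi_(L2space Om) u)%qT - u) x)//.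
by rewrite h mulr0.
Qed.

Let scaleA Om (b c : C) (w : L2space Om) :
  L2scale b (L2scale c w) = L2scale (b * c) w.
Proof. by rewrite /L2scale -/(L2scale b _) L2scale_pi scalerA. Qed.

Let scale1 Om : left_id 1 (@L2scale Om).
Proof. by move=> w; rewrite /L2scale scale1r reprK. Qed.

Let scaleDr Om : right_distributive (@L2scale Om) +%R.
Proof.
move=> c v w; rewrite -[v]reprK -[w]reprK -[LHS]/(L2scale c _).
by rewrite -pi_addr !L2scale_pi scalerDr pi_addr.
Qed.

Let scaleDl Om (w : L2space Om) : {morph (@L2scale Om)^~ w : b c / b + c}.
Proof. by move=> b c; rewrite /L2scale scalerDl pi_addr. Qed.

HB.instance Definition _ Om := GRing.Zmodule_isLmodule.Build C (L2space Om)
  (@scaleA Om) (@scale1 Om) (@scaleDr Om) (@scaleDl Om).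

(* well defined: the integral does not depend on the representatives *)
Definition L2ip Om (v w : L2space Om) : C :=
  cint Om (fun x => repr v x * Num.conj (repr w x)).

Definition isL2class Om f (w : L2space Om) :=
  exists u : L2fun Om, L2fun_val u = f /\ w = (\pi_(L2space Om) u)%qT.

End L2.

Section sobolev.
Context {R : realType} {n : nat}.
Local Notation T := 'rV[R]_n.
Local Notation C := R[i].
Local Notation re := (@complex.Re R).
Local Notation im := (@complex.Im R).
Local Notation mu := (@lebesgue_rv R n).
Implicit Types (Om : set T) (m q : T -> R) (f phi eta h : T -> C).

(* the Euclidean norm; the norm `|x| of a row vector is the sup norm *)
Definition enorm (x : T) : R := Num.sqrt (\sum_i x ord0 i ^+ 2).

Definition pd (i : 'I_n) (f : T -> R) : T -> R :=
  fun x => 'D_(delta_mx ord0 i) f x.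

Fixpoint Ck (k : nat) (f : T -> R) : Prop :=
  continuous f /\
  if k is l.+1 then
    forall i, (forall x, derivable f x (delta_mx ord0 i)) /\ Ck l (pd i f)
  else True.

Definition smooth (f : T -> R) := forall k, Ck k f.

Definition cpd (i : 'I_n) f : T -> C := fun x =>
  Complex (pd i (re \o f) x) (pd i (im \o f) x).

Definition laplacian f : T -> C := fun x => \sum_i cpd i (cpd i f) x.

Definition testfun Om eta :=
  [/\ smooth (re \o eta), smooth (im \o eta) &
      exists K : set T,
        [/\ compact K, K `<=` Om & forall x, ~ K x -> eta x = 0]].

Definition L1loc Om (f : T -> R) :=
  measurable_fun Om f /\ forall K : set T, compact K -> K `<=` Om ->
    (\int[mu]_(x in K) `|f x|%:E < +oo)%E.

Definition L2loc Om (f : T -> R) :=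
  measurable_fun Om f /\ forall K : set T, compact K -> K `<=` Om ->
    (\int[mu]_(x in K) (f x ^+ 2)%:E < +oo)%E.

Definition Linf Om (f : T -> R) :=
  measurable_fun Om f /\
  exists M : R, {ae mu, forall x, Om x -> `|f x| <= M}.

(* g = partial_i f in the sense of distributions on Om *)
Definition weak_pd Om (i : 'I_n) (f g : T -> C) :=
  [/\ L1loc Om (re \o f), L1loc Om (im \o f),
      L1loc Om (re \o g), L1loc Om (im \o g) &
      forall eta, testfun Om eta ->
        cint Om (fun x => f x * cpd i eta x) = - cint Om (fun x => g x * eta x)].

Definition real_weak_grad Om (f : T -> R) (g : 'I_n -> T -> R) :=
  forall i, weak_pd Om i (fun x => (f x)%:C) (fun x => (g i x)%:C).

Definition W1inf Om (f : T -> R) :=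
  Linf Om f /\
  exists g, real_weak_grad Om f g /\ forall i, Linf Om (g i).

Definition W1inf_loc_closure Om (f : T -> R) :=
  forall (c : T) (r : R), W1inf (Om `&` [set x | enorm (x - c) < r]) f.

(* phi is in W^{1,2}(Om), with weak gradient g *)
Definition W12 Om phi (g : 'I_n -> T -> C) :=
  [/\ L2 Om phi, forall i, L2 Om (g i) & forall i, weak_pd Om i phi (g i)].

(* phi is in W^{1,2}_0(Om), with weak gradient g *)
Definition W012 Om phi (g : 'I_n -> T -> C) :=
  W12 Om phi g /\
  exists eta : nat -> T -> C,
    [/\ forall k, testfun Om (eta k),
        l2norm Om (eta k \- phi) @[k --> \oo] --> 0%E &
        forall i, l2norm Om (cpd i (eta k) \- g i) @[k --> \oo] --> 0%E].

Definition mulop m phi : T -> C := fun x => (m x)%:C * phi x.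

Definition dom_mul Om m phi := L2 Om phi /\ L2 Om (mulop m phi).

Definition sqrtf q : T -> R := fun x => Num.sqrt (q x).

(* phi is in Dom(- Delta + q), and (- Delta + q) phi = h *)
Definition schrodinger Om q phi h :=
  [/\ exists g, W012 Om phi g, dom_mul Om (sqrtf q) phi, L2 Om h &
      forall eta, testfun Om eta ->
        cint Om (fun x => phi x * - laplacian eta x + (q x)%:C * phi x * eta x)
        = cint Om (fun x => h x * eta x)].

Definition assumptionA Om (a q : T -> R) :=
  [/\ L2loc Om a, L1loc Om q, {ae mu, forall x, Om x -> 0 <= a x /\ 0 <= q x} &
  exists ar as_ : T -> R, exists nabla_ar : 'I_n -> T -> R,
   [/\ {ae mu, forall x, Om x -> a x = ar x + as_ x /\ 0 <= ar x},
      W1inf_loc_closure Om ar /\ real_weak_grad Om ar nabla_ar,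
      L2loc Om as_,
      forall e : R, 0 < e -> exists M : R, 0 < M /\
        {ae mu, forall x, Om x ->
          Num.sqrt (\sum_i nabla_ar i x ^+ 2) <=
          e * ar x `^ (3 / 2) + M * (Num.sqrt (q x) + 1)} &
      forall e : R, 0 < e -> exists M : R, 0 < M /\
        forall psi h, dom_mul Om ar psi -> schrodinger Om q psi h ->
          (l2norm Om (mulop as_ psi) <=
           e%:E * (l2norm Om h + l2norm Om (mulop ar psi)) +
           M%:E * l2norm Om psi)%E]].

End sobolev.

Section spectrum.
Context {R : realType} {E : lmodType R[i]} (ip : E -> E -> R[i]).

Definition ipnorm (x : E) : R := Num.sqrt (complex.Re (ip x x)).

(* An operator in E is represented by its graph *)
Definition closure_op (A : set (E * E)) : set (E * E) :=
  [set p | exists u : nat -> E * E,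
    [/\ forall k, A (u k),
        ipnorm ((u k).1 - p.1) @[k --> \oo] --> (0 : R) &
        ipnorm ((u k).2 - p.2) @[k --> \oo] --> (0 : R)]].

Definition sigma_e2 (A : set (E * E)) : set R[i] :=
  [set lam | exists psi chi : nat -> E,
    [/\ forall k, A (psi k, chi k), forall k, ipnorm (psi k) = 1,
        forall v, normc (ip (psi k) v) @[k --> \oo] --> (0 : R) &
        ipnorm (chi k - lam *: psi k) @[k --> \oo] --> (0 : R)]].

End spectrum.

Section operatorG.
Context {R : realType} {n : nat}.
Local Notation T := 'rV[R]_n.
Local Notation C := R[i].
Variables (Om : set T) (a q : T -> R).

Definition formW (eta zeta : T -> C) : C :=
  \sum_i cint Om (fun x => cpd i eta x * Num.conj (cpd i zeta x)) +
  cint Om (fun x => mulop (sqrtf q) eta x * Num.conj (mulop (sqrtf q) zeta x)).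

Variables (W : lmodType C) (ipW : {dot W for Num.conj}) (J : (T -> C) -> W).

(* (W, J) is a completion of (testfun Om, formW) *)
Record isWcompletion : Prop := IsWcompletion {
  Wcomplete : forall w : nat -> W,
    (forall e : R, 0 < e -> exists N : nat, forall k l : nat,
       (N <= k)%N -> (N <= l)%N -> ipnorm ipW (w k - w l) < e) ->
    exists v : W, ipnorm ipW (w k - v) @[k --> \oo] --> (0 : R) ;
  Wlinear : forall (c : C) (eta zeta : T -> C),
    testfun Om eta -> testfun Om zeta ->
    J (fun x => c * eta x + zeta x) = c *: J eta + J zeta ;
  Wisometric : forall eta zeta : T -> C,
    testfun Om eta -> testfun Om zeta ->
    ipW (J eta) (J zeta) = formW eta zeta ;
  Wdense : forall (w : W) (e : R), 0 < e ->
    exists eta : T -> C, testfun Om eta /\ ipnorm ipW (J eta - w) < e }.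

(* phi is in W^{1,2}_0(Om) and in Dom(q^{1/2}), and w is phi as an element of
   the completion: the limit of J eta_k for test functions eta_k -> phi in the
   norm of formW *)
Definition inW (phi : T -> C) (w : W) :=
  dom_mul Om (sqrtf q) phi /\
  exists g : 'I_n -> T -> C, W012 Om phi g /\
  exists eta : nat -> T -> C,
    [/\ forall k, testfun Om (eta k),
        forall i, l2norm Om (cpd i (eta k) \- g i) @[k --> \oo] --> 0%E,
        l2norm Om (mulop (sqrtf q) (eta k \- phi)) @[k --> \oo] --> 0%E &
        ipnorm ipW (J (eta k) - w) @[k --> \oo] --> (0 : R)].

(* inner product of H = W(Om) x L^2(Om) *)
Definition ipH (u v : W * L2space Om) : C := ipW u.1 v.1 + L2ip u.2 v.2.

(* graph of (phi1, phi2) |-> (phi2, (Delta - q) phi1 - 2 a phi2) *)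
Definition G0 : set ((W * L2space Om) * (W * L2space Om)) :=
  [set p | exists phi1 phi2 h1 h2 : T -> C,
    [/\ schrodinger Om q phi1 h1 /\ dom_mul Om a phi1,
        schrodinger Om q phi2 h2 /\ dom_mul Om a phi2,
        inW phi1 p.1.1 /\ isL2class phi2 p.1.2 &
        inW phi2 p.2.1 /\
        isL2class (fun x => - h1 x - 2 * mulop a phi2 x) p.2.2]].

Definition G := closure_op ipH G0.

End operatorG.
Arguments ipH {R n} Om {W} ipW u v.
Arguments G {R n} Om a q {W} ipW J.

Section tube.
Context {R : realType} {n : nat}.
Implicit Types x : 'rV[R]_n.+1.

Definition fst_coor x : R := x ord0 ord0.

Definition tl_coor x : 'rV[R]_n := \row_(i < n) x ord0 (lift ord0 i).

(* for n = 0, i.e. in dimension one, this is (0, +oo) *)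
Definition tube (omega : R -> R) : set 'rV[R]_n.+1 :=
  [set x | 0 < fst_coor x /\
    ((0 < n)%N -> enorm (tl_coor x) < (omega (fst_coor x))^-1)].

(* essential supremum over a subset S *)
Definition ess_sup_on (S : set 'rV[R]_n.+1) (f : 'rV[R]_n.+1 -> R) : \bar R :=
  ess_sup (@lebesgue_rv R n.+1) (patch (fun=> -oo%E) S (EFin \o f)).

Definition C1pos (f : R -> R) := forall u, 0 < u ->
  derivable f u 1 /\ {for u, continuous (derive1 f)}.

Definition C2pos (f : R -> R) := C1pos f /\ C1pos (derive1 f).

End tube.

(* Main.v *)
(** Put (G - lam)(phi, lam phi) = (0, Delta phi - (q + 2 lam a + lam^2) phi) for a
    test function phi; in the tube the second component is
    Delta phi + A(x_1) phi - B phi.  Since A varies slowly, at a distance there is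
    a smooth phase th with th' close to A^{1/2} on an interval of any given length
    2l around s, and phi = e^{i th(x_1)} chi((x_1 - s)/l) prod_j chi(x_j/r), with r
    comparable to 1/omega(s), is supported in the tube.  All the error terms, the
    transversal ones of size r^{-2} ~ omega^2 = o(A^{1/2}) included, are then
    bounded by a small multiple of A(s)^{1/2}, whereas |d_1 phi| is at least
    A(s)^{1/2}/2 on a fixed fraction of the box, and the norm of (phi, lam phi) in
    H dominates that of d_1 phi.  Letting the boxes move to infinity gives
    normalised states with disjoint supports; these are orthonormal in H, hence
    converge weakly to 0 by Bessel's inequality. *)
From HB Require Import structures.
Require Import Defs.
From mathcomp Require Import all_boot all_order all_algebra.
From mathcomp Require Import generic_quotient ring_quotient complex.
From mathcomp Require Import ring lra.
From mathcomp Require Import all_classical all_reals all_analysis.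
From mathcomp Require Import measurable_realfun ess_sup_inf.

Set Implicit Arguments.
Unset Strict Implicit.
Unset Printing Implicit Defensive.

Import Order.TTheory GRing.Theory Num.Theory.
Import numFieldNormedType.Exports.

Local Open Scope classical_set_scope.
Local Open Scope ring_scope.

(** * Smooth functions and cutoffs on the line *)

(** [A] is only C^1, so a phase whose derivative is exactly [A^{1/2}] need not be smooth, while test
    functions must be. The gradient in the norm of H gives room: it gains a factor [A^{1/2}], so th'
    need only lie within a small k of [A^{1/2}], with th'' at most a constant times [k A(s)^{1/2}].
    For the same reason no WKB amplitude [A^{-1/4}] is inserted to cancel the th'' term. The single
    number k measures everything: the window has half-length 1/k, and slow variation, B and the
    transversal terms are made small in terms of k. The limits in the hypotheses on A and omega are
    thus spent once, in producing a window for given k. The other obstacle is the domain of G.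
    Membership in the domain of -Delta + q is a statement about distributions, so even for test
    functions it rests on Green's identity on R^d, obtained from the fundamental theorem of calculus
    by peeling coordinates off the iterated Lebesgue measure. *)

Section smooth1.
Context {R : realType}.
Implicit Types f g : R -> R.

Fixpoint Ck1 (k : nat) f : Prop :=
  if k is l.+1 then (forall x, derivable f x 1) /\ Ck1 l (derive1 f)
  else continuous f.

Definition smooth1 f := forall k, Ck1 k f.

Lemma Ck1_cont k f : Ck1 k f -> continuous f.
Proof.
case: k => // k [df _] x.
exact/differentiable_continuous/derivable1_diffP/df.
Qed.

Lemma Ck1W k f : Ck1 k.+1 f -> Ck1 k f.
Proof.
elim: k f => [f /Ck1_cont//|k IH f [df dk]]; split => //; exact: IH.
Qed.

Lemma derive1_funE f g : (forall x : R, is_derive x (1:R) f (g x)) -> derive1 f = g.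
Proof. by move=> h; apply/funext => x; rewrite derive1E; apply: derive_val. Qed.

Lemma Ck1S k f g : (forall x : R, is_derive x (1:R) f (g x)) -> Ck1 k g -> Ck1 k.+1 f.
Proof.
move=> h hg; split; last by rewrite (derive1_funE h).
by move=> x; have [] := h x.
Qed.

Lemma Ck1_is_derive k f (x : R) : Ck1 k.+1 f -> is_derive x (1:R) f (derive1 f x).
Proof. by move=> [df _]; rewrite derive1E; exact/derivableP. Qed.

Lemma smooth1_is_derive f (x : R) : smooth1 f -> is_derive x (1:R) f (derive1 f x).
Proof. by move=> /(_ 1); exact: Ck1_is_derive. Qed.

Lemma smooth1_derive1 f : smooth1 f -> smooth1 (derive1 f).
Proof. by move=> h k; have [] := h k.+1. Qed.

Lemma smooth1_cont f : smooth1 f -> continuous f.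
Proof. by move=> /(_ 0). Qed.

(** Only stability of the class under derivation is used, so no formula for a k-th derivative is
    ever written. It serves constants, the combinations of cos and sin, and the functions
    [flat p]. *)
Lemma smooth1_coind (P : set (R -> R)) :
  (forall f, P f -> exists g, P g /\ forall x : R, is_derive x (1:R) f (g x)) ->
  forall f, P f -> smooth1 f.
Proof.
move=> HP f Pf k; elim: k f Pf => [f Pf|k IH f Pf]; have [g [Pg h]] := HP f Pf.
  apply: (@Ck1_cont 1); split; first by move=> x; have [] := h x.
  rewrite (derive1_funE h); have [g' [_ h']] := HP g Pg.
  move=> x; apply/differentiable_continuous/derivable1_diffP.
  by have [] := h' x.
by apply: (Ck1S h); exact: IH.
Qed.

Lemma smooth1_cst c : smooth1 (fun=> c).
Proof.
apply: (smooth1_coind (P := [set f | exists c, f = fun=> c])); last by exists c.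
move=> _ [d ->]; exists (fun=> 0); split; first by exists 0.
by move=> x; exact: is_derive_cst.
Qed.

Lemma Ck1D k f g : Ck1 k f -> Ck1 k g -> Ck1 k (fun x => f x + g x : R).
Proof.
elim: k f g => [f g cf cg x|k IH f g hf hg]; first exact: cvgD (cf x) (cg x).
apply: (Ck1S (f := fun x => f x + g x) (g := fun x => derive1 f x + derive1 g x : R)).
  by move=> x; exact: is_deriveD (Ck1_is_derive x hf) (Ck1_is_derive x hg).
by apply: IH; [case: hf|case: hg].
Qed.

Lemma Ck1M k f g : Ck1 k f -> Ck1 k g -> Ck1 k (fun x => f x * g x : R).
Proof.
elim: k f g => [f g cf cg x|k IH f g hf hg]; first exact: cvgM (cf x) (cg x).
apply: (Ck1S (f := fun x => f x * g x) (g := fun x => f x * derive1 g x + g x * derive1 f x : R)).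
  by move=> x; exact: is_deriveM (Ck1_is_derive x hf) (Ck1_is_derive x hg).
apply: Ck1D; apply: IH; try exact: Ck1W; by [case: hf|case: hg].
Qed.

Lemma Ck1_comp k f g : Ck1 k f -> Ck1 k g -> Ck1 k (fun x => f (g x)).
Proof.
elim: k f g => [f g cf cg x|k IH f g hf hg].
  exact: continuous_comp (cg x) (cf _).
apply: (@Ck1S _ (f \o g) (fun x : R => derive1 f (g x) * derive1 g x : R)).
  move=> x.
  exact: (is_derive1_comp (Ck1_is_derive _ hf) (Ck1_is_derive x hg)).
by apply: Ck1M; [apply: IH; [case: hf|exact: Ck1W]|case: hg].
Qed.

Lemma smooth1D f g : smooth1 f -> smooth1 g -> smooth1 (fun x => f x + g x).
Proof. by move=> hf hg k; exact: Ck1D. Qed.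

Lemma smooth1M f g : smooth1 f -> smooth1 g -> smooth1 (fun x => f x * g x).
Proof. by move=> hf hg k; exact: Ck1M. Qed.

Lemma smooth1_comp f g : smooth1 f -> smooth1 g -> smooth1 (fun x => f (g x)).
Proof. by move=> hf hg k; exact: Ck1_comp. Qed.

Lemma smooth1_id : smooth1 (fun x => x).
Proof.
case=> [x|k]; first exact: cvg_id.
by apply: (@Ck1S _ (fun x => x) (fun=> 1)); exact: smooth1_cst.
Qed.

Lemma smooth1_affine a b : smooth1 (fun x => a * x + b).
Proof.
apply: smooth1D; last exact: smooth1_cst.
by apply: smooth1M; [exact: smooth1_cst|exact: smooth1_id].
Qed.

Lemma is_derive_affine (a b x : R) : is_derive x (1:R) (fun y : R => a * y + b) a.
Proof.
have h := is_deriveD (is_deriveM (is_derive_cst (a : R) (x : R) (1:R)) (is_derive_id (x : R) (1:R)))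
  (is_derive_cst (b : R) (x : R) (1:R)).
apply: is_derive_eq h _.
by rewrite /= /GRing.scale/= mulr0 mulr1 !addr0.
Qed.

Lemma smooth1V f : smooth1 f -> (forall x, f x != 0) ->
  smooth1 (fun x => (f x)^-1).
Proof.
move=> hf f0; elim => [x|k IH].
  by apply: cvgV => //; exact: smooth1_cont.
apply: (Ck1S (g := fun x => - (f x)^-2 * derive1 f x)).
  move=> x; exact: (is_deriveV (f0 x) (smooth1_is_derive x hf)).
apply: Ck1M; last exact: smooth1_derive1.
rewrite (_ : (fun x => - _) = (fun x => -1 * ((f x)^-1 * (f x)^-1))); last first.
  by apply/funext => x; rewrite mulN1r -exprVn expr2.
by apply: Ck1M; [exact: smooth1_cst|exact: Ck1M].
Qed.

Lemma smooth1_cos_sin : smooth1 (@cos R) /\ smooth1 (@sin R).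
Proof.
pose P : set (R -> R) := [set f | exists a b, f = fun x => a * cos x + b * sin x].
have HP f : P f -> exists g, P g /\ forall x : R, is_derive x (1:R) f (g x).
  move=> [a [b ->]]; exists (fun x => b * cos x + (- a) * sin x); split.
    by exists b, (- a).
  move=> x.
  have h := is_deriveD
    (is_deriveM (is_derive_cst (a : R) (x : R) (1:R)) (is_derive_cos x))
    (is_deriveM (is_derive_cst (b : R) (x : R) (1:R)) (is_derive_sin x)).
  apply: is_derive_eq h _.
  by rewrite /= /GRing.scale/= !mulr0 !addr0; ring.
have := smooth1_coind HP; move=> H; split; apply: H.
  by exists 1, 0; apply/funext => x; ring.
by exists 0, 1; apply/funext => x; ring.
Qed.

End smooth1.

Section flat.
Context {R : realType}.

(** Raise [y / k <= 1 + y / k <= exp (y / k)] to the power k. The constant is crude, but only its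
    existence matters. *)
Lemma exprn_le_expR (k : nat) (y : R) : 0 <= y -> y ^+ k <= k%:R ^+ k * expR y.
Proof.
case: k => [y0|k y0].
  by rewrite !expr0 mul1r; apply: le_trans (expR_ge1Dx y); rewrite lerDl.
have k0 : (0 : R) < k.+1%:R by rewrite ltr0n.
have -> : expR y = expR (y / k.+1%:R) ^+ k.+1.
  by rewrite -expRM_natr; rewrite divfK// pnatr_eq0.
rewrite -exprMn lerXn2r ?nnegrE ?mulr_ge0 ?expR_ge0//.
rewrite mulrC -ler_pdivrMr//.
by apply: le_trans (expR_ge1Dx _); rewrite lerDr.
Qed.

Lemma horner_le_expR (p : {poly R}) :
  exists C : R, 0 <= C /\ forall y : R, 0 <= y -> `|p.[y]| <= C * expR y.
Proof.
exists (\sum_(i < size p) `|p`_i| * i%:R ^+ i); split.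
  by apply: sumr_ge0 => i _; rewrite mulr_ge0// exprn_ge0.
move=> y y0; rewrite horner_coef mulr_suml.
apply: le_trans (ler_norm_sum _ _ _) _; apply: ler_sum => i _.
rewrite normrM -mulrA ler_wpM2l// ger0_norm ?exprn_ge0//.
exact: exprn_le_expR.
Qed.

(** The difference quotient at 0 is at most [C |h|]. This settles the one point near which [flat p]
    is not given by a single formula. *)
Lemma is_derive0_quadratic (f : R -> R) C : (forall y, `|f y| <= C * y ^+ 2) ->
  is_derive (0:R) (1:R) f 0.
Proof.
move=> hf.
have C0 : 0 <= C by have := hf 1; rewrite expr1n mulr1; exact: le_trans.
have f0 : f 0 = 0.
  by have := hf 0; rewrite expr0n/= mulr0 normr_le0 => /eqP.
have cv : h^-1 *: (f (h *: (1:R) + 0) - f 0) @[h --> (0:R)^'] --> (0:R).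
  apply/cvgr0Pnorm_lt => e e0; near=> h.
  have h0 : h != 0 by near: h; exact: nbhs_dnbhs_neq.
  rewrite f0 subr0 addr0 /GRing.scale/= mulr1 normrM normfV.
  apply: (@le_lt_trans _ _ (C * `|h|)).
    rewrite mulrC ler_pdivrMr ?normr_gt0//.
    by apply: le_trans (hf h) _; rewrite -mulrA -expr2 real_normK ?num_real.
  apply: (@le_lt_trans _ _ ((C + 1) * `|h|)); first by rewrite ler_wpM2r// lerDl.
  rewrite mulrC -ltr_pdivlMr; last lra.
  near: h; apply: dnbhs0_lt; rewrite divr_gt0//; lra.
by apply: DeriveDef; [apply/cvg_ex; exists 0|exact/cvg_lim].
Unshelve. all: by end_near. Qed.

(* The functions p(1/x) e^{-1/x}, extended by 0, form a class closed under
   derivation, which makes e^{-1/x} smooth by [smooth1_coind]. *)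
Definition flat (p : {poly R}) (x : R) : R :=
  if 0 < x then p.[x^-1] * expR (- x^-1) else 0.

Lemma is_derive_near (f g : R -> R) (x df : R) : (\forall y \near x, f y = g y) ->
  is_derive x (1:R) f df -> is_derive x (1:R) g df.
Proof.
move=> fg [dv e]; apply: DeriveDef.
  by apply: near_eq_derivable dv; rewrite ?oner_neq0.
by rewrite -e; apply/esym/near_eq_derive; rewrite ?oner_neq0.
Qed.

Lemma flat_quadratic p : exists C, forall y, `|flat p y| <= C * y ^+ 2.
Proof.
(* Evaluated at 1/y, the extra factor ['X^2] becomes the [y ^+ 2] of the bound. *)
have [C [C0 hC]] := horner_le_expR ('X^2 * p).
exists C => y; rewrite /flat; case: ifPn => y0; last first.
  by rewrite normr0 mulr_ge0// sqr_ge0.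
have /hC : 0 <= y^-1 by rewrite invr_ge0 ltW.
rewrite hornerM hornerXn normrM ger0_norm ?exprn_ge0 ?invr_ge0 ?(ltW y0)// => h.
rewrite normrM (ger0_norm (expR_ge0 _)) expRN.
rewrite ler_pdivrMr ?expR_gt0// mulrAC -ler_pdivrMr ?exprn_gt0//.
by apply: le_trans h; rewrite mulrC exprVn.
Qed.

Lemma is_derive_flat p (x : R) :
  is_derive x (1:R) (flat p) (flat ('X^2 * (p - p^`())) x).
Proof.
have [x0|x0|x0] := ltgtP 0 x; last first.
- have [C hC] := flat_quadratic p; rewrite -x0 {2}/flat ltxx.
  exact: is_derive0_quadratic hC.
- rewrite /flat ltNge (ltW x0)/=; apply: (@is_derive_near (fun=> 0)).
  near=> y; rewrite /flat ifN// -leNgt ltW//; near: y; exact: lt_nbhsl.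
- have xn0 : x != 0 by rewrite gt_eqF.
  have dV : is_derive x (1:R) (fun y : R => y^-1) (- x^-2).
    have h := is_deriveV xn0 (is_derive_id x (1:R)).
    by apply: is_derive_eq h _; rewrite /GRing.scale/= mulr1.
  have dp := is_derive1_comp (is_derive_poly p x^-1) dV.
  have dNV : is_derive x (1:R) (fun y : R => - y^-1) (x^-2).
    by have h := is_deriveN dV; apply: is_derive_eq h _; rewrite opprK.
  have de := @is_derive1_comp _ expR (fun y : R => - y^-1) x _ _ (is_derive_expR (- x^-1)) dNV.
  have := is_deriveM dp de.
  move=> h; apply: (@is_derive_near (fun y => p.[y^-1] * expR (- y^-1))).
    near=> y; rewrite /flat ifT//; near: y; exact: lt_nbhsr.
  apply: is_derive_eq h _; rewrite /flat x0 /GRing.scale/= !hornerE /=.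
  by rewrite -exprVn; ring.
Unshelve. all: by end_near. Qed.

Lemma smooth1_flat p : smooth1 (flat p).
Proof.
apply: (smooth1_coind (P := [set f | exists p, f = flat p])); last by exists p.
move=> _ [r ->]; exists (flat ('X^2 * (r - r^`()))); split; first by eexists.
by move=> x; exact: is_derive_flat.
Qed.

Definition flat1 : R -> R := flat 1%:P.

Lemma flat1_gt0 x : 0 < x -> 0 < flat1 x.
Proof. by move=> x0; rewrite /flat1 /flat x0 hornerC mul1r expR_gt0. Qed.

Lemma flat1_le0 x : x <= 0 -> flat1 x = 0.
Proof. by move=> x0; rewrite /flat1 /flat ltNge x0. Qed.

Lemma flat1_ge0 x : 0 <= flat1 x.
Proof.
by have [x0|x0] := leP x 0; [rewrite flat1_le0|exact/ltW/flat1_gt0].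
Qed.

Lemma flat1_den_gt0 x : 0 < flat1 x + flat1 (1 - x).
Proof.
have [x0|x0] := ltP 0 x.
  by rewrite ltr_wpDr ?flat1_ge0// flat1_gt0.
by rewrite ltr_wpDl ?flat1_ge0// flat1_gt0//; lra.
Qed.

(** The denominator never vanishes, because x and 1 - x are not both nonpositive. *)
Definition smoothstep (x : R) : R := flat1 x * (flat1 x + flat1 (1 - x))^-1.

Lemma smoothstep_le0 x : x <= 0 -> smoothstep x = 0.
Proof. by move=> x0; rewrite /smoothstep flat1_le0// mul0r. Qed.

Lemma smoothstep_ge1 x : 1 <= x -> smoothstep x = 1.
Proof.
move=> x1; rewrite /smoothstep [flat1 (1 - x)]flat1_le0 ?addr0; last lra.
by rewrite mulfV// gt_eqF// flat1_gt0//; lra.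
Qed.

Lemma smoothstep01 x : 0 <= smoothstep x <= 1.
Proof.
have d0 := flat1_den_gt0 x; rewrite /smoothstep mulr_ge0 ?invr_ge0 ?flat1_ge0 ?(ltW d0)//=.
by rewrite ler_pdivrMr ?flat1_den_gt0// mul1r lerDl flat1_ge0.
Qed.

Lemma smooth1_smoothstep : smooth1 smoothstep.
Proof.
apply: smooth1M; first exact: smooth1_flat.
apply: smooth1V; last by move=> x; rewrite gt_eqF// flat1_den_gt0.
apply: smooth1D; first exact: smooth1_flat.
rewrite (_ : (fun x => _) = (fun x => flat1 ((-1) * x + 1))); last first.
  by apply/funext => x; congr flat1; ring.
by apply: (smooth1_comp (f := flat1)); [exact: smooth1_flat|exact: smooth1_affine].
Qed.

(** The first factor rises from 0 to 1 on [-1, -1/2], the second falls from 1 to 0 on [1/2, 1]. *)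
Definition plateau (x : R) : R := smoothstep (2 * x + 2) * smoothstep ((-2) * x + 2).

Lemma smooth1_plateau : smooth1 plateau.
Proof.
by apply: smooth1M; apply: (smooth1_comp (f := smoothstep));
  [exact: smooth1_smoothstep|exact: smooth1_affine|exact: smooth1_smoothstep|exact: smooth1_affine].
Qed.

Lemma plateau01 x : 0 <= plateau x <= 1.
Proof.
rewrite /plateau; case/andP: (smoothstep01 (2 * x + 2)) => a0 a1.
case/andP: (smoothstep01 ((-2) * x + 2)) => b0 b1.
by rewrite mulr_ge0//= mulr_ile1.
Qed.

Lemma plateau1 x : `|x| <= 2^-1 -> plateau x = 1.
Proof. by rewrite ler_norml => /andP[? ?]; rewrite /plateau !smoothstep_ge1 ?mulr1//; lra. Qed.

Lemma plateau0 x : 1 <= `|x| -> plateau x = 0.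
Proof.
rewrite /plateau ler_normr => /orP[h|h].
  by rewrite [X in _ * X]smoothstep_le0 ?mulr0//; lra.
by rewrite smoothstep_le0 ?mul0r//; lra.
Qed.

Lemma bounded_supp (f : R -> R) : continuous f -> (forall x, 1 < `|x| -> f x = 0) ->
  exists M : R, 0 <= M /\ forall x, `|f x| <= M.
Proof.
move=> cf f0.
have [||c _ hc] := @EVT_max R (fun x => `|f x|) (-1) 1; first lra.
  apply: continuous_subspaceT => x; apply: (@continuous_comp _ _ _ f (fun z : R => `|z|)).
    exact: cf.
  exact: norm_continuous.
exists `|f c|; split=> // x.
have [x1|x1] := leP `|x| 1; last by rewrite f0 ?normr0.
by apply: hc; rewrite in_itv/= -ler_norml.
Qed.

Lemma derive1_near_cst (f : R -> R) c (x : R) : (\forall y \near x, f y = c) ->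
  derive1 f x = 0.
Proof.
move=> h; have hd : is_derive x (1:R) f 0.
  apply: (@is_derive_near (fun=> c)).
  by near=> y; apply/esym; near: y.
by rewrite derive1E; apply: derive_val.
Unshelve. all: by end_near. Qed.

Lemma derive1_supp (f : R -> R) : (forall x, 1 < `|x| -> f x = 0) ->
  forall x, 1 < `|x| -> derive1 f x = 0.
Proof.
move=> f0 x x1; apply: (@derive1_near_cst _ 0); near=> y; apply: f0.
near: y; have : (fun z : R => `|z|) @ x --> `|x| by apply: norm_continuous.
by move=> /cvgr_gt/(_ _ x1).
Unshelve. all: by end_near. Qed.

Lemma plateau_bounds : exists M : R, [/\ 1 <= M,
  forall x, `|derive1 plateau x| <= M & forall x, `|derive1 (derive1 plateau) x| <= M].
Proof.
have s0 x : 1 < `|x| -> plateau x = 0 by move=> /ltW; exact: plateau0.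
have [M1 [M10 h1]] := bounded_supp (smooth1_cont (smooth1_derive1 smooth1_plateau)) (derive1_supp s0).
have [M2 [M20 h2]] := bounded_supp
  (smooth1_cont (smooth1_derive1 (smooth1_derive1 smooth1_plateau))) (derive1_supp (derive1_supp s0)).
(* The summand 1 ensures [1 <= M], a normalisation on which the error estimate [wave_arith]
   relies. *)
exists (M1 + M2 + 1); split; first lra.
- by move=> x; apply: le_trans (h1 x) _; lra.
- by move=> x; apply: le_trans (h2 x) _; lra.
Qed.

End flat.

(** * Smooth functions of several variables *)

Section smoothn.
Context {R : realType} {n : nat}.
Local Notation T := 'rV[R]_n.
Local Notation ev i := (delta_mx ord0 i : T).
Implicit Types (f g : T -> R).

(** The two difference quotients coincide. This carries calculus on the line to directional
    derivatives and back, for tensor products and under Fubini's theorem. *)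
Lemma is_derive_lineP (V : normedModType R) (f : V -> R) (x v : V) (d : R) :
  is_derive x v f d <-> is_derive (0:R) (1:R) (fun h : R => f (h *: v + x)) d.
Proof.
have E : (fun h : R => h^-1 *: ((f \o shift x) (h *: v) - f x)) =
  (fun h : R => h^-1 *: (((fun h : R => f (h *: v + x)) \o shift (0:R)) (h *: (1:R)) - f (0 *: v + x))).
  by apply/funext => h /=; rewrite addr0 scale0r add0r /GRing.scale/= mulr1.
split=> -[]; rewrite /derivable /derive.
  by rewrite E => h1 h2; apply: DeriveDef.
by rewrite -E => h1 h2; apply: DeriveDef.
Qed.

Lemma pd_is_derive i f x d : is_derive x (ev i) f d -> pd i f x = d.
Proof. by move=> h; rewrite /pd; apply: derive_val. Qed.

Lemma Ck_cont k f : Ck k f -> continuous f.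
Proof. by case: k => [[]|k []]. Qed.

Lemma Ck_is_derive k i f x : Ck k.+1 f -> is_derive x (ev i) f (pd i f x).
Proof. by move=> [_ /(_ i)[df _]]; exact/derivableP. Qed.

Lemma smooth_is_derive i f x : smooth f -> is_derive x (ev i) f (pd i f x).
Proof. by move=> /(_ 1); exact: Ck_is_derive. Qed.

Lemma smooth_pd i f : smooth f -> smooth (pd i f).
Proof. by move=> h k; have [_ /(_ i)[]] := h k.+1. Qed.

Lemma smooth_cont f : smooth f -> continuous f.
Proof. by move=> /(_ 0); exact: Ck_cont. Qed.

Lemma pd_scale (c : R) i f : (forall x, derivable f x (ev i)) ->
  pd i (fun x => c * f x) = (fun x => c * pd i f x).
Proof.
move=> df; apply/funext => x; apply: pd_is_derive.
exact: is_deriveZ (derivableP (df x)).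
Qed.

Lemma smooth_scale (c : R) f : smooth f -> smooth (fun x => c * f x).
Proof.
move=> + k; elim: k f => [f /smooth_cont cf|k IH f sf].
  by split => // x; exact: cvgMl_tmp (cf x).
have cf := smooth_cont sf.
split=> [x|i]; first exact: cvgMl_tmp (cf x).
split=> [x|]; first by have [] := is_deriveZ c (smooth_is_derive i x sf).
rewrite pd_scale; first by apply: IH; exact: smooth_pd.
by move=> x; have [] := smooth_is_derive i x sf.
Qed.

Lemma is_derive_nearV (f g : T -> R) (x v : T) (df : R) : (\forall y \near x, f y = g y) ->
  is_derive x v f df -> is_derive x v g df.
Proof.
move=> fg; have [->|v0] := eqVneq v 0.
  move=> h; have -> : df = 0.
    by have [_ <-] := h; rewrite derive0.
  by apply: DeriveDef; [exact: derivable0|rewrite derive0].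
move=> [dv e]; apply: DeriveDef; first exact: near_eq_derivable fg dv.
by rewrite -e; apply/esym/near_eq_derive.
Qed.

Lemma pd_supp (K : set T) i f : closed K -> (forall x, ~ K x -> f x = 0) ->
  forall x, ~ K x -> pd i f x = 0.
Proof.
move=> cK f0 x Kx; apply: pd_is_derive.
apply: (@is_derive_nearV (fun=> 0)).
have : open (~` K) by exact: closed_openC.
rewrite openE => /(_ x Kx); apply: filterS => y Ky.
by rewrite f0.
Qed.

Implicit Types (G : 'I_n -> R -> R).

(** Separated variables: a partial derivative replaces one factor by its derivative ([upd]), so the
    class is stable under [pd] and smoothness is decided on the line. *)
Definition tensor (G : 'I_n -> R -> R) (x : T) : R := \prod_i G i (x ord0 i).

Definition upd (G : 'I_n -> R -> R) j h : 'I_n -> R -> R :=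
  fun i => if i == j then h else G i.

Lemma continuous_tensor G : (forall i, continuous (G i)) -> continuous (tensor G).
Proof.
move=> cg x; rewrite /tensor.
pose F (i : 'I_n) (x : T) := G i (x ord0 i).
have cF i : continuous (F i).
  by move=> y; apply: continuous_comp; [exact: coord_continuous|exact: cg].
suff H (s : seq 'I_n) : continuous (fun x => \prod_(i <- s) F i x) by exact: H.
elim: s => [y|i s IH y].
  rewrite (_ : (fun _ => _) = fun=> 1); last by apply/funext => z; rewrite big_nil.
  exact: (@cst_continuous _ _ (1:R)).
rewrite (_ : (fun _ => _) = fun z => F i z * \prod_(j <- s) F j z); last first.
  by apply/funext => z; rewrite big_cons.
exact: cvgM (cF i y) (IH y).
Qed.

Lemma tensor_updE G j h x :
  tensor (upd G j h) x = h (x ord0 j) * \prod_(i | i != j) G i (x ord0 i).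
Proof.
rewrite /tensor (bigD1 j)//= /upd eqxx; congr *%R.
by apply: eq_bigr => i /negbTE ->.
Qed.

Lemma upd_id G j : upd G j (G j) = G.
Proof. by apply/funext => i; rewrite /upd; case: eqP => // ->. Qed.

Lemma is_derive_tensor G j x : smooth1 (G j) ->
  is_derive x (ev j) (tensor G) (tensor (upd G j (derive1 (G j))) x).
Proof.
move=> sg; apply/is_derive_lineP.
set P := \prod_(i | i != j) G i (x ord0 i).
have E : (fun h : R => tensor G (h *: ev j + x)) =
    (fun h => P * G j (h *: 1 + x ord0 j)).
  apply/funext => h; rewrite -{1}(upd_id G j) tensor_updE mulrC; congr *%R.
    by apply: eq_bigr => i /negbTE ij; rewrite !mxE ij/= mulr0 add0r.
  by rewrite !mxE !eqxx.
rewrite E tensor_updE mulrC -/P.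
have h1 := smooth1_is_derive (x ord0 j) sg.
have h2 : is_derive (0:R) (1:R) (fun h => G j (h *: 1 + x ord0 j)) (derive1 (G j) (x ord0 j)).
  exact: (is_derive_lineP (G j) (x ord0 j : R^o) (1:R) _).1 h1.
exact: is_deriveZ h2.
Qed.

Lemma pd_tensor G j : smooth1 (G j) ->
  pd j (tensor G) = tensor (upd G j (derive1 (G j))).
Proof. by move=> h; apply/funext => x; apply: pd_is_derive; exact: is_derive_tensor. Qed.

Lemma smooth_tensor G : (forall i, smooth1 (G i)) -> smooth (tensor G).
Proof.
move=> + k; elim: k G => [|k IH] G sg.
  by split=> //; apply: continuous_tensor => i; exact: smooth1_cont.
split; first by apply: continuous_tensor => i; exact: smooth1_cont.
move=> j; split=> [x|]; first by have [] := is_derive_tensor x (sg j).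
rewrite pd_tensor//; apply: IH => i; rewrite /upd; case: eqP => // _.
exact: smooth1_derive1.
Qed.

Lemma continuous_supp_bounded (K : set T) f : continuous f -> compact K ->
  (forall x, ~ K x -> f x = 0) -> exists M : R, 0 < M /\ forall x, `|f x| <= M.
Proof.
move=> cf cK f0.
have /compact_bounded [M [_ hM]] : compact (f @` K).
  by apply: continuous_compact => //; exact: continuous_subspaceT.
exists (`|M| + 1); split; first by rewrite ltr_wpDl.
move=> x; have [Kx|Kx] := pselect (K x); last by rewrite f0// normr0 addr_ge0.
by apply: (hM (`|M| + 1)); [rewrite ltr_pwDr// ler_norm|exists x].
Qed.

End smoothn.

(** * Lebesgue measure on row vectors *)

Section rv_measure.
Context {R : realType}.

Lemma rv_norm_leP n (M : R) (x : 'rV[R]_n) : 0 <= M ->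
  `|x| <= M <-> forall j, `|x ord0 j| <= M.
Proof.
move=> M0; rewrite [`|x|](mx_normrE x); split.
  by move=> /bigmax_leP[_ h] j; exact: (h (ord0, j)).
by move=> h; apply/bigmax_leP; split=> // -[i j] _ /=; rewrite ord1.
Qed.

Lemma closed_norm_le n (M : R) : closed [set x : 'rV[R]_n | `|x| <= M].
Proof.
have := @closed_comp _ _ (fun x : 'rV[R]_n => `|x|) [set y | y <= M].
by apply; [move=> x _; exact: norm_continuous|exact: closed_le].
Qed.

Lemma compact_norm_le n (M : R) : compact [set x : 'rV[R]_n | `|x| <= M].
Proof.
apply: bounded_closed_compact; last exact: closed_norm_le.
exists M; split; first exact: num_real.
by move=> y My x /= xM; exact: le_trans xM (ltW My).
Qed.

Lemma measurable_rv_box n (B : 'I_n -> set (measurableTypeR R)) :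
  (forall i, measurable (B i)) ->
  measurable [set x : 'rV[R]_n | forall i, B i (x ord0 i)].
Proof.
move=> mB; rewrite (_ : [set _ | _] = \bigcap_(i in [set: 'I_n])
    (fun x : 'rV[R]_n => x ord0 i) @^-1` B i).
  apply: fin_bigcap_measurable => // i _; rewrite -[X in measurable X]setTI.
  by apply: measurable_coor => //; exact: mB.
by apply/seteqP; split=> [x Bx i _|x Bx i]; [exact: Bx|exact: (Bx i I)].
Qed.

(** The sigma-algebra is generated by the coordinates, so U is written as a countable union of boxes
    with rational centres. The radius d satisfies [2 * d < e] because x and the other points of the
    box are each only within d of the centre. *)
Lemma open_measurable_rv n (U : set 'rV[R]_n) : open U ->
  measurable (U : set 'rV[R]_n).
Proof.
move=> oU.
pose box (p : 'rV[rat]_n * nat) : set 'rV[R]_n :=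
  [set x | forall i, (ball (ratr (p.1 ord0 i) : R) p.2.+1%:R^-1) (x ord0 i)].
pose D (p : 'rV[rat]_n * nat) := `[< box p `<=` U >].
rewrite (_ : U = \bigcup_(p in [set p | D p]) box p); last first.
  apply/seteqP; split=> [x Ux|x [p /asboolP pU px]]; last exact: pU.
  have : nbhs x U by exact: open_nbhs_nbhs.
  move=> /nbhs_ballP[e /= e0 eU].
  have [k hk] : exists k : nat, 2 * k.+1%:R^-1 < e.
    exists (Num.truncn (2 / e)); rewrite ltr_pdivrMr ?ltr0n// mulrC -ltr_pdivrMr//.
    exact: truncnS_gt.
  have : (0 : R) < k.+1%:R^-1 by rewrite invr_gt0 ltr0n.
  set d : R := k.+1%:R^-1 in hk * => d0.
  have hc i : exists c : rat, ball (ratr c : R) d (x ord0 i).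
    have xk : x ord0 i - d < x ord0 i + d by rewrite ltrBlDr -addrA ltrDl addr_gt0.
    have [c] := rat_in_itvoo xk.
    rewrite in_itv/= => /andP[h1 h2]; exists c.
    by rewrite /ball/= ltr_norml; apply/andP; split; lra.
  have [c hc'] := choice hc.
  exists (\row_i c i, k) => /=; last by move=> i /=; rewrite mxE; exact: hc'.
  apply/asboolP => y /= hy; apply: eU; split => // i j; rewrite ord1.
  have := hy j; have := hc' j; rewrite mxE /ball/= -/d !ltr_norml.
  by move=> /andP[? ?] /andP[? ?]; apply/andP; split; lra.
rewrite bigcup_mkcond; apply: countable_bigcupT_measurable => [|p].
  exact: countableP.
case: ifPn => // _; apply: (@measurable_rv_box _ (fun i => ball (ratr (p.1 ord0 i) : R) p.2.+1%:R^-1)) => i.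
exact: measurable_ball.
Qed.

Lemma continuous_measurable_rv n (f : 'rV[R]_n -> R) : continuous f ->
  measurable_fun [set: 'rV[R]_n] f.
Proof.
move=> /continuousP cf; apply: (measurability _ (measurable_realfun.RGenOpens.measurableE R)).
move=> _ [_ [a [b ->] <-]]; rewrite setTI; apply: open_measurable_rv.
exact/cf/interval_open.
Qed.

Lemma lebesgue_rv_ball_lty n (M : R) :
  (lebesgue_rv n [set x | forall i, `[(- M)%R, M]%classic (x ord0 i)] < +oo)%E.
Proof.
rewrite (lebesgue_rv_box (B := fun=> `[(- M)%R, M]%classic))//.
have -> : lebesgue_measure (`[(- M)%R, M]%classic : set (measurableTypeR R)) =
    (fine (lebesgue_measure (`[(- M)%R, M]%classic : set (measurableTypeR R))))%:E.
  by rewrite fineK// lebesgue_measure_itv/=; case: ifP.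
rewrite prodEFin; exact: ltry.
Qed.

Lemma lebesgue_rv_sigma_finite n : sigma_finite setT (@lebesgue_rv R n).
Proof.
exists (fun k => [set x : 'rV[R]_n | forall i, `[- k%:R, k%:R]%classic (x ord0 i)]).
  apply/esym; rewrite -subTset => x _; exists (Num.truncn `|x|).+1 => //= i.
  rewrite in_itv/= -ler_norml; move: i; apply/rv_norm_leP => //; exact/ltW/truncnS_gt.
move=> k; split; first by apply: (@measurable_rv_box _ (fun=> _)) => i; exact: measurable_itv.
exact: lebesgue_rv_ball_lty.
Qed.

(** An alias of [lebesgue_rv] whose head constant carries the sigma-finite structure that Fubini's
    theorem asks for. *)
Definition lebesgue_rv_fun n : set 'rV[R]_n -> \bar R := lebesgue_rv n.

HB.instance Definition _ n := Measure.copy (@lebesgue_rv_fun n) (lebesgue_rv n).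

HB.instance Definition _ n := Measure_isSigmaFinite.Build _ _ _
  (@lebesgue_rv_fun n) (@lebesgue_rv_sigma_finite n).

(** By definition [lebesgue_rv n.+1] is the push-forward of the product measure under [rv_cons];
    integrability is transferred along with the integral because Fubini's theorem is applied
    next. *)
Lemma lebesgue_rv_integral_cons n (f : 'rV[R]_n.+1 -> \bar R) :
  measurable_fun [set: 'rV[R]_n.+1] f ->
  (@lebesgue_rv R n.+1).-integrable setT f ->
  (\int[lebesgue_rv n.+1]_x f x =
  \int[lebesgue_rv n \x lebesgue_measure]_p f (rv_cons p))%E /\
  (lebesgue_rv n \x lebesgue_measure)%E.-integrable setT (f \o @rv_cons R n).
Proof.
move=> mf intf.
have intf' : (lebesgue_rv n \x lebesgue_measure)%E.-integrable setT (f \o @rv_cons R n).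
  apply/integrableP; split; first exact: (measurableT_comp mf (@measurable_rv_cons R n)).
  move/integrableP : intf => [_]; apply: le_lt_trans.
  have H := @ge0_integral_pushforward _ _ _ _ _ _ (@measurable_rv_cons R n) (lebesgue_rv n \x lebesgue_measure)%E setT (abse \o f) measurableT.
  have -> : (\int[lebesgue_rv n.+1]_x `|f x| = \int[pushforward (lebesgue_rv n \x lebesgue_measure) (@rv_cons R n)]_(x in setT) (abse \o f) x)%E by [].
  rewrite H ?preimage_setT//; first exact: measurableT_comp.
  by move=> x _; exact: abse_ge0.
split=> //.
have H := @integral_pushforward _ _ _ _ _ _ (@measurable_rv_cons R n) (lebesgue_rv n \x lebesgue_measure)%E setT f mf.
have -> : (\int[lebesgue_rv n.+1]_x f x = \int[pushforward (lebesgue_rv n \x lebesgue_measure) (@rv_cons R n)]_(x in setT) f x)%E by [].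
by rewrite H ?preimage_setT.
Qed.

Lemma continuous_supp_integrable n (f : 'rV[R]_n -> R) (M : R) :
  continuous f -> (forall x, M < `|x| -> f x = 0) ->
  (@lebesgue_rv R n).-integrable setT (EFin \o f).
Proof.
move=> cf f0.
wlog M0 : M f0 / 0 <= M.
  move=> /(_ (Num.max M 0)); apply; last by rewrite le_max lexx orbT.
  by move=> x; rewrite gt_max => /andP[/f0].
set B := [set x : 'rV[R]_n | forall i, `[- M, M]%classic (x ord0 i)].
have BE x : B x <-> `|x| <= M.
  rewrite (rv_norm_leP _ M0); split=> h j; have := h j; by rewrite /= in_itv/= ler_norml.
have mB : measurable B by apply: (@measurable_rv_box _ (fun=> _)) => i; exact: measurable_itv.
have fE : EFin \o f = (EFin \o f) \_ B.
  apply/funext => x; rewrite patchE; case: ifPn => //; rewrite notin_setE => Bx /=.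
  by rewrite f0// ltNge; apply/negP => /BE.
rewrite fE; apply/(integrable_mkcond _ mB).
have [C [C0 hC]] : exists C : R, 0 < C /\ forall x, `|f x| <= C.
  apply: (continuous_supp_bounded (K := [set x | `|x| <= M])) => //.
    exact: compact_norm_le.
  by move=> x /negP; rewrite -ltNge; exact: f0.
apply: measurable_bounded_integrable => //.
- exact: lebesgue_rv_ball_lty.
- exact: measurable_funTS (continuous_measurable_rv cf).
- exists C; split; first exact: num_real.
  by move=> y Cy x _ /=; apply: le_trans (hC x) (ltW Cy).
Qed.

Lemma integral_derive1_supp (F : R -> R) (M : R) :
  (forall x : R, derivable F x 1) -> continuous (derive1 F) ->
  (forall x, M < `|x| -> F x = 0) ->
  (\int[lebesgue_measure]_x (derive1 F x)%:E = 0)%E.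
Proof.
move=> dF cF F0.
wlog M0 : M F0 / 0 <= M.
  move=> /(_ (Num.max M 0)); apply; last by rewrite le_max lexx orbT.
  by move=> x; rewrite gt_max => /andP[/F0].
(* F is known to vanish only where [M < |x|] strictly; enlarging the interval by 1 makes it vanish
   at both endpoints and near every point outside. *)
have -> : (\int[lebesgue_measure]_x (derive1 F x)%:E =
    \int[lebesgue_measure]_(x in `[(- (M + 1))%R, (M + 1)%R]) (derive1 F x)%:E)%E.
  rewrite [RHS]integral_mkcond; apply: eq_integral => x _; rewrite patchE.
  case: ifPn => //; rewrite notin_setE/= in_itv/= -ler_norml => /negP; rewrite -ltNge => h.
  congr EFin; apply: (@derive1_near_cst _ _ 0).
  near=> y; apply: F0; apply: (@lt_trans _ _ (M + 1)); first lra.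
  near: y; have : (fun z : R => `|z|) @ x --> `|x| by apply: norm_continuous.
  by move=> /cvgr_gt/(_ _ h).
have cFF : continuous F.
  by move=> x; exact/differentiable_continuous/derivable1_diffP/dF.
have ab : - (M + 1) < M + 1 by lra.
have Fab : derivable_oo_LRcontinuous F (- (M + 1)) (M + 1).
  split=> [x _| |]; first exact: dF.
  - exact: cvg_at_right_filter (cFF _).
  - exact: cvg_at_left_filter (cFF _).
rewrite (continuous_FTC2 ab (continuous_subspaceT cF) Fab) //.
by rewrite !F0 ?subee// ?normrN ger0_norm; lra.
Unshelve. all: by end_near. Qed.


Lemma rv_consD n (i : 'I_n) (h : R) (x : 'rV[R]_n) (y : R) :
  rv_cons (h *: delta_mx ord0 i + x, y) =
  h *: delta_mx ord0 (lift ord0 i) + rv_cons (x, y).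
Proof.
apply/rowP => j; rewrite !mxE/=; case: (unliftP ord0 j) => [k ->|->] /=.
  by rewrite !mxE (inj_eq lift_inj).
by rewrite mulr0 add0r.
Qed.

Lemma rv_consD0 n (h : R) (x : 'rV[R]_n) (y : R) :
  rv_cons (x, h * 1 + y) = h *: delta_mx ord0 ord0 + rv_cons (x, y).
Proof.
apply/rowP => j; rewrite !mxE/=; case: (unliftP ord0 j) => [k ->|->] /=.
  by rewrite mulr0 add0r.
by [].
Qed.

Lemma rv_cons_norm n (x : 'rV[R]_n) (y : R) :
  `|x| <= `|rv_cons (x, y)| /\ `|y| <= `|rv_cons (x, y)|.
Proof.
have /rv_norm_leP h := lexx `|rv_cons (x, y)|; split.
  apply/rv_norm_leP => // j.
  have /(_ (normr_ge0 _) (lift ord0 j)) := h.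
  by rewrite mxE liftK.
by have /(_ (normr_ge0 _) ord0) := h; rewrite mxE unlift_none.
Qed.

Lemma continuous_rv_consr n (x : 'rV[R]_n) : continuous (fun y : R => rv_cons (x, y)).
Proof.
move=> y; apply/cvg_ballP => e e0; have : nbhs y (ball y e) by exact: nbhsx_ballx.
apply: filterS => z hz; split=> // k j; rewrite !mxE/= ord1 {k}.
by case: (unliftP ord0 j) => [k _|_] /=; [exact: ballxx|exact: hz].
Qed.

Lemma continuous_rv_consl n (y : R) : continuous (fun x : 'rV[R]_n => rv_cons (x, y)).
Proof.
move=> x A /nbhs_ballP[e /= e0 eA].
have : nbhs x (ball x e) by exact: nbhsx_ballx.
apply: filterS => z [_ hz]; apply: eA; split=> // k j; rewrite !mxE/= ord1 {k}.
by case: (unliftP ord0 j) => [k _|_] /=; [exact: hz|exact: ballxx].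
Qed.

(** Induction on the dimension. The order of integration is chosen so that the inner integral
    contains direction i: a direction [lift ord0 j] is left to the induction hypothesis, direction
    [ord0] to the fundamental theorem of calculus. *)
Lemma integral_pd_supp n (i : 'I_n) (f : 'rV[R]_n -> R) (M : R) :
  continuous f -> (forall x, derivable f x (delta_mx ord0 i)) ->
  continuous (pd i f) -> (forall x, M < `|x| -> f x = 0) ->
  (\int[lebesgue_rv n]_x (pd i f x)%:E = 0)%E.
Proof.
elim: n i f => [[]//|n IH] i f cf df cpf f0.
have pf0 x : M < `|x| -> pd i f x = 0.
  rewrite ltNge => /negP; apply: (pd_supp (K := [set x | `|x| <= M])).
    exact: closed_norm_le.
  by move=> y /negP; rewrite -ltNge; exact: f0.
have intp := continuous_supp_integrable cpf pf0.
have mp : measurable_fun setT (EFin \o pd i f).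
  by apply/measurable_EFinP; exact: continuous_measurable_rv.
have [-> intc] := lebesgue_rv_integral_cons mp intp.
have Df z : is_derive z (delta_mx ord0 i) f (pd i f z) := derivableP (df z).
have cx (x : 'rV[R]_n) (g : 'rV[R]_n.+1 -> R) : continuous g ->
  continuous (fun y : R => g (rv_cons (x, y))).
  by move=> cg y; apply: continuous_comp; [exact: continuous_rv_consr|exact: cg].
have cy (y : R) (g : 'rV[R]_n.+1 -> R) : continuous g ->
  continuous (fun x : 'rV[R]_n => g (rv_cons (x, y))).
  by move=> cg x; apply: continuous_comp; [exact: continuous_rv_consl|exact: cg].
case: (unliftP ord0 i) => [j ij|i0].
  rewrite -(@integral21_prod_meas1 _ _ _ _ _ (@lebesgue_rv_fun n) lebesgue_measure _ intc).
  rewrite (eq_integral (fun=> 0%E)) ?integral0// => y _ /=.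
  have D (x : 'rV[R]_n) : is_derive x (delta_mx ord0 j) (fun x => f (rv_cons (x, y))) (pd i f (rv_cons (x, y))).
    apply/is_derive_lineP.
    under eq_fun do rewrite rv_consD -ij.
    exact: (is_derive_lineP f _ _ _).1 (Df _).
  rewrite -[RHS](IH j (fun x => f (rv_cons (x, y)))).
  - by apply: eq_integral => x _; rewrite (pd_is_derive (D x)).
  - exact: cy.
  - by move=> x; have [] := D x.
  - rewrite (_ : pd j _ = fun x => pd i f (rv_cons (x, y))); first exact: cy.
    by apply/funext => x; exact: pd_is_derive (D x).
  - move=> x Mx; apply: f0; apply: (lt_le_trans Mx).
    by have [] := rv_cons_norm x y.
rewrite -(@integral12_prod_meas1 _ _ _ _ _ (@lebesgue_rv_fun n) lebesgue_measure _ intc).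
rewrite (eq_integral (fun=> 0%E)) ?integral0// => x _ /=.
have D (y : R) : is_derive y (1:R) (fun y : R => f (rv_cons (x, y))) (pd i f (rv_cons (x, y))).
  apply/is_derive_lineP.
  under eq_fun do rewrite rv_consD0 -i0.
  exact: (is_derive_lineP f _ _ _).1 (Df _).
have DE := derive1_funE D.
rewrite -[RHS](@integral_derive1_supp (fun y : R => f (rv_cons (x, y))) M).
- by rewrite DE.
- by move=> y; have [] := D y.
- by rewrite DE; exact: cx.
- move=> y My; apply: f0; apply: (lt_le_trans My).
  by have [] := rv_cons_norm x y.
Qed.

End rv_measure.

(** * The phase *)

Section phase.
Context {R : realType}.
Implicit Types f g : R -> R.

Lemma derive1_affine_comp (a b c x : R) f : smooth1 f ->
  is_derive x (1:R) (fun y => a * f (b * y + c)) (a * b * derive1 f (b * x + c)).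
Proof.
move=> sf; have h1 := is_derive_affine b c x.
have h2 := @is_derive1_comp _ f (fun y : R => b * y + c) x _ _ (smooth1_is_derive (b * x + c) sf) h1.
have h := is_deriveZ a h2; apply: is_derive_eq h _.
by rewrite /GRing.scale/=; ring.
Qed.

Lemma smooth1_affine_comp (a b c : R) f : smooth1 f -> smooth1 (fun y => a * f (b * y + c)).
Proof.
move=> sf; apply: smooth1M; first exact: smooth1_cst.
by apply: (smooth1_comp sf); exact: smooth1_affine.
Qed.

Lemma derive1_affine_compE (a b c : R) f : smooth1 f ->
  derive1 (fun y => a * f (b * y + c)) = (fun x => a * b * derive1 f (b * x + c)).
Proof. by move=> sf; apply: derive1_funE => x; exact: derive1_affine_comp. Qed.

Lemma derive1_smoothD f g : smooth1 f -> smooth1 g ->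
  derive1 (fun x => f x + g x) = fun x => derive1 f x + derive1 g x.
Proof.
move=> sf sg; apply: derive1_funE => x.
exact: is_deriveD (smooth1_is_derive x sf) (smooth1_is_derive x sg).
Qed.

(* Smooth, equal to 0 on the left and to x on the right: its derivative goes from 0
   to 1, so that a phase with prescribed slopes is a sum of rescaled ramps and no
   antiderivative has to be constructed. *)
Definition ramp (x : R) : R := x * smoothstep (3 * x - 1).

Lemma smooth1_ramp : smooth1 ramp.
Proof.
apply: smooth1M; first exact: smooth1_id.
by apply: (smooth1_comp (f := smoothstep)); [exact: smooth1_smoothstep|exact: smooth1_affine].
Qed.

Lemma ramp_left x : x < 3^-1 -> derive1 ramp x = 0.
Proof.
move=> x3; apply: (@derive1_near_cst _ _ 0); near=> y.
have y3 : y < 3^-1 by near: y; exact: lt_nbhsl.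
by rewrite /ramp smoothstep_le0 ?mulr0//; lra.
Unshelve. all: by end_near. Qed.

Lemma ramp_right x : 2 / 3 < x -> derive1 ramp x = 1.
Proof.
move=> x3; have h : is_derive x (1:R) ramp 1.
  apply: (@is_derive_near _ (fun y => y)); near=> y.
  have y3 : 2 / 3 < y by near: y; exact: lt_nbhsr.
  by rewrite /ramp smoothstep_ge1 ?mulr1//; lra.
by rewrite derive1E; apply: derive_val.
Unshelve. all: by end_near. Qed.

Lemma ramp_left2 x : x < 3^-1 -> derive1 (derive1 ramp) x = 0.
Proof.
move=> x3; apply: (@derive1_near_cst _ _ 0); near=> y; apply: ramp_left.
near: y; exact: lt_nbhsl.
Unshelve. all: by end_near. Qed.

Lemma ramp_right2 x : 2 / 3 < x -> derive1 (derive1 ramp) x = 0.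
Proof.
move=> x3; apply: (@derive1_near_cst _ _ 1); near=> y; apply: ramp_right.
near: y; exact: lt_nbhsr.
Unshelve. all: by end_near. Qed.

Lemma ramp_bounds : exists M : R, [/\ 1 <= M,
  forall x, `|derive1 ramp x| <= M & forall x, `|derive1 (derive1 ramp) x| <= M].
Proof.
have s1 := smooth1_derive1 smooth1_ramp.
have s2 := smooth1_derive1 s1.
have [||c _ hc] := @EVT_max R (fun x => `|derive1 ramp x|) 0 1; first lra.
  apply: continuous_subspaceT => x; apply: (@continuous_comp _ _ _ (derive1 ramp) (fun z : R => `|z|)).
    exact: smooth1_cont.
  exact: norm_continuous.
have [|M2 [M20 h2]] := bounded_supp (smooth1_cont s2).
  by move=> x; rewrite ltr_normr => /orP[h|h]; [apply: ramp_right2|apply: ramp_left2]; lra.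
exists (`|derive1 ramp c| + (M2 + 1)); have n0 := normr_ge0 (derive1 ramp c); split; first lra.
  move=> x; have [x0|x0] := ltP x 0; first by rewrite ramp_left ?normr0; lra.
  have [x1|x1] := ltP 1 x; first by rewrite ramp_right ?normr1; lra.
  have := hc x; rewrite in_itv/= x0 x1 => /(_ isT) h.
  by apply: le_trans h _; rewrite lerDl addr_ge0.
by move=> x; apply: le_trans (h2 x) _; lra.
Qed.

(* [derive1 th] follows f at the nodes s + j d; each step adds one rescaled ramp. *)
Lemma smooth_steps (M D s e d : R) f (N : nat) : 0 < d -> 0 <= D ->
  (forall x, `|derive1 ramp x| <= M) -> (forall x, `|derive1 (derive1 ramp) x| <= M) ->
  (forall x y, s <= x <= e -> s <= y <= e -> `|f x - f y| <= D * `|x - y|) ->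
  s + N%:R * d <= e ->
  exists th : R -> R, [/\ smooth1 th,
    forall x, s <= x <= s + N%:R * d -> `|derive1 th x - f x| <= (M + 1) * D * d,
    forall x, s <= x <= s + N%:R * d -> `|derive1 (derive1 th) x| <= M * D &
    forall x, s + N%:R * d <= x -> derive1 th x = f (s + N%:R * d) /\
      derive1 (derive1 th) x = 0].
Proof.
move=> d0 D0 hM1 hM2 lip.
have M0 : 0 <= M by apply: le_trans (hM1 0).
elim: N => [|N IH] se.
  (* For N = 0 the interval is the point s, and an affine function of slope [f s] will do. *)
  have dE : derive1 (fun x => f s * x + 0) = fun=> f s.
    by apply: derive1_funE => x; exact: is_derive_affine.
  have ddE : derive1 (fun _ : R => f s) = fun=> 0.
    by apply: derive1_funE => x; exact: is_derive_cst.
  exists (fun x => f s * x + 0); split; first exact: smooth1_affine.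
  - move=> x; rewrite mul0r addr0 => /le_anti <-.
    by rewrite dE subrr normr0 !mulr_ge0 ?addr_ge0// ltW.
  - by move=> x _; rewrite dE ddE normr0 mulr_ge0.
  - by move=> x _; rewrite dE ddE mul0r addr0.
have e1 : s + N.+1%:R * d = s + N%:R * d + d by rewrite -natr1; ring.
rewrite e1 in se *; set t := s + N%:R * d in IH se *.
have [|th [sth h1 h2 h3]] := IH; first lra.
have st : s <= t by rewrite /t lerDl mulr_ge0// ltW.
have dn0 : d != 0 by rewrite gt_eqF.
pose c := f (t + d) - f t.
have cb : `|c| <= D * d.
  have := lip (t + d) t; rewrite /c (_ : t + d - t = d); last ring.
  by rewrite (gtr0_norm d0); apply; lra.
(* The factor d cancels against the rescaling by [d^-1]: the slope changes by exactly c, and the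
   second derivative is at most [M |c| / d <= M D], whatever d is. *)
pose th' := fun x => th x + (c * d) * ramp (d^-1 * x + (- t / d)).
have s' := smooth1_affine_comp (c * d) d^-1 (- t / d) smooth1_ramp.
have dE : derive1 th' = fun x => derive1 th x + c * derive1 ramp (d^-1 * x + (- t / d)).
  rewrite /th' derive1_smoothD// derive1_affine_compE; last exact: smooth1_ramp.
  by apply/funext => x; congr (_ + _ * _); field.
have s'' := smooth1_affine_comp c d^-1 (- t / d) (smooth1_derive1 smooth1_ramp).
have ddE : derive1 (derive1 th') = fun x => derive1 (derive1 th) x +
    c / d * derive1 (derive1 ramp) (d^-1 * x + (- t / d)).
  rewrite dE derive1_smoothD//; last exact: smooth1_derive1.
  by rewrite derive1_affine_compE//; exact: smooth1_derive1 smooth1_ramp.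
have arg x : d^-1 * x + (- t / d) = (x - t) / d by ring.
have argl x : x <= t -> d^-1 * x + (- t / d) < 3^-1.
  by move=> xt; rewrite arg ltr_pdivrMr//; lra.
have argr x : t + d <= x -> 2 / 3 < d^-1 * x + (- t / d).
  move=> xt; rewrite arg ltr_pdivlMr//; lra.
exists th'; split; first exact: smooth1D.
- move=> x /andP[sx xt]; rewrite dE; have [xt'|xt'] := leP x t.
    by rewrite ramp_left ?mulr0 ?addr0; [apply: h1; rewrite sx xt'|exact: argl].
  have [-> _] := h3 x (ltW xt').
  have l1 : `|f t - f x| <= D * d.
    apply: le_trans (lip t x _ _) _; try by apply/andP; split; lra.
    by rewrite ler_wpM2l// ler_norml; apply/andP; split; lra.
  have l2 : `|c * derive1 ramp (d^-1 * x + (- t / d))| <= D * d * M.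
    by rewrite normrM ler_pM.
  rewrite (_ : _ - f x = (f t - f x) + c * derive1 ramp (d^-1 * x + (- t / d))); last ring.
  apply: le_trans (ler_normD _ _) _; apply: le_trans (lerD l1 l2) _.
  by rewrite le_eqVlt; apply/orP; left; apply/eqP; ring.
- move=> x /andP[sx xt]; rewrite ddE; have [xt'|xt'] := leP x t.
    by rewrite ramp_left2 ?mulr0 ?addr0; [apply: h2; rewrite sx xt'|exact: argl].
  have [_ ->] := h3 x (ltW xt').
  rewrite add0r normrM normrM normfV (gtr0_norm d0) mulrC; apply: ler_pM => //.
    by rewrite mulr_ge0// invr_ge0 ltW.
  by rewrite ler_pdivrMr.
- move=> x tx; rewrite ddE dE; have [|-> ->] := h3 x; first lra.
  rewrite ramp_right ?ramp_right2 ?mulr0 ?addr0; try exact: argr.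
  by rewrite /c; split => //; ring.
Qed.

Lemma smooth_phase : exists M : R, 1 <= M /\ forall f (s e D : R), s < e -> 0 <= D ->
  (forall x y, s <= x <= e -> s <= y <= e -> `|f x - f y| <= D * `|x - y|) ->
  forall eta : R, 0 < eta -> exists th : R -> R, smooth1 th /\
    forall x, s <= x <= e -> `|derive1 th x - f x| <= eta /\
      `|derive1 (derive1 th) x| <= M * D.
Proof.
have [M [M1 h1 h2]] := ramp_bounds; exists M; split => // f s e D se D0 lip eta eta0.
pose N := (Num.truncn ((M + 1) * D * (e - s) / eta)).+1.
have N0 : (0 : R) < N%:R by rewrite ltr0n.
pose d := (e - s) / N%:R.
have d0 : 0 < d by rewrite divr_gt0// subr_gt0.
have Nd : s + N%:R * d = e by rewrite /d mulrC divfK ?gt_eqF//; ring.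
have [|th [sth a b _]] := @smooth_steps M D s e d f N d0 D0 h1 h2 lip; first by rewrite Nd.
rewrite Nd in a b; exists th; split=> // x hx; split; last exact: b.
apply: le_trans (a x hx) _; rewrite /d mulrA ler_pdivrMr// -ler_pdivrMl// mulrC.
exact/ltW/truncnS_gt.
Qed.

Lemma mvt_lip f (df : R -> R) (a b D : R) :
  (forall x, a <= x <= b -> is_derive x (1:R) f (df x)) ->
  (forall x, a <= x <= b -> `|df x| <= D) ->
  forall x y, a <= x <= b -> a <= y <= b -> `|f x - f y| <= D * `|x - y|.
Proof.
move=> hd hD x y; wlog xy : x y / y <= x.
  by move=> H hx hy; have [xy|xy] := leP y x; [exact: H|rewrite distrC [`|x - y|]distrC; apply: H => //; exact: ltW].
move=> /andP[ax xb] /andP[ay yb].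
have [||c] := @MVT_segment R f df y x xy.
- by move=> z; rewrite in_itv/= => /andP[yz zx]; apply: hd; lra.
- apply: derivable_within_continuous => z; rewrite in_itv/= => /andP[yz zx].
  by have [] : is_derive z (1:R) f (df z) by apply: hd; lra.
rewrite in_itv/= => /andP[yc cx] ->.
by rewrite normrM ler_wpM2r//; apply: hD; lra.
Qed.

(** In place of Gronwall's inequality, f is compared with its maximum, attained at c. Its Lipschitz
    constant is at most [k * f c], so it deviates from [f s] by at most [f c / 4]. Hence
    [f c <= 4 / 3 * f s], and [f x >= f s - f c / 4 >= 2 / 3 * f s]. *)
Lemma slowly_varying f (df : R -> R) (a b s k : R) : a <= s <= b ->
  (forall x, a <= x <= b -> is_derive x (1:R) f (df x)) ->
  (forall x, a <= x <= b -> 0 < f x) ->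
  (forall x, a <= x <= b -> `|df x| <= k * f x) -> k * (b - a) <= 4^-1 -> 0 <= k ->
  (forall x, a <= x <= b -> 2 / 3 * f s <= f x <= 4 / 3 * f s) /\
  forall x y, a <= x <= b -> a <= y <= b -> `|f x - f y| <= k * (4 / 3 * f s) * `|x - y|.
Proof.
move=> sab hd f0 hk kab k0; have ab : a <= b by lra.
have cf : {within `[a, b], continuous f}.
  apply: derivable_within_continuous => z; rewrite in_itv/= => hz.
  by have [] := hd z hz.
have [c] := EVT_max ab cf; rewrite in_itv/= => hc hmax.
have hm x : a <= x <= b -> f x <= f c by move=> hx; apply: hmax; rewrite in_itv.
have lip := mvt_lip hd (D := k * f c) (fun x hx => le_trans (hk x hx) (ler_wpM2l k0 (hm x hx))).
have fc0 := f0 _ hc.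
have osc x : a <= x <= b -> `|f x - f s| <= f c / 4.
  move=> hx; apply: le_trans (lip x s hx sab) _.
  rewrite mulrAC mulrC; apply: ler_wpM2l; first exact: ltW.
  apply: le_trans kab; apply: ler_wpM2l => //.
  by rewrite ler_norml; lra.
have fcs : f c <= 4 / 3 * f s.
  by have := osc c hc; rewrite ler_norml => /andP[]; lra.
split=> [x hx|x y hx hy].
  have := osc x hx; have := hm x hx; rewrite ler_norml => ? /andP[? ?]; apply/andP; split; lra.
by apply: le_trans (lip x y hx hy) _; rewrite ler_wpM2r// ler_wpM2l.
Qed.

End phase.

(** * Derivatives of a modulated cutoff on the line *)

Section wave.
Context {R : realType}.

Lemma derive1_smoothM (f g : R -> R) : smooth1 f -> smooth1 g ->
  derive1 (fun x => f x * g x) = fun x => f x * derive1 g x + derive1 f x * g x.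
Proof.
move=> sf sg; apply: derive1_funE => x.
have h := is_deriveM (smooth1_is_derive x sf) (smooth1_is_derive x sg).
by apply: is_derive_eq h _; rewrite /GRing.scale/= [g x * _]mulrC.
Qed.

Lemma derive1_smooth_comp (f g : R -> R) : smooth1 f -> smooth1 g ->
  derive1 (fun x => f (g x)) = fun x => derive1 f (g x) * derive1 g x.
Proof.
move=> sf sg; apply: derive1_funE => x.
exact: (@is_derive1_comp _ f g x _ _ (smooth1_is_derive _ sf) (smooth1_is_derive x sg)).
Qed.

Lemma derive1_cosE : derive1 (@cos R) = fun x => - sin x.
Proof. by apply: derive1_funE => x; exact: is_derive_cos. Qed.

Lemma derive1_sinE : derive1 (@sin R) = cos.
Proof. by apply: derive1_funE => x; exact: is_derive_sin. Qed.

Lemma normr_cos_le1 (x : R) : `|cos x| <= 1.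
Proof. by rewrite ler_norml cos_geN1 cos_le1. Qed.

Lemma normr_sin_le1 (x : R) : `|sin x| <= 1.
Proof. by rewrite ler_norml sin_geN1 sin_le1. Qed.

Variables (th u : R -> R).
Hypotheses (sth : smooth1 th) (su : smooth1 u).

Section trig.
Variables (t t1 : R -> R).
Hypotheses (st : smooth1 t) (st1 : smooth1 t1).
Hypotheses (dt : derive1 t = t1) (dt1 : derive1 t1 = fun x => - t x).

Let comp0 : derive1 (fun x => t (th x)) = fun x => t1 (th x) * derive1 th x.
Proof. by rewrite (derive1_smooth_comp st sth) dt. Qed.

Let comp1 : derive1 (fun x => t1 (th x)) = fun x => - t (th x) * derive1 th x.
Proof. by rewrite (derive1_smooth_comp st1 sth) dt1. Qed.

(** The pair (t, t1) stands for (cos, -sin) or (sin, cos), so that the real and imaginary parts of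
    [exp (i th) u] are treated at once. *)
Lemma derive1_wave : derive1 (fun x => t (th x) * u x) =
  fun x => t1 (th x) * derive1 th x * u x + t (th x) * derive1 u x.
Proof.
rewrite derive1_smoothM//; last exact: (smooth1_comp st sth).
by apply/funext => x; rewrite comp0 addrC.
Qed.

Lemma derive2_wave : derive1 (derive1 (fun x => t (th x) * u x)) =
  fun x => t (th x) * (derive1 (derive1 u) x - derive1 th x ^+ 2 * u x) +
   t1 (th x) * (derive1 (derive1 th) x * u x + 2 * (derive1 th x * derive1 u x)).
Proof.
have sdth := smooth1_derive1 sth; have sdu := smooth1_derive1 su.
have s1 := smooth1_comp st1 sth; have s0 := smooth1_comp st sth.
rewrite derive1_wave derive1_smoothD; first last.
- exact: smooth1M.
- by apply: smooth1M => //; exact: smooth1M.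
rewrite (derive1_smoothM (f := fun x => t1 (th x) * derive1 th x))//; last exact: smooth1M.
rewrite (derive1_smoothM (f := fun x => t1 (th x)))// derive1_smoothM//.
rewrite comp0 comp1; apply/funext => x.
have key (y y1 q q1 z z1 z2 : R) :
    y1 * q * z1 + (y1 * q1 + - y * q * q) * z + (y * z2 + y1 * q * z1) =
    y * (z2 - q ^+ 2 * z) + y1 * (q1 * z + 2 * (q * z1)) by ring.
exact: key.
Qed.

Hypotheses (tb : forall x, `|t x| <= 1) (t1b : forall x, `|t1 x| <= 1).

(** The four terms are the eikonal mismatch, the curvature of the phase, the cross term of phase and
    cutoff, and the second derivative of the cutoff. The oscillating factors and u itself are
    bounded by 1. *)
Lemma wave_bound (a K L x : R) : 0 <= K -> 0 < L -> 0 <= u x <= 1 ->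
  `|derive1 u x| <= K / L -> `|derive1 (derive1 u) x| <= K / L ^+ 2 ->
  `|derive1 (derive1 (fun x => t (th x) * u x)) x + a * (t (th x) * u x)| <=
  `|a - derive1 th x ^+ 2| + `|derive1 (derive1 th) x| +
  2 * (`|derive1 th x| * (K / L)) + K / L ^+ 2.
Proof.
move=> K0 L0 /andP[u0 u1] d1 d2; rewrite derive2_wave.
set p := derive1 th x; set p1 := derive1 (derive1 th) x.
set v := derive1 u x in d1 *; set w := derive1 (derive1 u) x in d2 *.
have M1 (z y : R) : `|z| <= 1 -> `|z * y| <= `|y|.
  by move=> z1; rewrite normrM ler_piMl.
have Mu (y : R) : `|y * u x| <= `|y|.
  by rewrite normrM ler_piMr// ger0_norm.
have key (y y1 b q q1 z z1 z2 : R) :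
    y * (z2 - q ^+ 2 * z) + y1 * (q1 * z + 2 * (q * z1)) + b * (y * z) =
    y * ((b - q ^+ 2) * z) + y1 * (q1 * z) + y1 * (2 * (q * z1)) + y * z2 by ring.
rewrite key.
apply: le_trans (ler_normD _ _) _; apply: lerD; last exact: le_trans (M1 _ _ (tb _)) d2.
apply: le_trans (ler_normD _ _) _; apply: lerD.
  apply: le_trans (ler_normD _ _) _; apply: lerD.
    exact: le_trans (M1 _ _ (tb _)) (Mu _).
  exact: le_trans (M1 _ _ (t1b _)) (Mu _).
apply: le_trans (M1 _ _ (t1b _)) _.
by rewrite !normrM ger0_norm// !ler_wpM2l.
Qed.

End trig.
End wave.

(** * Laplacian of a product of longitudinal and transversal factors *)

Section profile.
Context {R : realType} {n : nat}.
Local Notation T := 'rV[R]_n.+1.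

Definition profile (g chi : R -> R) : 'I_n.+1 -> R -> R :=
  fun i => if i == ord0 then g else chi.

Variables (g chi : R -> R).
Hypotheses (sg : smooth1 g) (schi : smooth1 chi).

Lemma smooth1_profile i : smooth1 (profile g chi i).
Proof. by rewrite /profile; case: ifP. Qed.

Lemma pd2_tensor (G : 'I_n.+1 -> R -> R) i (x : T) : (forall i, smooth1 (G i)) ->
  pd i (pd i (tensor G)) x =
  derive1 (derive1 (G i)) (x ord0 i) * \prod_(k | k != i) G k (x ord0 k).
Proof.
move=> sG; rewrite pd_tensor//.
have E : upd G i (derive1 (G i)) i = derive1 (G i) by rewrite /upd eqxx.
rewrite pd_tensor ?E; last exact: smooth1_derive1.
rewrite tensor_updE; congr (_ * _); apply: eq_bigr => k ki.
by rewrite /upd (negbTE ki).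
Qed.

Lemma pd_profile0 (x : T) : pd ord0 (tensor (profile g chi)) x =
  derive1 g (x ord0 ord0) * \prod_(k : 'I_n.+1 | k != ord0) chi (x ord0 k).
Proof.
rewrite pd_tensor; last exact: smooth1_profile.
rewrite tensor_updE; congr (_ * _).
by apply: eq_bigr => k k0; rewrite /profile (negbTE k0).
Qed.

Lemma tensor_profile (x : T) : tensor (profile g chi) x =
  g (x ord0 ord0) * \prod_(k : 'I_n.+1 | k != ord0) chi (x ord0 k).
Proof.
rewrite /tensor (bigD1 ord0)//=; congr (_ * _).
by apply: eq_bigr => k k0; rewrite /profile (negbTE k0).
Qed.

Lemma profile_bound (x : T) (a E C : R) :
  (forall y, `|g y| <= 1) -> (forall y, `|chi y| <= 1) ->
  (forall y, `|derive1 (derive1 chi) y| <= C) ->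
  `|derive1 (derive1 g) (x ord0 ord0) + a * g (x ord0 ord0)| <= E ->
  `|\sum_(i < n.+1) pd i (pd i (tensor (profile g chi))) x +
    a * tensor (profile g chi) x| <= E + n%:R * C.
Proof.
move=> g1 c1 hC hE.
have p1 (P : pred 'I_n.+1) (F : 'I_n.+1 -> R) : (forall k, `|F k| <= 1) -> `|\prod_(k | P k) F k| <= 1.
  by move=> h; rewrite normr_prod; apply: prodr_ile1 => k _; rewrite normr_ge0 h.
rewrite big_ord_recl (pd2_tensor _ _ smooth1_profile) tensor_profile.
rewrite [in X in X + _ + _](_ : profile g chi ord0 = g)//.
rewrite (eq_bigr (fun k => chi (x ord0 k))); last first.
  by move=> k k0; rewrite /profile (negbTE k0).
(* Only the longitudinal second derivative is grouped with the zeroth-order term, since these two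
   must cancel; each of the n transversal ones costs C. *)
rewrite addrAC mulrA -mulrDl.
apply: le_trans (ler_normD _ _) _; apply: lerD.
  by rewrite normrM; apply: le_trans hE; rewrite ler_piMr// p1.
apply: le_trans (ler_norm_sum _ _ _) _.
rewrite -[n in n%:R]card_ord -sum1_card natr_sum mulr_suml; apply: ler_sum => i _.
rewrite mul1r (pd2_tensor _ _ smooth1_profile) {1}/profile /=.
rewrite normrM; apply: le_trans (hC (x ord0 (lift ord0 i))).
rewrite ler_piMr// p1// => k; rewrite /profile; case: ifP => _; [exact: g1|exact: c1].
Qed.

End profile.

(** * Windows along the ray *)

Section window.
Context {R : realType}.

Lemma C1pos_is_derive (f : R -> R) (u : R) : C1pos f -> 0 < u ->
  is_derive u (1:R) f (derive1 f u).
Proof.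
move=> cf u0; have [d _] := cf u u0.
by rewrite derive1E; exact/derivableP.
Qed.

Lemma near_pinfty (P : R -> Prop) : (\forall u \near +oo, P u) ->
  exists M, forall u, M < u -> P u.
Proof. by move=> [M [_ h]]; exists M. Qed.

Lemma norm_cvg0_near (f : R -> R) (e : R) : 0 < e -> f u @[u --> +oo] --> (0 : R) ->
  \forall u \near +oo, `|f u| <= e.
Proof. by move=> e0 /cvgr0_norm_le; apply. Qed.

Lemma exists_gt (s : seq R) : exists M, 0 < M /\ forall x, x \in s -> x < M.
Proof.
elim: s => [|x s [M [M0 hM]]]; first by exists 1.
exists (M + `|x|); split=> [|y]; first by rewrite ltr_wpDr.
rewrite inE => /orP[/eqP ->|/hM yM]; last by rewrite ltr_wpDr.
by rewrite (le_lt_trans (ler_norm x))// ltrDr.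
Qed.

Lemma slow_window (f : R -> R) (l k s : R) : 0 < k -> 0 < l -> 2 * (k * l) <= 4^-1 ->
  C1pos f -> 0 < s - l ->
  (forall u, s - l <= u -> 0 < f u /\ `|derive1 f u| <= k * f u) ->
  (forall u, s - l <= u <= s + l -> 2 / 3 * f s <= f u <= 4 / 3 * f s) /\
  forall u v, s - l <= u <= s + l -> s - l <= v <= s + l ->
    `|f u - f v| <= k * (4 / 3 * f s) * `|u - v|.
Proof.
move=> k0 l0 kl cf sl hf.
apply: (@slowly_varying _ f (derive1 f)).
- by apply/andP; split; lra.
- move=> u /andP[u1 _]; exact: C1pos_is_derive cf (lt_le_trans sl u1).
- by move=> u /andP[u1 _]; have [] := hf u u1.
- by move=> u /andP[u1 _]; have [] := hf u u1.
- by rewrite (_ : s + l - (s - l) = 2 * l); lra.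
- exact: ltW.
Qed.

(** The derivative of [A^{1/2}] is [A' / (2 A^{1/2})], so the relative slope is halved to k / 2.
    This is why [k * l <= 4^-1] suffices on a window of length 2 l, and why the factor 4/3 in the
    Lipschitz constant is absorbed. *)
Lemma sqrt_window (A : R -> R) (l k s : R) : 0 < k -> 0 < l -> k * l <= 4^-1 ->
  C1pos A -> 0 < s - l ->
  (forall u, s - l <= u -> 0 < A u /\ `|derive1 A u| <= k * A u) ->
  let f u := Num.sqrt (A u) in
  (forall u, s - l <= u <= s + l -> 2 / 3 * f s <= f u <= 4 / 3 * f s) /\
  forall u v, s - l <= u <= s + l -> s - l <= v <= s + l ->
    `|f u - f v| <= k * f s * `|u - v|.
Proof.
move=> k0 l0 kl cA sl hA f.
have f0 u : s - l <= u -> 0 < f u by move=> /hA[h _]; rewrite sqrtr_gt0.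
have fs0 : 0 < f s by apply: f0; lra.
have [||||||H1 H2] := @slowly_varying _ f (fun u => (2 * f u)^-1 * derive1 A u) (s - l) (s + l) s (k / 2).
- by apply/andP; split; lra.
- move=> u /andP[u1 _].
  have dA := C1pos_is_derive cA (lt_le_trans sl u1).
  have := @is_derive1_comp _ (@Num.sqrt R) A u _ _ (is_derive1_sqrt (hA _ u1).1) dA.
  exact.
- by move=> u /andP[u1 _]; exact: f0.
- move=> u /andP[u1 _]; have fu := f0 _ u1.
  have [Au dAu] := hA _ u1.
  rewrite normrM ger0_norm ?invr_ge0 ?mulr_ge0 ?(ltW fu)// ler_pdivrMl ?mulr_gt0//.
  apply: le_trans dAu _; rewrite -[in leLHS](sqr_sqrtr (ltW Au)) -/(f u).
  by rewrite le_eqVlt; apply/orP; left; apply/eqP; field.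
- by rewrite (_ : s + l - (s - l) = 2 * l); lra.
- by lra.
split=> // u v hu hv; apply: le_trans (H2 u v hu hv) _.
rewrite ler_wpM2r// mulrA ler_wpM2r ?(ltW fs0)//; lra.
Qed.

(** All the asymptotic hypotheses on A and omega are turned here into inequalities on one window;
    from this point on neither function is passed to a limit. Both k and l are given first, and s is
    then taken large. *)
Lemma tube_window n (A omega : R -> R) :
  C1pos A -> A u @[u --> +oo] --> +oo ->
  `|derive1 A u| / A u @[u --> +oo] --> (0 : R) ->
  ((0 < n)%N -> forall u, 0 < u -> 0 < omega u) ->
  ((0 < n)%N -> [/\ C1pos omega,
      derive1 omega u / omega u @[u --> +oo] --> (0 : R) &
      omega u ^+ 4 / A u @[u --> +oo] --> (0 : R)]) ->
  forall k l s0 : R, 0 < k -> 0 < l -> exists s r : R,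
    let f u := Num.sqrt (A u) in
    [/\ 0 < s - l, s0 < s - l, 0 < r &
    [/\ k^-1 <= f s, forall u, s - l <= u <= s + l -> 0 < A u,
      forall u, s - l <= u <= s + l -> 2 / 3 * f s <= f u <= 4 / 3 * f s,
      forall u v, s - l <= u <= s + l -> s - l <= v <= s + l ->
        `|f u - f v| <= k * f s * `|u - v| &
      (forall x : 'rV[R]_n.+1, `|x ord0 ord0 - s| <= l ->
        (forall j : 'I_n, `|x ord0 (lift ord0 j)| <= r) -> tube omega x) /\
      n%:R / r ^+ 2 <= k * f s]].
Proof.
move=> cA Ay dA om0 hom k l s0 k0 l0.
(* The bound [(8 * l)^-1] makes A and omega vary little over a length 2 l; it yields the condition
   [2 * (k1 * l) <= 4^-1] of [slow_window]. *)
pose k1 := Num.min k (8 * l)^-1.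
have k10 : 0 < k1 by rewrite lt_min k0 invr_gt0 mulr_gt0.
have k1k : k1 <= k by rewrite ge_min lexx.
have k1l : k1 * l <= 8^-1.
  apply: (@le_trans _ _ ((8 * l)^-1 * l)); first by rewrite ler_wpM2r ?(ltW l0)// ge_min lexx orbT.
  by rewrite le_eqVlt; apply/orP; left; apply/eqP; field; lra.
have [M1 hM1] : exists M, forall u, M < u -> k^-1 ^+ 2 <= A u.
  by apply: near_pinfty; move/cvgryPge : Ay; apply.
have [M2 hM2] := near_pinfty (norm_cvg0_near k10 dA).
have hA u : M1 < u -> M2 < u -> 0 < A u /\ `|derive1 A u| <= k1 * A u.
  move=> u1 u2; have A0 : 0 < A u by apply: lt_le_trans (hM1 _ u1); rewrite exprn_gt0// invr_gt0.
  split => //; have := hM2 _ u2; rewrite ger0_norm ?divr_ge0 ?(ltW A0)//.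
  by rewrite ler_pdivrMr.
have W s : M1 < s - l -> M2 < s - l -> 0 < s - l ->
   [/\ k^-1 <= Num.sqrt (A s), forall u, s - l <= u <= s + l -> 0 < A u,
      forall u, s - l <= u <= s + l -> 2 / 3 * Num.sqrt (A s) <= Num.sqrt (A u) <= 4 / 3 * Num.sqrt (A s) &
      forall u v, s - l <= u <= s + l -> s - l <= v <= s + l ->
        `|Num.sqrt (A u) - Num.sqrt (A v)| <= k * Num.sqrt (A s) * `|u - v| ].
  move=> s1 s2 sl.
  have k4 : k1 * l <= 4^-1 by apply: le_trans k1l _; lra.
  have hAs u : s - l <= u -> 0 < A u /\ `|derive1 A u| <= k1 * A u.
    by move=> us; apply: hA; lra.
  have [a b] := sqrt_window k10 l0 k4 cA sl hAs.
  split => //.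
  - have kk : 0 <= k^-1 by rewrite invr_ge0 ltW.
    by rewrite -(ger0_norm kk) -sqrtr_sqr ler_wsqrtr// hM1//; lra.
  - by move=> u /andP[u1 _]; have [] := hA u; lra.
  - move=> u v hu hv; apply: le_trans (b u v hu hv) _.
    by rewrite ler_wpM2r// ler_wpM2r// sqrtr_ge0.
have [n0|n0] := posnP n.
  have [M [M0 hM]] := exists_gt [:: s0; M1; M2].
  have sE : M + l - l = M by ring.
  have [||| a b c d] := W (M + l); rewrite ?sE//; try by apply: hM; rewrite !inE eqxx ?orbT.
  (* In dimension one there is no transversal coordinate: r = 1 is an arbitrary positive value and
     [n / r ^ 2] is 0. *)
  exists (M + l), 1; rewrite sE; split=> //; first by apply: hM; rewrite !inE eqxx.
  rewrite sE in b c d.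
  split => //; split; last first.
    have fs : 0 <= Num.sqrt (A (M + l)) by exact: sqrtr_ge0.
    by rewrite n0 mul0r mulr_ge0// ltW.
  move=> x; rewrite ler_norml /tube => /andP[x1 x2] _; split; last by move=> n1; exfalso; move: n1; rewrite n0.
  rewrite /fst_coor; move: x1; lra.
have [com dom om4] := hom n0.
have [M3 hM3] := near_pinfty (norm_cvg0_near k10 dom).
(* For the r chosen below, [n / r ^ 2] equals [c * omega(s) ^ 2]; the bound
   [c * omega(s) ^ 2 <= k * A(s)^{1/2}] is the square root of [omega ^ 4 / A <= (k / c) ^ 2]. *)
pose c : R := 4 * n%:R * n.+1%:R ^+ 2.
have nR : (0 : R) < n%:R by rewrite ltr0n.
have c0 : 0 < c by rewrite !mulr_gt0// exprn_gt0.
have kc0 : 0 < (k / c) ^+ 2 by rewrite exprn_gt0// divr_gt0.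
have [M4 hM4] := near_pinfty (norm_cvg0_near kc0 om4).
have [M [sl hM]] := exists_gt [:: s0; M1; M2; M3; M4].
have [s0M M1M M2M M3M M4M] : [/\ s0 < M, M1 < M, M2 < M, M3 < M & M4 < M].
  by split; apply: hM; rewrite !inE eqxx ?orbT.
have [s sM] : exists s, M = s - l by exists (M + l); ring.
rewrite {hM}sM in s0M M1M M2M M3M M4M sl.
have [a1 a2 a3 a4] := W s M1M M2M sl.
have oms : 0 < omega s by apply: om0 => //; lra.
(* The box is cut out coordinatewise, the tube by the Euclidean norm. The factor n + 1 gives
   [n r ^ 2 < (3 / (4 omega(s))) ^ 2], and omega exceeds [4 / 3 * omega s] nowhere on the window. *)
pose r := (2 * n.+1%:R * omega s)^-1.
have r0 : 0 < r by rewrite invr_gt0 !mulr_gt0.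
have As : 0 < A s by apply: a2; lra.
exists s, r; split => //.
split => //; split; last first.
  have -> : n%:R / r ^+ 2 = c * omega s ^+ 2.
    by rewrite /r -exprVn invrK /c; ring.
  have := hM4 s; rewrite ger0_norm ?divr_ge0 ?exprn_ge0 ?(ltW As) ?(ltW oms)//.
  rewrite ler_pdivrMr// => h; have {}h := h ltac:(lra).
  rewrite -ler_pdivlMl// mulrA [c^-1 * k]mulrC.
  rewrite -ler_sqr ?nnegrE ?exprn_ge0 ?(ltW oms)// ?mulr_ge0 ?sqrtr_ge0 ?invr_ge0 ?(ltW k0) ?(ltW c0)//.
  by rewrite [(k / c * _) ^+ 2]exprMn sqr_sqrtr ?(ltW As)// -exprM.
have k4 : 2 * (k1 * l) <= 4^-1 by lra.
have hos v : s - l <= v -> 0 < omega v /\ `|derive1 omega v| <= k1 * omega v.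
  move=> vs; have v0 : 0 < v by lra.
  have ov := om0 n0 _ v0; split => //.
  have := hM3 v; rewrite normrM normfV (gtr0_norm ov) ler_pdivrMr//; apply.
  lra.
have [ho _] := slow_window k10 l0 k4 com sl hos.
move=> x; rewrite ler_norml => /andP[x1 x2] xr.
have xw : s - l <= fst_coor x <= s + l by rewrite /fst_coor; lra.
split; first by lra.
move=> _; have ox : 0 < omega (fst_coor x) by apply: om0 => //; lra.
have /andP[_ oxs] := ho _ xw.
have r2 : n%:R * r ^+ 2 < (omega (fst_coor x))^-1 ^+ 2.
  apply: (@lt_le_trans _ _ ((4 / 3 * omega s)^-1 ^+ 2)); last first.
    have q0 : 0 < 4 / 3 * omega s by rewrite mulr_gt0// divr_gt0.
    by rewrite ler_sqr ?nnegrE ?invr_ge0 ?(ltW q0) ?(ltW ox)// lef_pV2 ?posrE.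
  have -> : (4 / 3 * omega s)^-1 = 3 / 4 * (omega s)^-1 by field; rewrite gt_eqF.
  rewrite /r invfM !exprMn mulrA ltr_pM2r; last by rewrite exprn_gt0// invr_gt0.
  rewrite exprVn ltr_pdivrMr ?exprn_gt0 ?mulr_gt0//.
  have : (1 : R) <= n.+1%:R by rewrite ler1n.
  by rewrite -natr1; nra.
rewrite -[ltRHS](@ger0_norm _ (omega (fst_coor x))^-1) ?invr_ge0 ?(ltW ox)//.
rewrite -sqrtr_sqr ltr_sqrt ?exprn_gt0 ?invr_gt0//.
apply: le_lt_trans r2; rewrite -[n in n%:R]card_ord -sum1_card natr_sum mulr_suml.
apply: ler_sum => j _; rewrite mul1r /tl_coor mxE.
by rewrite -real_normK ?num_real// ler_sqr ?nnegrE ?(ltW r0).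
Qed.

End window.

Local Open Scope complex_scope.

(** * Test functions *)

Section testfun.
Context {R : realType} {n : nat}.
Local Notation T := 'rV[R]_n.
Local Notation C := R[i].
Local Notation re := (@complex.Re R).
Local Notation im := (@complex.Im R).
Local Notation mu := (@lebesgue_rv R n).
Local Notation ev i := (delta_mx ord0 i : T).
Implicit Types (Om : set T) (f g : T -> R) (phi eta : T -> C).

Lemma reD (z w : C) : re (z + w) = re z + re w.
Proof. by case: z w => [? ?] [? ?]. Qed.
Lemma imD (z w : C) : im (z + w) = im z + im w.
Proof. by case: z w => [? ?] [? ?]. Qed.
Lemma reN (z : C) : re (- z) = - re z.
Proof. by case: z. Qed.
Lemma imN (z : C) : im (- z) = - im z.
Proof. by case: z. Qed.
Lemma reM (z w : C) : re (z * w) = re z * re w - im z * im w.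
Proof. by case: z w => [? ?] [? ?]. Qed.
Lemma imM (z w : C) : im (z * w) = re z * im w + im z * re w.
Proof. by case: z w => [? ?] [? ?]. Qed.
Lemma complexP (z w : C) : re z = re w -> im z = im w -> z = w.
Proof. by case: z w => [? ?] [? ?] /= -> ->. Qed.

Lemma CkW k f : Ck k.+1 f -> Ck k f.
Proof.
elim: k f => [f [cf _]|k IH f [cf h]]; first by split.
split=> // i; have [dk hk] := h i; split=> //; exact: IH.
Qed.

Lemma pdD k i f g : Ck k.+1 f -> Ck k.+1 g ->
  pd i (fun x => f x + g x) = fun x => pd i f x + pd i g x.
Proof.
move=> hf hg; apply/funext => x; apply: pd_is_derive.
exact: is_deriveD (Ck_is_derive i x hf) (Ck_is_derive i x hg).
Qed.

Lemma CkD k f g : Ck k f -> Ck k g -> Ck k (fun x => f x + g x).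
Proof.
have cfg (f1 g1 : T -> R) : continuous f1 -> continuous g1 ->
    continuous (fun x => f1 x + g1 x).
  by move=> c1 c2 x; exact: cvgD (c1 x) (c2 x).
elim: k f g => [f g hf hg|k IH f g hf hg].
  by split=> //; exact: cfg (Ck_cont hf) (Ck_cont hg).
split; first exact: cfg (Ck_cont hf) (Ck_cont hg).
move=> i.
split=> [x|]; first by have [] := is_deriveD (Ck_is_derive i x hf) (Ck_is_derive i x hg).
by rewrite (pdD i hf hg); apply: IH; [have [_ /(_ i)[]] := hf|have [_ /(_ i)[]] := hg].
Qed.

Lemma is_derive_mul k i f g x : Ck k.+1 f -> Ck k.+1 g ->
  is_derive x (ev i) (fun x => f x * g x) (f x * pd i g x + pd i f x * g x).
Proof.
move=> hf hg; have h := is_deriveM (Ck_is_derive i x hf) (Ck_is_derive i x hg).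
by apply: is_derive_eq h _; rewrite /GRing.scale/= [g x * _]mulrC.
Qed.

Lemma pdM k i f g : Ck k.+1 f -> Ck k.+1 g ->
  pd i (fun x => f x * g x) = fun x => f x * pd i g x + pd i f x * g x.
Proof.
by move=> hf hg; apply/funext => x; apply: pd_is_derive; exact: is_derive_mul hf hg.
Qed.

Lemma CkM k f g : Ck k f -> Ck k g -> Ck k (fun x => f x * g x).
Proof.
have cfg (f1 g1 : T -> R) : continuous f1 -> continuous g1 ->
    continuous (fun x => f1 x * g1 x).
  by move=> c1 c2 x; exact: cvgM (c1 x) (c2 x).
elim: k f g => [f g hf hg|k IH f g hf hg].
  by split=> //; exact: cfg (Ck_cont hf) (Ck_cont hg).
split; first exact: cfg (Ck_cont hf) (Ck_cont hg).
move=> i.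
split=> [x|]; first by have [] := is_derive_mul i x hf hg.
rewrite (pdM i hf hg).
by apply: CkD; apply: IH; rewrite ?(CkW hf) ?(CkW hg)//;
  [exact: CkW|have [_ /(_ i)[]] := hg|have [_ /(_ i)[]] := hf|exact: CkW].
Qed.

Lemma smoothD f g : smooth f -> smooth g -> smooth (fun x => f x + g x).
Proof. by move=> hf hg k; exact: CkD. Qed.

Lemma smoothM f g : smooth f -> smooth g -> smooth (fun x => f x * g x).
Proof. by move=> hf hg k; exact: CkM. Qed.

Lemma smoothN f : smooth f -> smooth (fun x => - f x).
Proof.
by move=> /(smooth_scale (-1)); under eq_fun do rewrite mulN1r.
Qed.

Lemma smooth0 : smooth (fun _ : T => 0 : R).
Proof.
have S0 : (fun _ : T => 0 : R) = (fun x => 0 * (fun _ => 0) x).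
  by apply/funext => x; rewrite mulr0.
elim=> [|k IH]; first by split=> //; exact: cst_continuous.
split; first exact: cst_continuous.
move=> i; split=> [x|]; first exact: derivable_cst.
rewrite (_ : pd i _ = fun=> 0)//; apply/funext => x; exact: pd_is_derive.
Qed.

Definition csmooth phi := smooth (re \o phi) /\ smooth (im \o phi).

Lemma csmoothD phi eta : csmooth phi -> csmooth eta ->
  csmooth (fun x => phi x + eta x).
Proof.
move=> [a b] [c d]; split.
  rewrite (_ : re \o _ = fun x => re (phi x) + re (eta x)); first exact: smoothD.
  by apply/funext => x /=; rewrite reD.
rewrite (_ : im \o _ = fun x => im (phi x) + im (eta x)); first exact: smoothD.
by apply/funext => x /=; rewrite imD.
Qed.

Lemma csmoothM phi eta : csmooth phi -> csmooth eta ->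
  csmooth (fun x => phi x * eta x).
Proof.
move=> [a b] [c d]; split.
  rewrite (_ : re \o _ = fun x => re (phi x) * re (eta x) + - (im (phi x) * im (eta x))).
    by apply: smoothD; [exact: smoothM|apply: smoothN; exact: smoothM].
  by apply/funext => x /=; rewrite reM.
rewrite (_ : im \o _ = fun x => re (phi x) * im (eta x) + im (phi x) * re (eta x)).
  by apply: smoothD; exact: smoothM.
by apply/funext => x /=; rewrite imM.
Qed.

Lemma csmooth_cpd i phi : csmooth phi -> csmooth (cpd i phi).
Proof. by move=> [a b]; split; exact: smooth_pd. Qed.

Lemma csmooth_scale (c : R) phi : csmooth phi -> csmooth (fun x => c%:C * phi x).
Proof.
move=> [a b]; split.
  rewrite (_ : re \o _ = fun x => c * re (phi x)); first exact: smooth_scale.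
  by apply/funext => x /=; rewrite reM/= mul0r subr0.
rewrite (_ : im \o _ = fun x => c * im (phi x)); first exact: smooth_scale.
by apply/funext => x /=; rewrite imM/= mul0r addr0.
Qed.

Lemma cpd_scale (c : R) i phi : csmooth phi ->
  cpd i (fun x => c%:C * phi x) = fun x => c%:C * cpd i phi x.
Proof.
move=> [a b]; apply/funext => x; rewrite /cpd.
rewrite (_ : re \o _ = fun x => c * re (phi x)); last first.
  by apply/funext => y /=; rewrite reM/= mul0r subr0.
rewrite (_ : im \o _ = fun x => c * im (phi x)); last first.
  by apply/funext => y /=; rewrite imM/= mul0r addr0.
rewrite !pd_scale.
- by apply: complexP; rewrite (reM, imM)/= mul0r ?subr0 ?addr0.
- by move=> y; have [] := smooth_is_derive i y b.
- by move=> y; have [] := smooth_is_derive i y a.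
Qed.

Lemma cpdM i phi eta : csmooth phi -> csmooth eta ->
  cpd i (fun x => phi x * eta x) = fun x => phi x * cpd i eta x + cpd i phi x * eta x.
Proof.
move=> [a b] [c d]; apply/funext => x; rewrite /cpd.
rewrite (_ : re \o _ = fun x => re (phi x) * re (eta x) + (-1) * (im (phi x) * im (eta x))); last first.
  by apply/funext => y /=; rewrite reM mulN1r.
rewrite (_ : im \o _ = fun x => re (phi x) * im (eta x) + im (phi x) * re (eta x)); last first.
  by apply/funext => y /=; rewrite imM.
have ac := smoothM a c; have bd := smoothM b d.
have ad := smoothM a d; have bc := smoothM b c.
rewrite (pdD i (ad 1) (bc 1)) (pdD i (ac 1) (smooth_scale (-1) bd 1)) pd_scale; last first.
  by move=> y; have [] := smooth_is_derive i y bd.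
rewrite (pdM i (a 1) (c 1)) (pdM i (b 1) (d 1)) (pdM i (a 1) (d 1)) (pdM i (b 1) (c 1)).
by apply: complexP; rewrite (reD, imD) ?reM ?imM/=; ring.
Qed.

Lemma testfunP Om phi : testfun Om phi <-> csmooth phi /\
  exists K : set T, [/\ compact K, K `<=` Om & forall x, ~ K x -> phi x = 0].
Proof. by split=> [[]|[[]]]. Qed.

Lemma testfun_csmooth Om phi : testfun Om phi -> csmooth phi.
Proof. by case. Qed.

Lemma testfunMl Om phi eta : csmooth phi -> testfun Om eta ->
  testfun Om (fun x => phi x * eta x).
Proof.
move=> sp /testfunP[se [K [cK KO h]]]; apply/testfunP; split; first exact: csmoothM.
by exists K; split=> // x /h ->; rewrite mulr0.
Qed.

Lemma testfunMr Om phi eta : testfun Om phi -> csmooth eta ->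
  testfun Om (fun x => phi x * eta x).
Proof. by move=> hp he; under eq_fun do rewrite mulrC; exact: testfunMl. Qed.

Lemma testfun_scale Om (c : R) phi : testfun Om phi ->
  testfun Om (fun x => c%:C * phi x).
Proof.
move=> /testfunP[sp [K [cK KO h]]]; apply/testfunP; split; first exact: csmooth_scale.
by exists K; split=> // x /h ->; rewrite mulr0.
Qed.

Lemma testfunD Om phi eta : testfun Om phi -> testfun Om eta ->
  testfun Om (fun x => phi x + eta x).
Proof.
move=> /testfunP[sp [K [cK KO h]]] /testfunP[se [L [cL LO g]]].
apply/testfunP; split; first exact: csmoothD.
exists (K `|` L); split; first exact: compactU.
  by move=> x []; [exact: KO|exact: LO].
by move=> x KLx; rewrite h ?g ?addr0//; apply: contra_not KLx; [right|left].
Qed.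

Lemma testfun0 Om : testfun Om (fun=> 0).
Proof.
by split; [exact: smooth0|exact: smooth0|exists set0; split=> //; exact: compact0].
Qed.

Lemma cpd_supp (K : set T) i phi : closed K -> (forall x, ~ K x -> phi x = 0) ->
  forall x, ~ K x -> cpd i phi x = 0.
Proof.
move=> cK h x Kx; apply: complexP => /=.
  by apply: (pd_supp (f := re \o phi) i cK) => // y Ky /=; rewrite h.
by apply: (pd_supp (f := im \o phi) i cK) => // y Ky /=; rewrite h.
Qed.

Lemma compact_closed_rv (K : set T) : compact K -> closed K.
Proof. by apply: compact_closed; exact: norm_hausdorff. Qed.

Lemma compact_measurable_rv (K : set T) : compact K -> measurable K.
Proof.
move=> /compact_closed_rv/closed_openC/open_measurable_rv/measurableC.
by rewrite setCK.
Qed.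

Lemma testfun_cpd Om i phi : testfun Om phi -> testfun Om (cpd i phi).
Proof.
move=> /testfunP[sp [K [cK KO h]]]; apply/testfunP; split; first exact: csmooth_cpd.
by exists K; split=> //; apply: cpd_supp => //; exact: compact_closed_rv.
Qed.

Lemma testfun_sum Om (I : Type) (s : seq I) (F : I -> T -> C) :
  (forall i, testfun Om (F i)) -> testfun Om (fun x => \sum_(i <- s) F i x).
Proof.
move=> h; elim: s => [|i s IH].
  by under eq_fun do rewrite big_nil; exact: testfun0.
by under eq_fun do rewrite big_cons; exact: testfunD.
Qed.

Lemma testfun_laplacian Om phi : testfun Om phi -> testfun Om (laplacian phi).
Proof. by move=> h; apply: testfun_sum => i; do 2!apply: testfun_cpd. Qed.

Lemma laplacian_scale Om (c : R) phi : testfun Om phi ->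
  laplacian (fun x => c%:C * phi x) = fun x => c%:C * laplacian phi x.
Proof.
move=> h; apply/funext => x; rewrite /laplacian mulr_sumr; apply: eq_bigr => i _.
rewrite cpd_scale; last exact: testfun_csmooth h.
by rewrite cpd_scale//; exact: testfun_csmooth (testfun_cpd i h).
Qed.

End testfun.

(** * Square-integrable functions and integration by parts *)

Section integrals.
Context {R : realType} {n : nat}.
Local Notation T := 'rV[R]_n.
Local Notation C := R[i].
Local Notation re := (@complex.Re R).
Local Notation im := (@complex.Im R).
Local Notation mu := (@lebesgue_rv R n).
Context (Om : set T) (oOm : open Om).
Implicit Types (f g m : T -> R) (phi eta F G : T -> C).

Lemma mOm : measurable Om. Proof. exact: open_measurable_rv. Qed.

Definition cintegrable F :=
  mu.-integrable Om (EFin \o (re \o F)) /\ mu.-integrable Om (EFin \o (im \o F)).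

Lemma cintegrableD F G : cintegrable F -> cintegrable G ->
  cintegrable (fun x => F x + G x).
Proof.
move=> [a b] [c d]; split.
  rewrite (_ : EFin \o _ = ((EFin \o (re \o F)) \+ (EFin \o (re \o G)))%E).
    exact: (integrableD mOm).
  by apply/funext => x /=; rewrite reD EFinD.
rewrite (_ : EFin \o _ = ((EFin \o (im \o F)) \+ (EFin \o (im \o G)))%E).
  exact: (integrableD mOm).
by apply/funext => x /=; rewrite imD EFinD.
Qed.

Lemma integrable_lin (a b : R) f g : mu.-integrable Om (EFin \o f) ->
  mu.-integrable Om (EFin \o g) -> mu.-integrable Om (EFin \o (fun x => a * f x + b * g x)).
Proof.
move=> hf hg.
rewrite (_ : EFin \o _ = ((fun x => a%:E * (EFin \o f) x) \+ (fun x => b%:E * (EFin \o g) x))%E).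
  by apply: (integrableD mOm); exact: (integrableZl mOm).
by apply/funext => x /=; rewrite EFinD !EFinM.
Qed.

Lemma Rintegral_lin (a b : R) f g : mu.-integrable Om (EFin \o f) ->
  mu.-integrable Om (EFin \o g) ->
  \int[mu]_(x in Om) (a * f x + b * g x) =
  a * \int[mu]_(x in Om) f x + b * \int[mu]_(x in Om) g x.
Proof.
move=> hf hg; rewrite RintegralD.
- by rewrite !RintegralZl//; exact: mOm.
- exact: mOm.
- exact: (integrableZl mOm a hf).
- exact: (integrableZl mOm b hg).
Qed.

Lemma cintD F G : cintegrable F -> cintegrable G ->
  cint Om (fun x => F x + G x) = cint Om F + cint Om G.
Proof.
move=> [a b] [c d]; apply: complexP; rewrite (reD, imD)/=.
  rewrite -(RintegralD mOm a c); apply: eq_Rintegral => x _; exact: reD.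
rewrite -(RintegralD mOm b d); apply: eq_Rintegral => x _; exact: imD.
Qed.

Lemma cintegrableZ (c : C) F : cintegrable F -> cintegrable (fun x => c * F x).
Proof.
move=> [a b]; split.
  have := integrable_lin (re c) (- im c) a b; congr (mu.-integrable Om _).
  by apply/funext => x /=; rewrite reM mulNr.
have := integrable_lin (im c) (re c) a b; congr (mu.-integrable Om _).
by apply/funext => x /=; rewrite imM addrC.
Qed.

Lemma cintZ (c : C) F : cintegrable F -> cint Om (fun x => c * F x) = c * cint Om F.
Proof.
move=> [a b]; apply: complexP; rewrite (reM, imM)/=.
  rewrite -mulNr -(Rintegral_lin _ _ a b); apply: eq_Rintegral => x _.
  by rewrite /= reM mulNr.
rewrite addrC -(Rintegral_lin _ _ a b); apply: eq_Rintegral => x _.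
by rewrite /= imM addrC.
Qed.

Lemma cint0 : cint Om (fun=> 0) = 0.
Proof. by apply: complexP => /=; rewrite /Rintegral integral0. Qed.

Lemma cintegrable0 : cintegrable (fun=> 0).
Proof.
by split; rewrite (_ : EFin \o _ = cst 0%E)//; exact: integrable0.
Qed.

Lemma cintegrable_sum (I : Type) (s : seq I) (H : I -> T -> C) :
  (forall i, cintegrable (H i)) -> cintegrable (fun x => \sum_(i <- s) H i x).
Proof.
move=> h; elim: s => [|i s IH]; first by under eq_fun do rewrite big_nil; exact: cintegrable0.
by under eq_fun do rewrite big_cons; exact: cintegrableD.
Qed.

Lemma cint_sum (I : Type) (s : seq I) (H : I -> T -> C) :
  (forall i, cintegrable (H i)) ->
  cint Om (fun x => \sum_(i <- s) H i x) = \sum_(i <- s) cint Om (H i).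
Proof.
move=> h; elim: s => [|i s IH].
  by under eq_fun do rewrite big_nil; rewrite big_nil cint0.
under eq_fun do rewrite big_cons; rewrite big_cons cintD ?IH//.
exact: cintegrable_sum.
Qed.

Lemma cintN F : cintegrable F -> cint Om (fun x => - F x) = - cint Om F.
Proof.
by move=> h; rewrite -mulN1r -cintZ//; congr cint; apply/funext => x; rewrite mulN1r.
Qed.

Lemma eq_cint F G : (forall x, Om x -> F x = G x) -> cint Om F = cint Om G.
Proof.
by move=> FG; apply: complexP => /=; apply: eq_Rintegral => x /[!inE] Ox; rewrite FG.
Qed.

Lemma compact_norm_bounded (K : set T) : compact K ->
  exists M : R, forall x, M < `|x| -> ~ K x.
Proof.
move=> /compact_bounded[M [_ hM]]; exists (M + 1) => x Mx Kx.
have := hM (M + 1); rewrite ltrDl => /(_ ltr01 x Kx) /=.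
by rewrite leNgt Mx.
Qed.

Lemma supp_integrable (K : set T) f : continuous f -> compact K ->
  (forall x, ~ K x -> f x = 0) -> mu.-integrable setT (EFin \o f).
Proof.
move=> cf /compact_norm_bounded[M hM] f0.
by apply: (continuous_supp_integrable (M := M) cf) => x /hM/f0.
Qed.

Lemma integrable_supp (K : set T) (f : T -> \bar R) : measurable K -> K `<=` Om ->
  (forall x, ~ K x -> f x = 0%E) -> mu.-integrable K f -> mu.-integrable Om f.
Proof.
move=> mK KO f0 /(integrable_mkcond _ mK) h; apply/(integrable_mkcond _ mOm).
move: h; congr (mu.-integrable setT _); apply/funext => x; rewrite !patchE.
case: ifPn => [/[!inE] Kx|]; first by rewrite ifT// inE; exact: KO.
by rewrite notin_setE => Kx; case: ifP => // _; rewrite f0.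
Qed.

Lemma integrable_L1loc (K : set T) m g : L1loc Om m -> continuous g -> compact K ->
  K `<=` Om -> (forall x, ~ K x -> g x = 0) ->
  mu.-integrable Om (EFin \o (fun x => m x * g x)).
Proof.
move=> [mm lm] cg cK KO g0.
have mK := compact_measurable_rv cK.
apply: (integrable_supp mK KO) => [x Kx|]; first by rewrite /= g0// mulr0.
have [M [M0 hM]] := continuous_supp_bounded cg cK g0.
have im : mu.-integrable K (EFin \o m).
  apply/integrableP; split; last exact: lm.
  by apply/measurable_EFinP; exact: measurable_funS mOm KO mm.
rewrite (_ : EFin \o _ = ((EFin \o g) \* (EFin \o m))%E); last first.
  by apply/funext => x /=; rewrite -EFinM mulrC.
apply: (integrableMr mK _ _ im).
  exact: measurable_funTS (continuous_measurable_rv cg).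
exists M; split; first exact: num_real.
by move=> y My x _ /=; apply: le_trans (hM x) (ltW My).
Qed.

Lemma Lfun2_patch f : measurable_fun Om f ->
  mu.-integrable Om (EFin \o (fun x => f x ^+ 2)) -> (f \_ Om) \in Lfun mu 2%:E.
Proof.
move=> mf /(integrable_mkcond _ mOm)/integrableP[_ h].
rewrite inE; apply/andP; split; rewrite inE/=.
  exact/(measurable_restrictT _ mOm).
rewrite /finite_norm unlock /=; apply: poweR_lty; apply: le_lt_trans h.
rewrite le_eqVlt; apply/orP; left; apply/eqP; apply: eq_integral => x _.
rewrite /= !patchE; case: ifP => _ /=.
  by rewrite powR_mulrn// normrX.
by rewrite normr0 powR0.
Qed.

Lemma L2_crit F : measurable_fun Om (re \o F) -> measurable_fun Om (im \o F) ->
  mu.-integrable Om (EFin \o (fun x => re (F x) ^+ 2)) ->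
  mu.-integrable Om (EFin \o (fun x => im (F x) ^+ 2)) -> L2 Om F.
Proof.
move=> mr mi ir ii; split.
  rewrite (_ : (fun x => _) = (re \o F) \_ Om); first exact: Lfun2_patch.
  by apply/funext => x; rewrite /ext0 /patch; case: ifP.
rewrite (_ : (fun x => _) = (im \o F) \_ Om); first exact: Lfun2_patch.
by apply/funext => x; rewrite /ext0 /patch; case: ifP.
Qed.

Lemma continuous_sqr f : continuous f -> continuous (fun x => f x ^+ 2).
Proof. by move=> cf x; exact: cvgM (cf x) (cf x). Qed.

Lemma L2loc_sqr m : L2loc Om m -> L1loc Om (fun x => m x ^+ 2).
Proof.
move=> [mm h]; split; first exact: measurable_funX.
by move=> K cK KO; under eq_integral => x _ do rewrite ger0_norm ?sqr_ge0//; exact: h.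
Qed.

Lemma L2loc_cst (c : R) : L2loc Om (fun=> c).
Proof.
split; first exact: measurable_cst.
move=> K cK KO; have mK := compact_measurable_rv cK.
rewrite integral_cst//; apply: lte_mul_pinfty; rewrite ?lee_fin ?sqr_ge0//.
have [M hM] := compact_norm_bounded cK.
apply: le_lt_trans (lebesgue_rv_ball_lty n (Num.max M 0)).
apply: le_measure; rewrite ?inE//.
  by apply: (@measurable_rv_box _ _ (fun=> _)) => i; exact: measurable_itv.
move=> x Kx i /=; rewrite in_itv/= -ler_norml; move: i.
apply/rv_norm_leP; first by rewrite le_max lexx orbT.
by rewrite le_max leNgt; apply/orP; left; apply/negP => /hM.
Qed.

(** The square of m is locally integrable and that of phi is continuous with compact support. With m
    = q this makes [(-Delta + q) phi] square-integrable, with m = a it gives the domain of a, with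
    [sqrtf q] the form domain, and with m = 1 the space L^2 itself. *)
Lemma L2_mulop m phi : L2loc Om m -> testfun Om phi -> L2 Om (mulop m phi).
Proof.
move=> lm [sr si [K [cK KO h]]].
have [mm _] := lm; have l1 := L2loc_sqr lm.
have E (f : T -> R) : smooth f -> (forall x, ~ K x -> f x = 0) ->
  measurable_fun Om (fun x => m x * f x) /\
  mu.-integrable Om (EFin \o (fun x => (m x * f x) ^+ 2)).
  move=> sf f0; split.
    apply: measurable_funM => //.
    exact: measurable_funTS (continuous_measurable_rv (smooth_cont sf)).
  under [X in EFin \o X]eq_fun do rewrite exprMn.
  apply: (integrable_L1loc l1 (continuous_sqr (smooth_cont sf)) cK KO).
  by move=> x /f0 ->; rewrite expr0n.
have [e1 e2] := E _ sr (fun x Kx => congr1 re (h x Kx)).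
have [e3 e4] := E _ si (fun x Kx => congr1 im (h x Kx)).
have Re x : re (mulop m phi x) = m x * (re \o phi) x by rewrite /mulop reM/= mul0r subr0.
have Im x : im (mulop m phi x) = m x * (im \o phi) x by rewrite /mulop imM/= mul0r addr0.
have ReE : re \o mulop m phi = fun x => m x * (re \o phi) x by exact/funext.
have ImE : im \o mulop m phi = fun x => m x * (im \o phi) x by exact/funext.
apply: L2_crit; rewrite ?ReE ?ImE//.
  by under [X in EFin \o X]eq_fun do rewrite Re.
by under [X in EFin \o X]eq_fun do rewrite Im.
Qed.

Lemma testfun_L2 phi : testfun Om phi -> L2 Om phi.
Proof.
move=> /(L2_mulop (L2loc_cst 1)); congr L2; apply/funext => x.
by rewrite /mulop mul1r.
Qed.

Lemma dom_mul_testfun m phi : L2loc Om m -> testfun Om phi -> dom_mul Om m phi.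
Proof. by move=> lm h; split; [exact: testfun_L2|exact: L2_mulop]. Qed.

Lemma L2loc_sqrtf q : L1loc Om q -> L2loc Om (sqrtf q).
Proof.
move=> [mq lq]; split.
  apply: (measurableT_comp (f := @Num.sqrt R)) => //.
  by apply: continuous_measurable_fun; exact: sqrt_continuous.
move=> K cK KO; apply: le_lt_trans (lq K cK KO).
have mK := compact_measurable_rv cK.
have mqK := measurable_funS mOm KO mq.
apply: ge0_le_integral => //.
- by move=> x _; rewrite lee_fin sqr_ge0.
- apply/measurable_EFinP; apply: measurable_funX.
  apply: (measurableT_comp (f := @Num.sqrt R)) => //.
  by apply: continuous_measurable_fun; exact: sqrt_continuous.
- by apply/measurable_EFinP; exact: measurableT_comp.
- move=> x _; rewrite lee_fin /sqrtf.
  (* [Num.sqrt] is 0 at negative arguments, so the square of [sqrtf q] is at most [|q|] at every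
     point. *)
  have [q0|q0] := leP 0 (q x); first by rewrite sqr_sqrtr// ler_norm.
  by rewrite ler0_sqrtr ?(ltW q0)// expr0n /= normr_ge0.
Qed.

Lemma cintegrable_L1loc m phi : L1loc Om m -> testfun Om phi ->
  cintegrable (mulop m phi).
Proof.
move=> lm [sr si [K [cK KO h]]]; split.
  have := integrable_L1loc lm (smooth_cont sr) cK KO (fun x Kx => congr1 re (h x Kx)).
  congr (mu.-integrable Om _); apply/funext => x /=.
  by rewrite /mulop reM/= mul0r subr0.
have := integrable_L1loc lm (smooth_cont si) cK KO (fun x Kx => congr1 im (h x Kx)).
congr (mu.-integrable Om _); apply/funext => x /=.
by rewrite /mulop imM/= mul0r addr0.
Qed.

Lemma testfun_cintegrable phi : testfun Om phi -> cintegrable phi.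
Proof.
move=> [sr si [K [cK KO h]]]; split.
  apply: integrableS (supp_integrable (smooth_cont sr) cK _) => //; first exact: mOm.
  by move=> x Kx; rewrite /= h.
apply: integrableS (supp_integrable (smooth_cont si) cK _) => //; first exact: mOm.
by move=> x Kx; rewrite /= h.
Qed.

Lemma Rintegral_pd0 (K : set T) i f : smooth f -> compact K -> K `<=` Om ->
  (forall x, ~ K x -> f x = 0) -> \int[mu]_(x in Om) pd i f x = 0.
Proof.
move=> sf cK KO f0.
have [M hM] := compact_norm_bounded cK.
rewrite Rintegral_mkcond (_ : _ \_ _ = pd i f); last first.
  apply/funext => x; rewrite patchE; case: ifPn => //; rewrite notin_setE => Ox.
  rewrite (pd_supp (K := K))//; first exact: compact_closed_rv.
  by move=> /KO.
rewrite /Rintegral (@integral_pd_supp _ _ _ _ M)//.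
- exact: smooth_cont.
- by move=> x; have [] := smooth_is_derive i x sf.
- exact: smooth_cont (smooth_pd i sf).
- by move=> x /hM/f0.
Qed.

Lemma cint_cpd0 i F : testfun Om F -> cint Om (cpd i F) = 0.
Proof.
move=> [sr si [K [cK KO h]]]; apply: complexP => /=.
  by apply: (Rintegral_pd0 i sr cK KO) => x Kx; rewrite /= h.
by apply: (Rintegral_pd0 i si cK KO) => x Kx; rewrite /= h.
Qed.

(** The product inherits the compact support of eta, so its derivative integrates to 0. *)
Lemma testfun_ibp i phi eta : csmooth phi -> testfun Om eta ->
  cint Om (fun x => phi x * cpd i eta x) = - cint Om (fun x => cpd i phi x * eta x).
Proof.
move=> sp te.
apply/eqP; rewrite -addr_eq0 -cintD; first last.
- by apply: testfun_cintegrable; apply: testfunMl => //; exact: csmooth_cpd.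
- by apply: testfun_cintegrable; apply: testfunMl => //; exact: testfun_cpd.
rewrite -(cpdM i sp (testfun_csmooth te)) cint_cpd0//.
exact: testfunMl.
Qed.

Lemma testfun_L1loc phi : testfun Om phi -> L1loc Om (re \o phi) /\ L1loc Om (im \o phi).
Proof.
move=> [sr si [K [cK KO h]]].
have H f : smooth f -> (forall x, ~ K x -> f x = 0) -> L1loc Om f.
  move=> sf f0; split.
    exact: measurable_funTS (continuous_measurable_rv (smooth_cont sf)).
  move=> L cL LO.
  have : mu.-integrable L (EFin \o f).
    apply: integrableS (supp_integrable (smooth_cont sf) cK f0) => //.
    exact: compact_measurable_rv.
  by move=> /integrableP[].
split; apply: H => // x Kx; by rewrite /= h.
Qed.

Lemma testfun_weak_pd i phi : testfun Om phi -> weak_pd Om i phi (cpd i phi).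
Proof.
move=> tp; have [? ?] := testfun_L1loc tp.
have [? ?] := testfun_L1loc (testfun_cpd i tp).
split=> // eta te; exact: testfun_ibp (testfun_csmooth tp) te.
Qed.

Lemma l2norm0 F : (forall x, F x = 0) -> l2norm Om F = 0%E.
Proof.
move=> F0; rewrite /l2norm (_ : EFin \o normc \o ext0 Om F = cst 0%E) ?Lnorm0//.
apply/funext => x /=; rewrite /ext0 /patch F0 if_same.
by rewrite /Normc.normc/= expr0n addr0 sqrtr0.
Qed.

Lemma testfun_W012 phi : testfun Om phi -> W012 Om phi (fun i => cpd i phi).
Proof.
move=> tp; split.
  split; [exact: testfun_L2|move=> i|move=> i].
    exact: testfun_L2 (testfun_cpd i tp).
  exact: testfun_weak_pd.
exists (fun=> phi); split=> //.
  rewrite [X in X @ _ --> _](_ : _ = fun=> 0%E); first exact: cvg_cst.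
  by apply/funext => k; rewrite l2norm0// => x /=; rewrite subrr.
move=> i; rewrite [X in X @ _ --> _](_ : _ = fun=> 0%E); first exact: cvg_cst.
by apply/funext => k; rewrite l2norm0// => x /=; rewrite subrr.
Qed.

(** Green's identity: two integrations by parts in each variable move the Laplacian from eta to phi,
    so the classical expression is also the distributional one. The approximating sequence for
    [W012] is constant. *)
Lemma schrodinger_testfun q phi : L1loc Om q -> L2loc Om q -> testfun Om phi ->
  schrodinger Om q phi (fun x => - laplacian phi x + mulop q phi x).
Proof.
move=> q1 q2 tp; split.
- by exists (fun i => cpd i phi); exact: testfun_W012.
- exact: dom_mul_testfun (L2loc_sqrtf q1) tp.
- have := L2_linear (-1) (testfun_L2 (testfun_laplacian tp)) (L2_mulop q2 tp).
  by under eq_fun do rewrite mulN1r.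
move=> eta te.
have sp := testfun_csmooth tp; have se := testfun_csmooth te.
have qi : cintegrable (mulop q (fun x => phi x * eta x)).
  by apply: cintegrable_L1loc => //; exact: testfunMr.
have li : cintegrable (fun x => phi x * laplacian eta x).
  by apply: testfun_cintegrable; apply: testfunMl => //; exact: testfun_laplacian.
have li' : cintegrable (fun x => laplacian phi x * eta x).
  apply: testfun_cintegrable; apply: testfunMr => //; exact: testfun_laplacian.
have key : cint Om (fun x => phi x * laplacian eta x) = cint Om (fun x => laplacian phi x * eta x).
  under eq_fun do rewrite /laplacian mulr_sumr.
  under [in RHS]eq_fun do rewrite /laplacian mulr_suml.
  rewrite !cint_sum; first last.
  - move=> i; apply: testfun_cintegrable; apply: testfunMl => //.
    by do 2!apply: testfun_cpd.
  - move=> i; apply: testfun_cintegrable; apply: testfunMl => //.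
    by do 2!apply: csmooth_cpd.
  apply: eq_bigr => i _.
  rewrite testfun_ibp//; last exact: testfun_cpd.
  rewrite testfun_ibp ?opprK//; exact: csmooth_cpd.
transitivity (cint Om (fun x => - (phi x * laplacian eta x) + mulop q (fun x => phi x * eta x) x)).
  by apply: eq_cint => x _; rewrite /mulop mulrN mulrA.
rewrite cintD//; last by have := cintegrableZ (-1) li; under eq_fun do rewrite mulN1r.
rewrite cintN// key -cintN// -cintD//; last by have := cintegrableZ (-1) li'; under eq_fun do rewrite mulN1r.
by apply: eq_cint => x _; rewrite /mulop mulrDl mulNr mulrA.
Qed.

End integrals.

(** * Inner products *)

Section bessel.
Context {R : realType}.
Local Notation C := R[i].
Local Notation re := (@complex.Re R).
Local Notation im := (@complex.Im R).

Lemma re_conj (z : C) : re (Num.conj z) = re z. Proof. by case: z. Qed.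
Lemma im_conj (z : C) : im (Num.conj z) = - im z. Proof. by case: z. Qed.

Lemma normcE (z : C) : normc z = Num.sqrt (re z ^+ 2 + im z ^+ 2).
Proof. by case: z. Qed.

Lemma mulr_conj (z : C) : z * Num.conj z = (re z ^+ 2 + im z ^+ 2)%:C.
Proof. by apply: complexP; rewrite (reM, imM) re_conj im_conj/=; ring. Qed.

Context {E : lmodType C} (ip : E -> E -> C).
Hypothesis ipl : forall (a : C) u v w, ip (a *: u + v) w = a * ip u w + ip v w.
Hypothesis ipC : forall u v, ip v u = Num.conj (ip u v).
Hypothesis ip_ge0 : forall u, 0 <= re (ip u u).

Lemma ipr (a : C) u v w : ip w (a *: u + v) = Num.conj a * ip w u + ip w v.
Proof. by rewrite ipC ipl (ipC u w) (ipC v w) rmorphD rmorphM. Qed.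

(** The vector [w N] is v minus its components along the first N vectors; its squared norm [Q N]
    drops by exactly [|(psi N, v)|^2] at each step. A nonincreasing sequence bounded below
    converges, so the drops tend to 0 and no series is summed. *)
Lemma bessel_cvg0 (psi : nat -> E) (v : E) :
  (forall k l, ip (psi k) (psi l) = (k == l)%:R) ->
  normc (ip (psi k) v) @[k --> \oo] --> (0 : R).
Proof.
move=> on.
pose w := fix w N := if N is M.+1 then (- ip v (psi M)) *: psi M + w M else v.
(* Removing components along earlier vectors does not change the products with later ones. *)
have wpsi N m : (N <= m)%N -> ip (w N) (psi m) = ip v (psi m).
  elim: N => // N IH Nm /=; rewrite ipl on ltn_eqF// mulr0 add0r IH//.
  exact: ltnW.
pose Q N := re (ip (w N) (w N)).
have QS N : Q N.+1 = Q N - normc (ip (psi N) v) ^+ 2.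
  rewrite /Q /= ipl !ipr on eqxx mulr1 wpsi// [ip (psi N) (w N)]ipC wpsi//.
  rewrite [ip (psi N) v]ipC normcE sqr_sqrtr ?addr_ge0 ?sqr_ge0//.
  rewrite !(reD, reM, reN, imD, imM, imN, re_conj, im_conj).
  by ring.
have dQ : nonincreasing_seq Q.
  by apply/nonincreasing_seqP => k; rewrite QS gerBl sqr_ge0.
have lQ : has_lbound (range Q) by exists 0 => _ [k _ <-]; exact: ip_ge0.
have cQ := nonincreasing_is_cvgn dQ lQ.
have c0 : Q k - Q k.+1 @[k --> \oo] --> (0 : R).
  rewrite -(subrr (limn Q)); apply: cvgB => //.
  by rewrite (cvg_shiftS Q).
have -> : (fun k => normc (ip (psi k) v)) = (fun k => Num.sqrt (Q k - Q k.+1)).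
  apply/funext => k; rewrite QS opprB addrC subrK sqrtr_sqr ger0_norm//.
  by rewrite normcE sqrtr_ge0.
by have := cvg_comp _ _ c0 (@sqrt_continuous R 0); rewrite sqrtr0.
Qed.

Lemma ip0l u : ip 0 u = 0.
Proof.
have := ipl 1 0 0 u; rewrite scaler0 addr0 mul1r.
by move=> /eqP; rewrite -subr_eq0 opprD addNKr oppr_eq0 => /eqP.
Qed.

Lemma ip_sqZ (c : R) u :
  ip (c%:C *: u) (c%:C *: u) = (c ^+ 2 * re (ip u u))%:C.
Proof.
have i0 : im (ip u u) = 0.
  by have := congr1 (im) (ipC u u); rewrite im_conj; lra.
rewrite -[X in ip X _]addr0 ipl ip0l addr0 -[X in ip _ X]addr0 ipr.
rewrite [ip u 0]ipC ip0l rmorph0 addr0.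
by apply: complexP; rewrite !(reM, imM, re_conj, im_conj)/= i0; ring.
Qed.

End bessel.

(** * Inner products on classes of functions and on H *)

Section L2ip.
Context {R : realType} {n : nat}.
Local Notation T := 'rV[R]_n.
Local Notation C := R[i].
Local Notation re := (@complex.Re R).
Local Notation im := (@complex.Im R).
Local Notation mu := (@lebesgue_rv R n).
Context (Om : set T) (oOm : open Om).
Implicit Types (F G : T -> C) (u v : L2fun Om).

Let mOm := mOm oOm.

Lemma L2_mul_cintegrable F G : L2 Om F -> L2 Om G ->
  cintegrable Om (fun x => F x * Num.conj (G x)).
Proof.
have H (f g : T -> R) : f \in Lfun mu 2%:E -> g \in Lfun mu 2%:E ->
    mu.-integrable Om (EFin \o (fun x => f x * g x)).
  move=> hf hg; have /Lfun1_integrable := Lfun2_mul_Lfun1 hf hg.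
  exact: integrableS.
move=> [fr fi] [gr gi]; split.
  have := integrable_lin oOm 1 1 (H _ _ fr gr) (H _ _ fi gi).
  apply: eq_integrable => // x /set_mem Ox /=.
  by rewrite !mul1r /ext0 /patch mem_set// reM re_conj im_conj; congr EFin; ring.
have := integrable_lin oOm 1 (-1) (H _ _ fi gr) (H _ _ fr gi).
apply: eq_integrable => // x /set_mem Ox /=.
by rewrite !mul1r /ext0 /patch mem_set// imM re_conj im_conj; congr EFin; ring.
Qed.

Lemma ae_eq_cint F G : cintegrable Om F -> cintegrable Om G ->
  {ae mu, forall x, Om x -> F x = G x} -> cint Om F = cint Om G.
Proof.
move=> [a b] [c d] FG; apply: complexP; congr fine; apply: ae_eq_integral => //.
- exact: measurable_int a.
- exact: measurable_int c.
- by apply: filterS FG => x h Ox /=; rewrite h.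
- exact: measurable_int b.
- exact: measurable_int d.
- by apply: filterS FG => x h Ox /=; rewrite h.
Qed.

Lemma L2funP u : L2 Om u.
Proof. by case: u => f hf; exact/asboolP. Qed.

Lemma repr_pi_ae u :
  {ae mu, forall x, Om x -> repr (\pi_(L2space Om) u)%qT x = u x}.
Proof.
have : repr (\pi_(L2space Om) u)%qT - u \in @L2null _ _ Om.
  by rewrite Quotient.idealrBE reprK.
move=> /asboolP; apply: filterS => x + Ox => /(_ Ox) h.
by apply/eqP; rewrite -subr_eq0; apply/eqP.
Qed.

(** [L2ip] is defined through [repr], which returns a given representative only up to a null set;
    the integral does not see the difference. *)
Lemma L2ip_pi u v : L2ip (\pi_(L2space Om) u)%qT (\pi_(L2space Om) v)%qT =
  cint Om (fun x => u x * Num.conj (v x)).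
Proof.
apply: ae_eq_cint; try by apply: L2_mul_cintegrable; exact: L2funP.
apply: filterS2 (repr_pi_ae u) (repr_pi_ae v) => x hu hv Ox.
by rewrite hu// hv.
Qed.

Lemma L2ip_lin (a : C) (u v w : L2space Om) :
  L2ip (a *: u + v) w = a * L2ip u w + L2ip v w.
Proof.
rewrite -[u]reprK -[v]reprK -[w]reprK.
set u' := repr u; set v' := repr v; set w' := repr w.
have -> : a *: (\pi_(L2space Om) u')%qT + (\pi_(L2space Om) v')%qT =
    (\pi_(L2space Om) (a *: u' + v'))%qT.
  by rewrite pi_addr -L2scale_pi.
rewrite !L2ip_pi.
rewrite -(cintZ oOm); last by apply: L2_mul_cintegrable; exact: L2funP.
rewrite -(cintD oOm).
- by apply: eq_cint => x _ /=; rewrite mulrA -mulrDl.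
- by apply: (cintegrableZ oOm); apply: L2_mul_cintegrable; exact: L2funP.
- by apply: L2_mul_cintegrable; exact: L2funP.
Qed.

Lemma L2ipC (v w : L2space Om) : L2ip w v = Num.conj (L2ip v w).
Proof.
apply: complexP; rewrite (re_conj, im_conj)/=.
  by apply: eq_Rintegral => x _; rewrite !reM !re_conj !im_conj; ring.
have [_ i] := L2_mul_cintegrable (L2funP (repr v)) (L2funP (repr w)).
rewrite -mulN1r -(RintegralZl (-1) mOm i); apply: eq_Rintegral => x _.
by rewrite /= !imM !re_conj !im_conj; ring.
Qed.

Lemma re_L2ip_ge0 (v : L2space Om) : 0 <= re (L2ip v v).
Proof.
apply: Rintegral_ge0 => x _; rewrite mulr_conj/=.
by rewrite addr_ge0 ?sqr_ge0.
Qed.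

Context (W : lmodType C) (ipW : {dot W for Num.conj}).

Lemma ipH_lin (a : C) (u v w : W * L2space Om) :
  ipH Om ipW (a *: u + v) w = a * ipH Om ipW u w + ipH Om ipW v w.
Proof. by rewrite /ipH /= L2ip_lin linearPl /=; ring. Qed.

Lemma ipHC (u v : W * L2space Om) : ipH Om ipW v u = Num.conj (ipH Om ipW u v).
Proof.
rewrite /ipH (L2ipC u.2) [ipW v.1 _]hermC expr0 mul1r.
by rewrite rmorphD.
Qed.

Lemma re_ipH_ge0 (u : W * L2space Om) : 0 <= re (ipH Om ipW u u).
Proof.
rewrite /ipH reD addr_ge0 ?re_L2ip_ge0//.
have : 0 <= ipW u.1 u.1 by exact: dnorm_ge0.
by case: (ipW _ _) => a b; rewrite lecE => /andP[].
Qed.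

End L2ip.

(** * Quasi-modes *)

Section cutoff.
Context {R : realType}.

(* The shape a * f (b * y + c) is the one of [derive1_affine_comp]. *)
Definition cutoff (m rho y : R) : R := 1 * plateau (rho^-1 * y + - m / rho).

Lemma cutoff_arg (m rho y : R) : rho^-1 * y + - m / rho = (y - m) / rho.
Proof. by ring. Qed.

Lemma smooth1_cutoff m rho : smooth1 (cutoff m rho).
Proof. by apply: smooth1_affine_comp; exact: smooth1_plateau. Qed.

Lemma cutoff01 m rho y : 0 <= cutoff m rho y <= 1.
Proof. by rewrite /cutoff mul1r plateau01. Qed.

Lemma cutoff_norm m rho y : `|cutoff m rho y| <= 1.
Proof. by have /andP[h1 h2] := cutoff01 m rho y; rewrite ger0_norm. Qed.

Lemma cutoff_out m rho y : 0 < rho -> rho <= `|y - m| -> cutoff m rho y = 0.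
Proof.
move=> r0 h; rewrite /cutoff plateau0 ?mulr0// cutoff_arg normrM normfV (gtr0_norm r0).
by rewrite ler_pdivlMr// mul1r.
Qed.

(** A quarter of the width stays strictly inside the plateau, which occupies half of it; hence the
    cutoff is locally constant there. *)
Lemma cutoff_in m rho y : 0 < rho -> `|y - m| <= rho / 4 ->
  cutoff m rho y = 1 /\ derive1 (cutoff m rho) y = 0.
Proof.
move=> r0 h.
have h' : `|rho^-1 * y + - m / rho| < 2^-1.
  rewrite cutoff_arg normrM normfV (gtr0_norm r0) ltr_pdivrMr//; lra.
rewrite derive1_affine_compE; last exact: smooth1_plateau.
split; first by rewrite /cutoff plateau1 ?mulr1// ltW.
rewrite (@derive1_near_cst _ _ 1) ?mulr0//; near=> z; apply: plateau1; apply: ltW.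
near: z; have : (fun z : R => `|z|) @ (rho^-1 * y + - m / rho) --> `|rho^-1 * y + - m / rho|.
  by apply: norm_continuous.
by move=> /cvgr_lt/(_ _ h').
Unshelve. all: by end_near. Qed.

Lemma cutoff_bounds : exists K : R, 1 <= K /\ forall m rho y, 0 < rho ->
  `|derive1 (cutoff m rho) y| <= K / rho /\
  `|derive1 (derive1 (cutoff m rho)) y| <= K / rho ^+ 2.
Proof.
have [K [K1 h1 h2]] := @plateau_bounds R; exists K; split => // m rho y r0.
have s := @smooth1_plateau R; rewrite !derive1_affine_compE//; last exact: smooth1_derive1.
have ri : 0 < rho^-1 by rewrite invr_gt0.
split; first by rewrite mul1r normrM (gtr0_norm ri) mulrC ler_wpM2r// ltW.
by rewrite mul1r !normrM (gtr0_norm ri) mulrC expr2 invfM ler_wpM2r// mulr_ge0// ltW.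
Qed.

End cutoff.

(** * Boxes and their volumes *)

Section boxes.
Context {R : realType} {n : nat}.
Local Notation T := 'rV[R]_n.
Local Notation mu := (@lebesgue_rv R n).

Definition rbox (m rho : 'I_n -> R) : set T :=
  [set x | forall i, `[m i - rho i, m i + rho i]%classic (x ord0 i)].

Lemma rboxE m rho x : rbox m rho x <-> forall i, `|x ord0 i - m i| <= rho i.
Proof.
by split=> h i; have := h i; rewrite /= in_itv/= ler_distl.
Qed.

Lemma compact_rbox m rho : compact (rbox m rho).
Proof. by apply: (@rV_compact R n (fun i => `[m i - rho i, m i + rho i]%classic)) => i; exact: segment_compact. Qed.

Lemma measurable_rbox m rho : measurable (rbox m rho).
Proof. exact: compact_measurable_rv (@compact_rbox m rho). Qed.

Lemma mu_rbox m rho : (forall i, 0 <= rho i) ->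
  mu (rbox m rho) = (\prod_(i < n) (2 * rho i))%:E.
Proof.
move=> r0; rewrite /rbox (lebesgue_rv_box (B := fun i => `[m i - rho i, m i + rho i]%classic))//.
rewrite -prodEFin; apply: eq_bigr => i _; rewrite lebesgue_measure_itv/= lte_fin.
case: ifPn => h; first by rewrite -EFinB; congr EFin; ring.
congr EFin; have := r0 i; move: h; rewrite -leNgt; lra.
Qed.

End boxes.

(** * Integrals of squared moduli *)

Section nsq.
Context {R : realType} {n : nat}.
Local Notation T := 'rV[R]_n.
Local Notation C := R[i].
Local Notation mu := (@lebesgue_rv R n).

Definition nsq (z : C) : R := complex.Re z ^+ 2 + complex.Im z ^+ 2.

Lemma nsq_ge0 z : 0 <= nsq z. Proof. by rewrite addr_ge0 ?sqr_ge0. Qed.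

Lemma nsq0 : nsq 0 = 0. Proof. by rewrite /nsq/= expr0n addr0. Qed.

Context (Om : set T) (oOm : open Om).
Let mOm := mOm oOm.

Lemma L2_nsq_integrable (F : T -> C) : L2 Om F ->
  mu.-integrable Om (EFin \o (fun x => nsq (F x))).
Proof.
move=> [/Lfun2_integrable_sqr fr /Lfun2_integrable_sqr fi].
have h (g : T -> \bar R) : mu.-integrable setT g -> mu.-integrable Om g by exact: integrableS.
have := integrableD mOm (h _ fr) (h _ fi).
by apply: eq_integrable => // x /set_mem Ox /=; rewrite /ext0 /patch mem_set.
Qed.

Lemma integral_supp (K : set T) (f : T -> \bar R) : measurable K -> K `<=` Om ->
  (forall x, ~ K x -> f x = 0%E) -> (\int[mu]_(x in Om) f x = \int[mu]_(x in K) f x)%E.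
Proof.
move=> mK KO f0; rewrite integral_mkcond [RHS]integral_mkcond.
apply: eq_integral => x _; rewrite !patchE.
case: ifPn => [/[!inE] Ox|]; case: ifPn => //.
  by rewrite notin_setE => /f0.
by move=> /set_mem/KO Ox; rewrite notin_setE.
Qed.

(** The pointwise bound is required only almost everywhere, because the decomposition with B that
    supplies it holds only almost everywhere. *)
Lemma Rintegral_nsq_le (K : set T) (F : T -> C) (c v : R) : L2 Om F ->
  measurable K -> K `<=` Om -> (forall x, ~ K x -> F x = 0) ->
  {ae mu, forall x, K x -> nsq (F x) <= c} -> 0 <= c -> mu K = v%:E ->
  \int[mu]_(x in Om) nsq (F x) <= c * v.
Proof.
move=> lF mK KO F0 Fc c0 muK.
have fF := integrable_fin_num mOm (L2_nsq_integrable lF).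
rewrite /Rintegral -lee_fin fineK//.
rewrite (integral_supp mK KO); last by move=> x /F0 ->; rewrite nsq0.
rewrite EFinM -muK -integral_cst//; apply: ae_ge0_le_integral => //.
- by move=> x _; rewrite lee_fin nsq_ge0.
- exact: measurable_int (integrableS mOm mK KO (L2_nsq_integrable lF)).
Qed.

Lemma Rintegral_nsq_ge (K : set T) (F : T -> C) (c v : R) : L2 Om F ->
  measurable K -> K `<=` Om -> (forall x, K x -> c <= nsq (F x)) -> 0 <= c ->
  mu K = v%:E -> c * v <= \int[mu]_(x in Om) nsq (F x).
Proof.
move=> lF mK KO Fc c0 muK.
have fF := integrable_fin_num mOm (L2_nsq_integrable lF).
rewrite /Rintegral -lee_fin fineK//.
apply: (@le_trans _ _ (\int[mu]_(x in K) (nsq (F x))%:E)%E).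
  rewrite EFinM -muK -integral_cst//; apply: ge0_le_integral => //.
  - exact: measurable_int (integrableS mOm mK KO (L2_nsq_integrable lF)).
apply: ge0_subset_integral => //.
- exact: measurable_int (L2_nsq_integrable lF).
- by move=> x _; rewrite lee_fin nsq_ge0.
Qed.

End nsq.

(** * The wave packet *)

Section wave_packet.
Context {R : realType} {n : nat}.
Local Notation T := 'rV[R]_n.+1.
Local Notation C := R[i].
Variables (th : R -> R) (s l r : R).
Hypotheses (sth : smooth1 th) (l0 : 0 < l) (r0 : 0 < r).

Definition packet_center (i : 'I_n.+1) : R := if i == ord0 then s else 0.
Definition packet_width (i : 'I_n.+1) : R := if i == ord0 then l else r.

Definition packet_box := rbox packet_center packet_width.
(** On this box every cutoff is 1 with zero derivative, and its share of the volume of [packet_box]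
    depends on the dimension only. *)
Definition packet_core := rbox packet_center (fun i => packet_width i / 4).

(** This is [exp (i th(x_1))] times the cutoffs, written so that the real and imaginary parts are
    separately tensor products of smooth functions of one variable. *)
Definition packet : T -> C := fun x => Complex
  (tensor (profile (fun y => cos (th y) * cutoff s l y) (cutoff 0 r)) x)
  (tensor (profile (fun y => sin (th y) * cutoff s l y) (cutoff 0 r)) x).

Let su := @smooth1_cutoff R s l.
Let sc := smooth1_comp (@smooth1_cos_sin R).1 sth.
Let ss := smooth1_comp (@smooth1_cos_sin R).2 sth.
Let sgc : smooth1 (fun y => cos (th y) * cutoff s l y) := smooth1M sc su.
Let sgs : smooth1 (fun y => sin (th y) * cutoff s l y) := smooth1M ss su.
Let schi := @smooth1_cutoff R 0 r.

Lemma packet_boxE x : packet_box x <-> `|x ord0 ord0 - s| <= l /\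
  forall j : 'I_n, `|x ord0 (lift ord0 j)| <= r.
Proof.
rewrite /packet_box rboxE; split=> [h|[h1 h2] i].
  split; first exact: h ord0.
  by move=> j; have := h (lift ord0 j); rewrite /packet_center /packet_width /= subr0.
rewrite /packet_center /packet_width; case: (unliftP ord0 i) => [j ->|->]//=.
by rewrite subr0.
Qed.

Lemma packet_supp x : ~ packet_box x -> packet x = 0.
Proof.
move=> bx; have [i hi] : exists i, packet_width i < `|x ord0 i - packet_center i|.
  apply: contrapT => h; apply: bx; apply/rboxE => i; rewrite leNgt; apply/negP => hi.
  by apply: h; exists i.
have H (g : R -> R) : tensor (profile (fun y => g y * cutoff s l y) (cutoff 0 r)) x = 0.
  rewrite /tensor (bigD1 i)//= [X in X * _](_ : _ = 0) ?mul0r//.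
  move: hi; rewrite /profile /packet_width /packet_center; case: eqP => _ hi.
    by rewrite cutoff_out ?mulr0// ltW.
  by rewrite cutoff_out// ltW.
by rewrite /packet !H.
Qed.

Lemma packet_testfun (Om : set T) : packet_box `<=` Om -> testfun Om packet.
Proof.
move=> bO; split.
- by apply: smooth_tensor => i; apply: smooth1_profile.
- by apply: smooth_tensor => i; apply: smooth1_profile.
- exists packet_box; split=> //; first exact: compact_rbox.
  exact: packet_supp.
Qed.

Lemma packet_helmholtz (K a E : R) (x : T) : 0 <= K ->
  (forall m rho y, 0 < rho ->
  `|derive1 (cutoff m rho) y| <= K / rho /\
  `|derive1 (derive1 (cutoff m rho)) y| <= K / rho ^+ 2) ->
  `|a - derive1 th (x ord0 ord0) ^+ 2| + `|derive1 (derive1 th) (x ord0 ord0)| +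
  2 * (`|derive1 th (x ord0 ord0)| * (K / l)) + K / l ^+ 2 + n%:R * (K / r ^+ 2) <= E ->
  `|complex.Re (laplacian packet x) + a * complex.Re (packet x)| <= E /\
  `|complex.Im (laplacian packet x) + a * complex.Im (packet x)| <= E.
Proof.
move=> K0 hK hE.
have reS (F : 'I_n.+1 -> C) : complex.Re (\sum_i F i) = \sum_i complex.Re (F i).
  by apply: (big_ind2 (fun z y => complex.Re z = y)) => // z1 y1 z2 y2 <- <-; rewrite reD.
have imS (F : 'I_n.+1 -> C) : complex.Im (\sum_i F i) = \sum_i complex.Im (F i).
  by apply: (big_ind2 (fun z y => complex.Im z = y)) => // z1 y1 z2 y2 <- <-; rewrite imD.
have b1 (f : R -> R) : (forall y, `|f y| <= 1) -> forall y, `|f (th y) * cutoff s l y| <= 1.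
  by move=> h y; rewrite normrM mulr_ile1// cutoff_norm.
have [d1 d2] := hK s l (x ord0 ord0) l0.
have [cc cs] := @smooth1_cos_sin R.
rewrite /laplacian reS imS; split; apply: le_trans hE.
  apply: (profile_bound sgc schi).
  - exact: (b1 cos (@normr_cos_le1 R)).
  - exact: cutoff_norm.
  - by move=> y; have [] := hK 0 r y r0.
  apply: (@wave_bound _ th _ sth su cos (fun y => - sin y)) => //.
  - by rewrite -derive1_cosE; exact: smooth1_derive1.
  - exact: derive1_cosE.
  - exact: derive1_funE.
  - exact: normr_cos_le1.
  - by move=> y; rewrite normrN normr_sin_le1.
  - exact: cutoff01.
apply: (profile_bound sgs schi).
- exact: (b1 sin (@normr_sin_le1 R)).
- exact: cutoff_norm.
- by move=> y; have [] := hK 0 r y r0.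
apply: (@wave_bound _ th _ sth su sin cos) => //.
- exact: derive1_sinE.
- exact: derive1_cosE.
- exact: normr_sin_le1.
- exact: normr_cos_le1.
- exact: cutoff01.
Qed.

(** The cutoffs drop out on the core, and the derivative of [exp (i th)] is [i th' exp (i th)]. *)
Lemma packet_core_nsq_grad x : packet_core x ->
  nsq (cpd ord0 packet x) = derive1 th (x ord0 ord0) ^+ 2.
Proof.
move=> /rboxE hx.
have [u1 du] := cutoff_in l0 (hx ord0).
have P1 : \prod_(k : 'I_n.+1 | k != ord0) cutoff 0 r (x ord0 k) = 1.
  apply: big1 => k k0; apply: (cutoff_in r0 _).1.
  by have := hx k; rewrite /packet_center /packet_width (negbTE k0).
have [cc cs] := @smooth1_cos_sin R.
rewrite /nsq /cpd /=.
rewrite (pd_profile0 sgc schi) (pd_profile0 sgs schi) !P1.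
rewrite (derive1_wave sth su cc (derive1_cosE)) (derive1_wave sth su cs (derive1_sinE)).
rewrite u1 du !mulr0 !addr0 !mulr1 !exprMn sqrrN -mulrDl [X in X * _]addrC cos2Dsin2.
by rewrite mul1r.
Qed.

Lemma packet_norm x : `|complex.Re (packet x)| <= 1 /\ `|complex.Im (packet x)| <= 1.
Proof.
have H (g : R -> R) : (forall y, `|g y| <= 1) ->
    `|tensor (profile (fun y => g y * cutoff s l y) (cutoff 0 r)) x| <= 1.
  move=> h; rewrite /tensor normr_prod; apply: prodr_ile1 => i _.
  rewrite normr_ge0/= /profile; case: ifP => _; last exact: cutoff_norm.
  by rewrite normrM mulr_ile1// cutoff_norm.
by split; apply: H => y; rewrite (normr_cos_le1, normr_sin_le1).
Qed.

End wave_packet.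

(** * The quasi-mode estimate *)

Section quasimode.
Context {R : realType} {n : nat}.
Local Notation T := 'rV[R]_n.+1.
Local Notation C := R[i].
Local Notation mu := (@lebesgue_rv R n.+1).

(** Here [L = A(s)^{1/2}], [f = A(x_1)^{1/2}], p and p1 are th' and th'' at x_1, [N = n / r ^ 2],
    and the longitudinal scale is 1/k. As [1 <= L], the bound [k <= 6^-1] gives
    [p >= 2 / 3 * L - 6^-1 >= L / 2]. The five terms contribute 4, M, 6 K, K and K. *)
Lemma wave_arith (k L f p p1 M K N : R) : 0 < k -> k <= 6^-1 -> 1 <= L -> 1 <= K ->
  2 / 3 * L <= f <= 4 / 3 * L -> `|p - f| <= k -> `|p1| <= M * (k * L) -> N <= k * L ->
  `|f ^+ 2 - p ^+ 2| + `|p1| + 2 * (`|p| * (K * k)) + K * k ^+ 2 + K * N <=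
    k * L * (4 + M + 8 * K) /\ L / 2 <= p.
Proof.
move=> k0 k1 L1 K1 /andP[f1 f2]; rewrite ler_distl => /andP[p1' p2] hp1 hN.
have pL : L / 2 <= p by lra.
split=> //.
have pn : `|p| <= 3 * L by rewrite ger0_norm; lra.
have h1 : `|f ^+ 2 - p ^+ 2| <= k * L * 4.
  rewrite subr_sqr normrM -mulrA; apply: ler_pM => //.
    by rewrite ler_norml; apply/andP; split; lra.
  by rewrite ger0_norm; lra.
have kL : 0 < k * L by rewrite mulr_gt0//; lra.
have h2 : 2 * (`|p| * (K * k)) <= 6 * (K * (k * L)).
  rewrite (_ : 6 * (K * (k * L)) = 2 * (3 * L * (K * k))); last by ring.
  by rewrite ler_pM2l// ler_wpM2r// mulr_ge0; lra.
have h3 : K * k ^+ 2 <= K * (k * L).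
  by rewrite ler_pM2l ?expr2 ?ler_pM2l//; lra.
have h4 : K * N <= K * (k * L) by rewrite ler_pM2l//; lra.
rewrite (_ : k * L * (4 + M + 8 * K) = k * L * 4 + M * (k * L) + 6 * (K * (k * L)) + K * (k * L) + K * (k * L)); last by ring.
by apply: lerD => //; apply: lerD => //; apply: lerD => //; apply: lerD.
Qed.

(** The left side is the residual, the factor 2 counting real and imaginary parts; the right side is
    the gradient [L / 2] squared over the core. After cancelling [L ^ 2] and V the claim is
    [8 k ^ 2 C0 ^ 2 N4 <= eps], and [k ^ 2 <= k]. *)
Lemma error_arith (k L C0 N4 eps V : R) : 0 < k -> k <= 1 -> 0 < V -> 0 < N4 ->
  0 < C0 -> k <= eps / (8 * C0 ^+ 2 * N4) ->
  2 * (k * L * C0) ^+ 2 * V <= eps * (L ^+ 2 / 4 * (V / N4)).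
Proof.
move=> k0 k1 V0 N40 C00; rewrite ler_pdivlMr ?mulr_gt0 ?exprn_gt0// => h.
rewrite (_ : eps * _ = (eps / (8 * N4)) * (2 * L ^+ 2 * V)); last by field; rewrite gt_eqF.
rewrite (_ : 2 * _ ^+ 2 * V = (k * (k * C0 ^+ 2)) * (2 * L ^+ 2 * V)); last by ring.
apply: ler_wpM2r; first by rewrite mulr_ge0 ?(ltW V0)// mulr_ge0 ?sqr_ge0.
apply: (@le_trans _ _ (k * C0 ^+ 2)).
  by rewrite ler_piMl// mulr_ge0 ?sqr_ge0// ltW.
by rewrite ler_pdivlMr ?mulr_gt0//; apply: le_trans h; rewrite le_eqVlt; apply/orP; left; apply/eqP; ring.
Qed.

Variables (Om : set T) (a q : T -> R) (lam : R) (omega A : R -> R) (B : T -> R).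
Hypotheses (oOm : open Om) (la : L2loc Om a) (lq : L2loc Om q).
Hypothesis tO : tube omega `<=` Om.
Hypothesis decomp : {ae mu, forall x, tube omega x ->
  q x + 2 * lam * a x + lam ^+ 2 = - A (fst_coor x) + B x}.
Hypothesis smallB : forall e : R, 0 < e -> exists k : nat,
  {ae mu, forall x, tube omega x -> k%:R < enorm x ->
    `|B x| ^+ 2 / A (fst_coor x) <= e}.
Hypothesis window : forall k l s0 : R, 0 < k -> 0 < l -> exists s r : R,
    let f u := Num.sqrt (A u) in
    [/\ 0 < s - l, s0 < s - l, 0 < r &
    [/\ k^-1 <= f s, forall u, s - l <= u <= s + l -> 0 < A u,
      forall u, s - l <= u <= s + l -> 2 / 3 * f s <= f u <= 4 / 3 * f s,
      forall u v, s - l <= u <= s + l -> s - l <= v <= s + l ->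
        `|f u - f v| <= k * f s * `|u - v| &
      (forall x : 'rV[R]_n.+1, `|x ord0 ord0 - s| <= l ->
        (forall j : 'I_n, `|x ord0 (lift ord0 j)| <= r) -> tube omega x) /\
      n%:R / r ^+ 2 <= k * f s]].

(* The second component of (G - lam)(phi, lam phi); the first one is 0. *)
Definition residual (phi : T -> C) : T -> C := fun x =>
  laplacian phi x - (q x + 2 * lam * a x + lam ^+ 2)%:C * phi x.

Lemma residual_L2 phi : testfun Om phi -> L2 Om (residual phi).
Proof.
move=> tp.
have h1 := L2_linear ((2 * lam)%:C) (L2_mulop oOm la tp) (L2_mulop oOm lq tp).
have h2 := L2_linear ((lam ^+ 2)%:C) (testfun_L2 oOm tp) h1.
have := L2_linear (-1) h2 (testfun_L2 oOm (testfun_laplacian tp)).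
congr L2; apply/funext => x; rewrite /residual /mulop.
by apply: complexP; rewrite !(reM, imM, reD, imD, reN, imN)/=; ring.
Qed.

Lemma enorm_ge_coor (x : T) i : `|x ord0 i| <= enorm x.
Proof.
rewrite /enorm -sqrtr_sqr ler_wsqrtr// (bigD1 i)//= lerDl.
by apply: sumr_ge0 => j _; rewrite sqr_ge0.
Qed.

(** The strip [s0 < x_1 < s1] is recorded so that quasi-modes can later be placed one behind the
    other. Comparing with the single derivative along the ray is enough, since the norm in H
    dominates it. *)
Lemma quasimode (eps s0 : R) : 0 < eps -> exists (phi : T -> C) (s1 : R), [/\ testfun Om phi,
  forall x : T, ~ (s0 < x ord0 ord0 < s1) -> phi x = 0,
  0 < \int[mu]_(x in Om) nsq (cpd ord0 phi x) &
  \int[mu]_(x in Om) nsq (residual phi x) <=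
    eps * \int[mu]_(x in Om) nsq (cpd ord0 phi x)].
Proof.
move=> eps0.
have [K [K1 hK]] := @cutoff_bounds R.
have [M [M1 phase]] := @smooth_phase R.
(* The constant [4 + M + 8 * K] of [wave_arith], plus 2 for the term with B. *)
pose C0 := 6 + M + 8 * K.
have C00 : 0 < C0 by rewrite /C0; lra.
(* The ratio of the volumes of the box and its core. *)
pose N4 : R := \prod_(i < n.+1) 4.
have N40 : 0 < N4 by apply: prodr_gt0.
pose k := Num.min 6^-1 (eps / (8 * C0 ^+ 2 * N4)).
have k0 : 0 < k by rewrite lt_min divr_gt0 ?mulr_gt0 ?exprn_gt0// andbT invr_gt0.
have k6 : k <= 6^-1 by rewrite ge_min lexx.
have keps : k <= eps / (8 * C0 ^+ 2 * N4) by rewrite ge_min lexx orbT.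
have k2 : 0 < k ^+ 2 by rewrite exprn_gt0.
(* With tolerance [k ^+ 2] and [A(x_1)^{1/2} <= 2 * L] on the window, this gives
   [|B| <= 2 * (k * L)]. The window is started beyond kB, so that [kB < enorm x] throughout the
   box. *)
have [kB hB] := smallB k2.
have l0 : 0 < k^-1 by rewrite invr_gt0.
have [s [r [sl ssl r0 [fs Apos fW fL [tubeW nr]]]]] := window (Num.max s0 kB%:R) k0 l0.
set l := k^-1 in l0 sl ssl fs Apos fW fL tubeW.
set L := Num.sqrt (A s) in fs fW fL nr.
have L1 : 1 <= L.
  by apply: le_trans fs; rewrite /l -[leLHS]invr1 lef_pV2 ?posrE//; lra.
have se : s - l < s + l by lra.
have kL0 : 0 <= k * L by rewrite mulr_ge0 ?(ltW k0)//; lra.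
(* The Lipschitz constant [k * L] of [A^{1/2}] bounds th'' up to the factor M; the slope tolerance
   is an independent choice, set to k. *)
have [th [sth hth]] := phase (fun u => Num.sqrt (A u)) (s - l) (s + l) (k * L) se kL0 fL k k0.
pose phi := @packet R n th s l r.
have boxT : @packet_box R n s l r `<=` tube omega.
  by move=> x /packet_boxE[h1 h2]; exact: tubeW.
have boxO : @packet_box R n s l r `<=` Om by move=> x /boxT/tO.
have tphi : testfun Om phi := packet_testfun sth l0 r0 boxO.
have psupp := @packet_supp R n th s l r l0 r0.
have boxx x : @packet_box R n s l r x -> s - l <= x ord0 ord0 <= s + l.
  by move=> /packet_boxE[+ _]; rewrite ler_distl.
have cbox := @compact_rbox R n.+1 (packet_center s) (packet_width l r).
have rho0 i : 0 < @packet_width R n l r i by rewrite /packet_width; case: ifP.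
pose V : R := \prod_(i < n.+1) (2 * packet_width l r i).
have V0 : 0 < V by apply: prodr_gt0 => i _; rewrite mulr_gt0.
have muV := @mu_rbox R n.+1 (packet_center s) (packet_width l r) (fun i => ltW (rho0 i)).
have muC : mu (@packet_core R n s l r) = (V / N4)%:E.
  rewrite mu_rbox; last by move=> i; rewrite divr_ge0// ltW.
  congr EFin; rewrite /V /N4 -prodf_div.
  by apply: eq_bigr => i _; rewrite mulrA.
have coreB : @packet_core R n s l r `<=` @packet_box R n s l r.
  move=> x /rboxE h; apply/rboxE => i; apply: le_trans (h i) _.
  by have := rho0 i; lra.
have arith x : @packet_box R n s l r x ->
  let p := derive1 th (x ord0 ord0) in
  `|A (x ord0 ord0) - p ^+ 2| + `|derive1 (derive1 th) (x ord0 ord0)| +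
  2 * (`|p| * (K / l)) + K / l ^+ 2 + n%:R * (K / r ^+ 2) <= k * L * (4 + M + 8 * K) /\
  L / 2 <= p.
  move=> bx p; have hx := boxx _ bx; have [hp1 hp2] := hth _ hx.
  have := wave_arith k0 k6 L1 K1 (fW _ hx) hp1 hp2 nr.
  rewrite sqr_sqrtr ?(ltW (Apos _ hx))//.
  by rewrite /l invrK exprVn invrK [n%:R * (K / _)]mulrCA.
have low : L ^+ 2 / 4 * (V / N4) <= \int[mu]_(x in Om) nsq (cpd ord0 phi x).
  apply: (Rintegral_nsq_ge oOm (F := cpd ord0 phi) _ _ _ _ _ muC).
  - apply: (testfun_L2 oOm); exact: (testfun_cpd ord0 tphi).
  - exact: measurable_rbox.
  - by move=> x /coreB/boxO.
  - move=> x cx; rewrite (packet_core_nsq_grad sth l0 r0 cx).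
    have [_ pL] := arith _ (coreB _ cx).
    rewrite (_ : L ^+ 2 / 4 = (L / 2) ^+ 2); last by field.
    by rewrite ler_sqr ?nnegrE//; lra.
  - by rewrite divr_ge0// sqr_ge0.
exists phi, (s + l + 1); split=> //.
- move=> x hx; apply: psupp => bx; apply: hx.
  have := boxx _ bx; move: ssl; rewrite gt_max => /andP[s0l _] /andP[h1 h2].
  by apply/andP; split; lra.
- by apply: lt_le_trans low; rewrite mulr_gt0// divr_gt0// exprn_gt0//; lra.
apply: (@le_trans _ _ (2 * (k * L * C0) ^+ 2 * V)); last first.
  apply: (@le_trans _ _ (eps * (L ^+ 2 / 4 * (V / N4)))); last by rewrite ler_pM2l.
  apply: error_arith => //; lra.
apply: (Rintegral_nsq_le oOm (residual_L2 tphi) _ boxO _ _ _ muV).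
- exact: measurable_rbox.
- move=> x bx; rewrite /residual [phi x]psupp// mulr0 subr0 /laplacian.
  have cl := compact_closed_rv cbox.
  apply: big1 => i _; exact: (cpd_supp i cl (cpd_supp i cl psupp) bx).
- apply: filterS2 decomp hB => x hd hb bx.
  have tx := boxT _ bx; rewrite /residual hd//.
  have hx := boxx _ bx.
  have [ha _] := arith _ bx.
  have [hr hi] := @packet_helmholtz R n th s l r sth l0 r0 K _ _ x (le_trans ler01 K1) hK ha.
  have xk : kB%:R < enorm x.
    apply: lt_le_trans (enorm_ge_coor x ord0); move: ssl; rewrite gt_max => /andP[_ h].
    apply: lt_le_trans (ler_norm _); move: hx => /andP[h1 _]; exact: lt_le_trans h h1.
  have Ax := Apos _ hx.
  have Bx : `|B x| <= 2 * (k * L).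
    have := hb tx xk; rewrite ler_pdivrMr// => hBA.
    have kL2 : 0 <= 2 * (k * L) by rewrite mulr_ge0.
    have L2 : 0 <= 2 * L by lra.
    rewrite -ler_sqr ?nnegrE//; apply: le_trans hBA _.
    have /andP[_ fu] := fW _ hx.
    rewrite (_ : (2 * (k * L)) ^+ 2 = k ^+ 2 * (2 * L) ^+ 2); last by ring.
    rewrite ler_pM2l// -(sqr_sqrtr (ltW Ax)) ler_sqr ?nnegrE ?sqrtr_ge0//.
    by apply: le_trans fu _; lra.
  have [n1 n2] := @packet_norm R n th s l r x.
  have fin z w : `|z + A (x ord0 ord0) * w| <= k * L * (4 + M + 8 * K) -> `|w| <= 1 ->
      (z - (- A (fst_coor x) + B x) * w) ^+ 2 <= (k * L * C0) ^+ 2.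
    move=> h1 h2; rewrite -real_normK ?num_real// ler_sqr ?nnegrE ?(mulr_ge0 kL0 (ltW C00))//.
    rewrite (_ : z - _ = (z + A (x ord0 ord0) * w) - B x * w); last by rewrite /fst_coor; ring.
    apply: le_trans (ler_normB _ _) _.
    rewrite (_ : k * L * C0 = k * L * (4 + M + 8 * K) + 2 * (k * L)); last by rewrite /C0; ring.
    by apply: lerD => //; rewrite normrM; apply: le_trans Bx; rewrite ler_piMr.
  rewrite /nsq !(reD, imD, reN, imN, reM, imM)/= !mul0r subr0 addr0 (_ : 2 * _ = (k * L * C0) ^+ 2 + (k * L * C0) ^+ 2); last by ring.
  by apply: lerD; apply: fin.
- by rewrite mulr_ge0// sqr_ge0.
Qed.

End quasimode.

(** * The singular sequence *)

Section graph.
Context {R : realType} {n : nat}.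
Local Notation T := 'rV[R]_n.+1.
Local Notation C := R[i].
Local Notation re := (@complex.Re R).
Local Notation im := (@complex.Im R).
Local Notation mu := (@lebesgue_rv R n.+1).
Variables (Om : set T) (a q : T -> R).
Hypotheses (oOm : open Om) (la : L2loc Om a) (lq : L2loc Om q) (l1q : L1loc Om q).
Variables (W : lmodType C) (ipW : {dot W for Num.conj}) (J : (T -> C) -> W).
Hypothesis WJ : isWcompletion Om q ipW J.
Variable (lam : R).

Definition L2cls (F : T -> C) (h : L2 Om F) : L2space Om :=
  (\pi_(L2space Om) (@MkL2fun R n.+1 Om F (asboolT h)))%qT.

Lemma L2cls_lin (c : C) (F G H : T -> C) (hF : L2 Om F) (hG : L2 Om G) (hH : L2 Om H) :
  (forall x, H x = c * F x + G x) -> L2cls hH = c *: L2cls hF + L2cls hG.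
Proof.
move=> HE; rewrite /L2cls.
rewrite [c *: _](L2scale_pi c) -pi_addr; congr (\pi_(L2space Om) _)%qT.
by apply: val_inj; apply/funext => x /=; exact: HE.
Qed.

Lemma L2clsZ (c : C) (F H : T -> C) (hF : L2 Om F) (hH : L2 Om H) :
  (forall x, H x = c * F x) -> L2cls hH = c *: L2cls hF.
Proof.
move=> HE; rewrite /L2cls.
rewrite [c *: _](L2scale_pi c); congr (\pi_(L2space Om) _)%qT.
by apply: val_inj; apply/funext => x /=; exact: HE.
Qed.

Lemma L2ip_cls (F G : T -> C) (hF : L2 Om F) (hG : L2 Om G) :
  L2ip (L2cls hF) (L2cls hG) = cint Om (fun x => F x * Num.conj (G x)).
Proof. exact: L2ip_pi. Qed.

Lemma re_L2ip_cls (F : T -> C) (hF : L2 Om F) :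
  re (L2ip (L2cls hF) (L2cls hF)) = \int[mu]_(x in Om) nsq (F x).
Proof.
by rewrite L2ip_cls; apply: eq_Rintegral => x _; rewrite mulr_conj.
Qed.

(** Linearity of J is given on test functions; at 0 it reads [J 0 = J 0 + J 0]. *)
Lemma J0 : J (fun=> 0) = 0.
Proof.
have := Wlinear WJ 1 (testfun0 Om) (testfun0 Om).
under eq_fun do rewrite mulr0 addr0.
by rewrite scale1r => /eqP; rewrite -subr_eq0 opprD addNKr oppr_eq0 => /eqP.
Qed.

Lemma JZ (c : C) phi : testfun Om phi -> J (fun x => c * phi x) = c *: J phi.
Proof.
move=> tp; have := Wlinear WJ c tp (testfun0 Om).
by under eq_fun do rewrite addr0; rewrite J0 addr0.
Qed.

Lemma cvg_zero (f : nat -> R) : (forall k, f k = 0) -> f k @[k --> \oo] --> (0 : R).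
Proof. by move=> f0; rewrite (_ : f = fun=> 0); [exact: cvg_cst|exact/funext]. Qed.

Lemma ereal_cvg_zero (f : nat -> \bar R) : (forall k, f k = 0%E) -> f k @[k --> \oo] --> 0%E.
Proof. by move=> f0; rewrite (_ : f = fun=> 0%E); [exact: cvg_cst|exact/funext]. Qed.

Lemma inW_testfun phi : testfun Om phi -> inW Om q ipW J phi (J phi).
Proof.
move=> tp; split; first exact: (dom_mul_testfun oOm (L2loc_sqrtf oOm l1q) tp).
exists (fun i => cpd i phi); split; first exact: testfun_W012.
exists (fun=> phi); split=> //.
- by move=> i; apply: ereal_cvg_zero => k; rewrite l2norm0// => x /=; rewrite subrr.
- by apply: ereal_cvg_zero => k; rewrite l2norm0// => x /=; rewrite /mulop /= subrr mulr0.
- by apply: cvg_zero => k; rewrite subrr /ipnorm linear0l /= sqrtr0.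
Qed.

Lemma testfun_lam phi : testfun Om phi -> testfun Om (fun x => lam%:C * phi x).
Proof. exact: testfun_scale. Qed.

Definition state phi (tp : testfun Om phi) : W * L2space Om :=
  (J phi, L2cls (testfun_L2 oOm (testfun_lam tp))).

Lemma Gstate_L2 phi : testfun Om phi ->
  L2 Om (fun x => - (- laplacian phi x + mulop q phi x) -
    2 * mulop a (fun x => lam%:C * phi x) x).
Proof.
move=> tp.
have h1 := L2_linear (-2) (L2_mulop oOm la (testfun_lam tp))
   (testfun_L2 oOm (testfun_laplacian tp)).
have := L2_linear (-1) (L2_mulop oOm lq tp) h1.
by congr L2; apply/funext => x; ring.
Qed.

Definition Gstate phi (tp : testfun Om phi) : W * L2space Om :=
  (J (fun x => lam%:C * phi x), L2cls (Gstate_L2 tp)).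

Lemma G0_state phi (tp : testfun Om phi) : @G0 R n.+1 Om a q W ipW J (state tp, Gstate tp).
Proof.
exists phi, (fun x => lam%:C * phi x), (fun x => - laplacian phi x + mulop q phi x).
exists (fun x => - laplacian (fun x => lam%:C * phi x) x + mulop q (fun x => lam%:C * phi x) x).
have tl := testfun_lam tp; split.
- by split; [exact: schrodinger_testfun|exact: dom_mul_testfun].
- by split; [exact: schrodinger_testfun|exact: dom_mul_testfun].
- by split; [exact: inW_testfun|eexists; split; last by []].
- by split; [exact: inW_testfun|eexists; split; last by []].
Qed.

(** An operator is contained in its closure, by constant sequences. *)
Lemma G_state phi (tp : testfun Om phi) : G Om a q ipW J (state tp, Gstate tp).
Proof.
have z : ipnorm (ipH Om ipW) 0 = 0.
  rewrite /ipnorm /ipH linear0l add0r.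
  by rewrite (ip0l (@L2ip_lin R n.+1 Om oOm)) sqrtr0.
exists (fun=> (state tp, Gstate tp)); split; first by move=> _; exact: G0_state.
- by apply: cvg_zero => k; rewrite subrr.
- by apply: cvg_zero => k; rewrite subrr.
Qed.

Lemma re_formW phi : re (formW Om q phi phi) =
  \sum_i \int[mu]_(x in Om) nsq (cpd i phi x) +
  \int[mu]_(x in Om) nsq (mulop (sqrtf q) phi x).
Proof.
rewrite /formW reD; congr (_ + _); last first.
  by apply: eq_Rintegral => x _; rewrite mulr_conj.
rewrite (big_morph re reD (erefl : re 0 = 0)).
by apply: eq_bigr => i _; apply: eq_Rintegral => x _; rewrite mulr_conj.
Qed.

Lemma Rintegral_nsq_ge0 (F : T -> C) : 0 <= \int[mu]_(x in Om) nsq (F x).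
Proof. by apply: Rintegral_ge0 => x _; exact: nsq_ge0. Qed.

Lemma state_norm_ge phi (tp : testfun Om phi) :
  \int[mu]_(x in Om) nsq (cpd ord0 phi x) <= re (ipH Om ipW (state tp) (state tp)).
Proof.
rewrite /ipH /= reD re_L2ip_cls (Wisometric WJ tp tp) re_formW big_ord_recl.
rewrite -!addrA lerDl !addr_ge0 ?Rintegral_nsq_ge0//.
by apply: sumr_ge0 => i _; exact: Rintegral_nsq_ge0.
Qed.

Lemma stateZ (c : R) phi (tp : testfun Om phi) :
  state (testfun_scale c tp) = c%:C *: state tp.
Proof.
rewrite /state; congr pair; first exact: JZ.
by apply: L2clsZ => x; rewrite mulrCA.
Qed.

(** The sets are closed so that the derivatives vanish outside them too; then every integrand of the
    inner product is identically 0. *)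
Lemma state_orth (K K' : set T) phi eta (tp : testfun Om phi) (te : testfun Om eta) :
  closed K -> closed K' -> (forall x, ~ K x -> phi x = 0) ->
  (forall x, ~ K' x -> eta x = 0) -> (forall x, K x -> ~ K' x) ->
  ipH Om ipW (state tp) (state te) = 0.
Proof.
move=> cK cK' hp he KK'.
have Z (F G : T -> C) : (forall x, ~ K x -> F x = 0) -> (forall x, ~ K' x -> G x = 0) ->
    cint Om (fun x => F x * Num.conj (G x)) = 0.
  move=> F0 G0; rewrite -[RHS](@cint0 R n.+1 Om); apply: eq_cint => x _.
  have [Kx|Kx] := pselect (K x); last by rewrite F0// mul0r.
  by rewrite G0 ?rmorph0 ?mulr0//; exact: KK'.
rewrite /ipH /= L2ip_cls (Wisometric WJ tp te) /formW big1; last first.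
  by move=> i _; apply: Z; exact: cpd_supp.
rewrite !Z ?addr0// => x h; by rewrite ?hp ?he /mulop ?mulr0// ?hp ?he ?mulr0.
Qed.

(** Homogeneity of J cancels the W component, so only the L^2 norm of the residual remains. *)
Lemma Gstate_sub phi (tp : testfun Om phi) :
  ipnorm (ipH Om ipW) (Gstate tp - lam%:C *: state tp) =
  Num.sqrt (\int[mu]_(x in Om) nsq (residual a q lam phi x)).
Proof.
have hr := @residual_L2 _ _ Om a q lam oOm la lq phi tp.
have -> : Gstate tp - lam%:C *: state tp = (0, L2cls hr).
  rewrite /Gstate /state; congr pair; first by rewrite /= JZ// subrr.
  rewrite /= -scaleNr addrC; apply/esym/L2cls_lin => x.
  by rewrite /residual /mulop; apply: complexP; rewrite !(reM, imM, reD, imD, reN, imN)/=; ring.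
by rewrite /ipnorm /ipH /= linear0l add0r re_L2ip_cls.
Qed.

Lemma residualZ (c : R) phi : testfun Om phi ->
  residual a q lam (fun x => c%:C * phi x) = fun x => c%:C * residual a q lam phi x.
Proof.
move=> tp; apply/funext => x; rewrite /residual (laplacian_scale c tp).
by rewrite mulrBr [in RHS]mulrCA.
Qed.

Lemma Rintegral_nsqZ (c : R) (F : T -> C) : L2 Om F ->
  \int[mu]_(x in Om) nsq (c%:C * F x) = c ^+ 2 * \int[mu]_(x in Om) nsq (F x).
Proof.
move=> lF; rewrite -(RintegralZl _ (mOm oOm) (L2_nsq_integrable oOm lF)).
by apply: eq_Rintegral => x _; rewrite /nsq reM imM/=; ring.
Qed.

Lemma singular_sequence : (forall eps s0 : R, 0 < eps ->
    exists (phi : T -> C) (s1 : R), [/\ testfun Om phi,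
      forall x : T, ~ (s0 < x ord0 ord0 < s1) -> phi x = 0,
      0 < \int[mu]_(x in Om) nsq (cpd ord0 phi x) &
      \int[mu]_(x in Om) nsq (residual a q lam phi x) <=
        eps * \int[mu]_(x in Om) nsq (cpd ord0 phi x)]) ->
  sigma_e2 (ipH Om ipW) (G Om a q ipW J) lam%:C.
Proof.
move=> quasi.
have quasi' (p : nat * R) : exists y : (T -> C) * R, [/\ testfun Om y.1,
      forall x : T, ~ (p.2 < x ord0 ord0 < y.2) -> y.1 x = 0,
      0 < \int[mu]_(x in Om) nsq (cpd ord0 y.1 x) &
      \int[mu]_(x in Om) nsq (residual a q lam y.1 x) <=
        p.1.+1%:R^-1 * \int[mu]_(x in Om) nsq (cpd ord0 y.1 x)].
  have [|phi [s1 h]] := quasi p.1.+1%:R^-1 p.2; first by rewrite invr_gt0.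
  by exists (phi, s1).
have [F hF] := choice quasi'.
(* Each strip starts at least 1 beyond the end of the previous one; K stops 1 short of the next
   start, so the closed strips are disjoint. The maximum with [s k'] makes s increasing without
   asking whether a strip is nonempty. *)
pose s := fix s k := if k is k'.+1 then Num.max (F (k', s k')).2 (s k') + 1 else 0.
pose phi k := (F (k, s k)).1.
pose K k : set T := [set x | s k <= x ord0 ord0 <= s k.+1 - 1].
have sS k : s k + 1 <= s k.+1 by rewrite /= lerD2r le_max lexx orbT.
have sM k l : (k <= l)%N -> s k <= s l.
  move=> /subnK <-; elim: (l - k)%N => [|m IH]; first exact: lexx.
  by rewrite addSn; apply: le_trans IH _; apply: le_trans (sS _); rewrite lerDl.
have cK k : closed (K k).
  have c0 : continuous (fun x : T => x ord0 ord0) by exact: coord_continuous.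
  have -> : K k = [set x : T | s k <= x ord0 ord0] `&` [set x : T | x ord0 ord0 <= s k.+1 - 1].
    by apply/seteqP; split => [x /andP[]//|x [h1 h2]]; exact/andP.
  apply: closedI.
  - exact: (@closed_comp _ _ (fun x : T => x ord0 ord0) [set y | s k <= y] (fun x _ => c0 x) (@closed_ge _ _)).
  - exact: (@closed_comp _ _ (fun x : T => x ord0 ord0) [set y | y <= s k.+1 - 1] (fun x _ => c0 x) (@closed_le _ _)).
have KK k l : (k < l)%N -> forall x, K k x -> ~ K l x.
  move=> kl x /andP[_ h1] /andP[h2 _].
  have := sM _ _ kl; have := le_trans h2 h1; lra.
have tphi k : testfun Om (phi k) by have [] := hF (k, s k).
have phiK k x : ~ K k x -> phi k x = 0.
  move=> Kx; have [_ h _ _] := hF (k, s k); apply: h => /andP[/= h1 h2]; apply: Kx.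
  rewrite /K /= (ltW h1) addrK le_max (ltW h2)//.
pose D k := \int[mu]_(x in Om) nsq (cpd ord0 (phi k) x).
pose Q k := re (ipH Om ipW (state (tphi k)) (state (tphi k))).
have D0 k : 0 < D k by have [] := hF (k, s k).
have DQ k : D k <= Q k by exact: state_norm_ge.
have Q0 k : 0 < Q k by apply: lt_le_trans (DQ k).
pose c k := (Num.sqrt (Q k))^-1.
have c2 k : c k ^+ 2 = (Q k)^-1 by rewrite exprVn sqr_sqrtr// ltW.
pose tpsi k := testfun_scale (c k) (tphi k).
have psiK k x : ~ K k x -> (c k)%:C * phi k x = 0 by move=> /phiK ->; rewrite mulr0.
have lip := @ipH_lin R n.+1 Om oOm W ipW.
have hip := @ipHC R n.+1 Om oOm W ipW.
have on k l : ipH Om ipW (state (tpsi k)) (state (tpsi l)) = (k == l)%:R.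
  case: (ltngtP k l) => [kl|lk|->].
  - exact: (state_orth (tpsi k) (tpsi l) (cK k) (cK l) (@psiK k) (@psiK l) (KK _ _ kl)).
  - by rewrite hip (state_orth (tpsi l) (tpsi k) (cK l) (cK k) (@psiK l) (@psiK k) (KK _ _ lk)) rmorph0.
  - by rewrite /tpsi stateZ (ip_sqZ lip hip) -/(Q l) c2 mulVf ?gt_eqF.
exists (fun k => state (tpsi k)), (fun k => Gstate (tpsi k)); split.
- by move=> k; exact: G_state.
- by move=> k; rewrite /ipnorm on eqxx /= sqrtr1.
- move=> v; apply: (bessel_cvg0 lip hip _ v on).
  exact: re_ipH_ge0.
apply/cvgr0Pnorm_le => e e0.
have [N hN] : exists N : nat, forall k, (N <= k)%N -> k.+1%:R^-1 <= e ^+ 2.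
  exists (Num.truncn (e ^+ 2)^-1) => k hk.
  rewrite -[leRHS]invrK lef_pV2 ?posrE ?ltr0n ?invr_gt0 ?exprn_gt0//.
  by apply: ltW; apply: lt_le_trans (truncnS_gt _) _; rewrite ler_nat.
exists N => // k /= /hN hk.
rewrite Gstate_sub ger0_norm ?sqrtr_ge0// -[leRHS](ger0_norm (ltW e0)) -sqrtr_sqr.
rewrite ler_wsqrtr// residualZ// Rintegral_nsqZ; last exact: residual_L2.
(* Normalisation divides by the squared norm [Q k] in H, while the quasi-mode bound involves [D k];
   as [D k <= Q k], the quotient is at most 1 / (k + 1). *)
rewrite c2 ler_pdivrMl//; have [_ _ _ h] := hF (k, s k); apply: le_trans h _ => /=.
by rewrite [leRHS]mulrC; apply: ler_pM => //; [exact/ltW/D0|exact: DQ].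
Qed.

End graph.

(** * From essential suprema to bounds almost everywhere *)

Section smallness.
Context {R : realType} {n : nat}.
Local Notation mu := (@lebesgue_rv R n.+1).

Lemma ess_sup_small (S : set 'rV[R]_n.+1) (f : 'rV[R]_n.+1 -> R) (e : R) : 0 < e ->
  ess_sup_on (S `&` [set x | k%:R < enorm x]) f @[k --> \oo] --> 0%E ->
  exists k : nat, {ae mu, forall x, S x -> k%:R < enorm x -> f x <= e}.
Proof.
move=> e0 h.
have : nbhs (0%E : \bar R) [set y | (y < e%:E)%E].
  by apply: open_nbhs_nbhs; split; [exact: open_ereal_lt_ereal|rewrite /= lte_fin].
move=> /h [N _ hN]; exists N.
(* Outside the set the patched function is [-oo], so a bound on its essential supremum constrains f
   on the set only. *)
have /ltW/ess_supP := hN N (leqnn N).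
apply: filterS => x + Sx xN; rewrite /patch mem_set//= lee_fin; exact.
Qed.

End smallness.

Theorem theorem4p2 (R : realType) (n : nat)
    (Om : set 'rV[R]_n.+1) (a q : 'rV[R]_n.+1 -> R)
    (W : lmodType R[i]) (ipW : {dot W for Num.conj})
    (J : ('rV[R]_n.+1 -> R[i]) -> W)
    (lam : R) (omega A : R -> R) (B : 'rV[R]_n.+1 -> R) :
  open Om ->
  assumptionA Om a q ->
  L2loc Om q ->
  isWcompletion Om q ipW J ->
  lam < 0 ->
  ((0 < n)%N -> forall u, 0 < u -> 0 < omega u /\ {for u, continuous omega}) ->
  tube omega `<=` Om ->
  {ae @lebesgue_rv R n.+1, forall x, tube omega x ->
     q x + 2 * lam * a x + lam ^+ 2 = - A (fst_coor x) + B x} ->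
  C1pos A ->
  A u @[u --> +oo] --> +oo ->
  `|derive1 A u| / A u @[u --> +oo] --> (0 : R) ->
  ess_sup_on (tube omega `&` [set x | k%:R < enorm x])
    (fun x => `|B x| ^+ 2 / A (fst_coor x)) @[k --> \oo] --> 0%E ->
  ((0 < n)%N ->
    [/\ C2pos omega,
        derive1 omega u / omega u @[u --> +oo] --> (0 : R),
        exists M : R,
          \forall u \near +oo, `|derive1 (derive1 omega) u / omega u ^+ 3| <= M &
        omega u ^+ 4 / A u @[u --> +oo] --> (0 : R)]) ->
  sigma_e2 (ipH Om ipW) (G Om a q ipW J) lam%:C.
Proof.
move=> oOm [la l1q _ _] lq WJ _ om tO decomp cA Ay dA hB hom.
apply: (singular_sequence oOm la lq l1q WJ) => eps s0 eps0.
apply: (quasimode oOm la lq tO decomp) => //.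
  by move=> e e0; exact: ess_sup_small hB.
apply: tube_window => // n0; first by move=> u /(om n0)[].
by have [[]] := hom n0.
Qed.
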